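(* Let $X\subset(M,\pi)$ be a coregular submanifold of a Poisson manifold, with local Poisson saturation $(P,\pi_P)$. Choose a complement $W$ to $TX^{\perp_\pi}$ in $TM|_X$ and denote by $j:(TX^{\perp_\pi})^*\hookrightarrow T^*M|_X$ the corresponding inclusion. Then $-j^*(\Omega_\chi|_X)\in\mathcal{E}_W(-\sigma-\tau)$, where $\Omega_\chi|_X$ denotes the pullback of $\Omega_\chi$ to $\Sigma|_X$. Moreover, the corresponding local model $\big(U,\pi(W,-j^*(\Omega_\chi|_X))\big)$ is isomorphic with $(P,\pi_P)$ around $X$. Explicitly, a Poisson diffeomorphism onto a neighborhood of $X$ in $(P,\pi_P)$ is given by $$\exp_\chi\circ j:\big(U,\pi(W,-j^*(\Omega_\chi|_X))\big)\to(P,\pi_P),$$ for $U\subset j^{-1}(\Sigma|_X)$ a suitable neighborhood of the zero section $X\subset (TX^{\perp_\pi})^*$.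
   Context: Poisson conventions. $\pi^\sharp:T^*M\to TM$ is given by $\langle\pi^\sharp(\alpha),\beta\rangle=\pi(\alpha,\beta)$. For an embedded submanifold $i:X\hookrightarrow M$, $TX^\circ\subset T^*M|_X$ is the annihilator of $TX$ and $TX^{\perp_\pi}:=\pi^\sharp(TX^\circ)$. $X$ is coregular if $\mathrm{pr}\circ\pi^\sharp:T^*M|_X\to TM|_X/TX$ has constant rank; equivalently $TX^{\perp_\pi}$ has constant rank, and is then a vector subbundle of $TM|_X$. A Poisson submanifold is a submanifold $P$ with $\pi^\sharp(T^*M|_P)\subset TP$; it has an induced Poisson structure $\pi_P$. Sprays. A Poisson spray is a vector field $\chi$ on $T^*M$ with $\mathrm{d}\mathrm{pr}(\chi(\xi))=\pi^\sharp(\xi)$ for all $\xi\in T^*M$ and $m_t^*\chi=t\chi$ for all $t>0$, where $\mathrm{pr}:T^*M\to M$ is the projection and $m_t$ is fiberwise multiplication by $t$. Fix one. On a neighborhood $\Sigma\subset T^*M$ of the zero section its flow $\phi^t_\chi$ is defined for $t\in[0,1]$; put $\exp_\chi:\Sigma\to M$, $\exp_\chi(\xi)=\mathrm{pr}(\phi^1_\chi(\xi))$, and $\Omega_\chi=\int_0^1(\phi_\chi^t)^*\omega_{can}\,\mathrm{d}t$, where $\omega_{can}=\sum_i \mathrm{d}q^i\wedge \mathrm{d}p_i$ is the canonical symplectic form on $T^*M$. $\Sigma$ is taken small enough that $\Omega_\chi$ is symplectic on $\Sigma$, and that $\mathrm{pr}:(\Sigma,\Omega_\chi)\to(M,\pi)$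 and $\exp_\chi:(\Sigma,\Omega_\chi)\to(M,-\pi)$ form a full dual pair (surjective Poisson submersions with $\Omega_\chi$-orthogonal fibers: $(\ker\mathrm{d}\mathrm{pr})^{\perp_{\Omega_\chi}}=\ker\mathrm{d}\exp_\chi$; the Poisson structure $\Omega_\chi^{-1}$ satisfies $L_{\Omega_\chi^{-1}}=\{v+\iota_v\Omega_\chi\}$). Here $\Sigma|_X=\Sigma\cap T^*M|_X$. Local Poisson saturation. Shrinking $\Sigma$ if necessary, $P:=\exp_\chi(j((TX^{\perp_\pi})^* )\cap\Sigma)$ is an embedded Poisson submanifold containing $X$, $\exp_\chi\circ j$ is a diffeomorphism from $j^{-1}(\Sigma|_X)$ onto $P$, and $P=\exp_\chi(\Sigma|_X)$. $(P,\pi_P)$ is called the local Poisson saturation of $X$; (after shrinking) it is the union of the symplectic leaves of $(V,\pi|_V)$ meeting $X$, for some open neighborhood $V$ of $X$. Dirac notions. $L_\pi=\{\pi^\sharp(\alpha)+\alpha:\alpha\in T^*M\}$. For a map $\varphi$ into a Dirac manifold with Dirac structure $L$, $\varphi^!L=\{v+(\mathrm{d}\varphi)^*\beta:\mathrm{d}\varphi(v)+\beta\in L\}$; for $X$ coregular, $i^!L_\pi$ is a smooth Dirac structure on $X$. For a closed two-form $\eta$, $L^\eta=\{v+\alpha+\iota_v\eta:v+\alpha\in L\}$. A Dirac structure is Poisson on $U$ if it equals $L_{\pi'}$ there for some Poisson structure $\pi'$. Local model. A complement $W$ to $TX^{\perp_\pi}$ in $TM|_X$ induces an inclusion $j:(TX^{\perp_\pi})^*\hookrightarrow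 T^*M|_X$ with image $W^\circ$ (dual to the projection $TM|_X\to TX^{\perp_\pi}$ along $W$). On $T\big((TX^{\perp_\pi})^*\big)|_X=TX\oplus(TX^{\perp_\pi})^*$ define $\sigma\in\Gamma(\wedge^2TX^{\perp_\pi})$, $\tau\in\Gamma(T^*X\otimes TX^{\perp_\pi})$ by $\sigma(\xi_1,\xi_2)=\pi(j(\xi_1),j(\xi_2))$ and $\tau((v_1,\xi_1),(v_2,\xi_2))=\langle v_1,j(\xi_2)\rangle-\langle v_2,j(\xi_1)\rangle$. $\mathcal{E}_W(-\sigma-\tau)$ is the set of closed two-forms $\eta$ on a neighborhood of the zero section $X\subset(TX^{\perp_\pi})^*$ whose restriction along $X$ (as a bilinear form on $TX\oplus(TX^{\perp_\pi})^*$) is $\eta|_X=-\sigma-\tau$ (with zero component in $\Gamma(\wedge^2T^*X)$). With $\mathrm{pr}_X:(TX^{\perp_\pi})^*\to X$ the bundle projection, $(\mathrm{pr}_X^!(i^!L_\pi))^\eta$ is Poisson on a neighborhood $U$ of $X$; the resulting Poisson manifold is the local model $(U,\pi(W,\eta))$. *)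

(* Defs.v *)
From HB Require Import structures.
From mathcomp Require Import all_boot all_order all_algebra.
From mathcomp Require Import all_classical all_reals all_analysis.
Set Implicit Arguments.
Unset Strict Implicit.
Unset Printing Implicit Defensive.
Import Order.TTheory GRing.Theory Num.Theory.
Import numFieldNormedType.Exports.
Local Open Scope classical_set_scope.
Local Open Scope ring_scope.

(* Smooth maps on an open subset [A] of R^m. *)
Fixpoint Ck (R : realType) (m : nat) (V : normedModType R) (k : nat)
    (A : set 'rV[R]_m) (f : 'rV[R]_m -> V) : Prop :=
  match k with
  | 0 => forall x, A x -> {for x, continuous f}
  | k'.+1 => (forall x, A x -> differentiable f x) /\
             forall v : 'rV[R]_m, Ck k' A (fun x => 'D_v f x)
  end.

Definition Cinfty (R : realType) (m : nat) (V : normedModType R)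
    (A : set 'rV[R]_m) (f : 'rV[R]_m -> V) : Prop :=
  forall k, Ck k A f.

(* A space with charts.  The chart [a] is the map [fwd a] restricted to
   [dom a], and [bwd a] is its inverse on the image.  [pref x] is a chosen chart
   around [x]: the tangent space at [x] is 'rV_n, a tangent vector being given
   by its components in the chart [pref x].  Covectors at [x] are also elements
   of 'rV_n, given by their components in the dual basis. *)
Record premanifold (R : realType) (n : nat) := Premanifold {
  carrier :> Type;
  index : Type;
  dom : index -> set carrier;
  fwd : index -> carrier -> 'rV[R]_n;
  bwd : index -> 'rV[R]_n -> carrier;
  pref : carrier -> index }.

Arguments index {R n} p.
Arguments dom {R n p} _ _.
Arguments fwd {R n p} _ _.
Arguments bwd {R n p} _ _.
Arguments pref {R n p} _.

Section ChartTopology.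
Variables (R : realType) (n : nat) (M : premanifold R n).

HB.instance Definition _ := gen_eqMixin (carrier M).
HB.instance Definition _ := gen_choiceMixin (carrier M).

(* [bwd a @^-1` A] is open relatively to the image of the chart [a]. *)
Definition chart_open (A : set M) : Prop :=
  forall (a : index M) (z : 'rV[R]_n), (fwd a @` dom a) z -> A (bwd a z) ->
    \forall z' \near z, (fwd a @` dom a) z' -> A (bwd a z').

Lemma chart_openT : chart_open setT.
Proof. by move=> a z _ _; near=> z'. Unshelve. all: by end_near. Qed.

Lemma chart_openI (A B : set M) :
  chart_open A -> chart_open B -> chart_open (A `&` B).
Proof.
move=> hA hB a z az [Az Bz].
by apply: filterS2 (hA a z az Az) (hB a z az Bz) => z' h1 h2 d; split; auto.
Qed.

Lemma chart_open_bigU (I : Type) (f : I -> set M) :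
  (forall i, chart_open (f i)) -> chart_open (\bigcup_i f i).
Proof.
move=> h a z az [i _ fi]; apply: filterS (h i a z az fi) => z' h1 d.
by exists i => //; exact: h1.
Qed.

HB.instance Definition _ := isOpenTopological.Build (carrier M)
  chart_openT chart_openI chart_open_bigU.

End ChartTopology.

Record is_manifold (R : realType) (n : nat) (M : premanifold R n) : Prop := {
  mfd_pref : forall x : M, dom (pref x) x;
  mfd_fwdK : forall (a : index M) (x : M), dom a x -> bwd a (fwd a x) = x;
  mfd_open : forall a b : index M, open (fwd a @` (dom a `&` dom b));
  mfd_smooth : forall a b : index M,
    Cinfty (fwd a @` (dom a `&` dom b)) (fun z => fwd b (bwd a z));
  mfd_hausdorff : hausdorff_space M;
  mfd_countable : @second_countable M }.

Definition euclid (R : realType) (n : nat) : premanifold R n :=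
  @Premanifold R n 'rV[R]_n unit (fun _ => setT) (fun _ x => x) (fun _ x => x)
    (fun _ => tt).

Definition real_line (R : realType) : premanifold R 1 :=
  @Premanifold R 1 R unit (fun _ => setT) (fun _ t => const_mx t)
    (fun _ z => z 0 0) (fun _ => tt).

Definition prod_mfd (R : realType) (m n : nat) (M : premanifold R m)
    (N : premanifold R n) : premanifold R (m + n) :=
  @Premanifold R (m + n) (M * N)%type (index M * index N)%type
    (fun a x => dom a.1 x.1 /\ dom a.2 x.2)
    (fun a x => row_mx (fwd a.1 x.1) (fwd a.2 x.2))
    (fun a z => (bwd a.1 (lsubmx z), bwd a.2 (rsubmx z)))
    (fun x => (pref x.1, pref x.2)).

(* The map [f] is only considered on the open set [A]. *)
Definition smooth_map (R : realType) (m n : nat) (M : premanifold R m)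
    (N : premanifold R n) (A : set M) (f : M -> N) : Prop :=
  (forall B : set N, open B -> open (A `&` f @^-1` B)) /\
  forall (a : index M) (b : index N),
    Cinfty (fwd a @` (A `&` dom a `&` f @^-1` dom b))
           (fun z => fwd b (f (bwd a z))).

(* The matrix of the differential; it acts on tangent vectors by v |-> v *m _,
   and its dual on covectors by beta |-> beta *m _^T. *)
Definition dmap (R : realType) (m n : nat) (M : premanifold R m)
    (N : premanifold R n) (f : M -> N) (x : M) : 'M[R]_(m, n) :=
  jacobian (fun z => fwd (pref (f x)) (f (bwd (pref x) z))) (fwd (pref x) x).

Definition dfwd (R : realType) (n : nat) (M : premanifold R n) (a : index M)
  (x : M) : 'M[R]_n := @dmap R n n M (euclid R n) (fwd a) x.

Definition dbwd (R : realType) (n : nat) (M : premanifold R n) (a : index M)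
  (z : 'rV[R]_n) : 'M[R]_n := @dmap R n n (euclid R n) M (bwd a) z.

Definition velocity (R : realType) (n : nat) (M : premanifold R n)
    (c : R -> M) (t : R) : 'rV[R]_n :=
  derive1 (fun s => fwd (pref (c t)) (c s)) t.

Definition diffeo (R : realType) (m n : nat) (M : premanifold R m)
    (N : premanifold R n) (A : set M) (B : set N) (f : M -> N) : Prop :=
  [/\ open A, open B, set_bij A B f, smooth_map A f &
      exists g : N -> M, smooth_map B g /\ forall x, A x -> g (f x) = x].

Definition embedding (R : realType) (m n : nat) (M : premanifold R m)
    (N : premanifold R n) (f : M -> N) : Prop :=
  [/\ smooth_map setT f, forall x, row_free (dmap f x), injective f &
      forall A : set M, open A -> exists2 B : set N, open B & A = f @^-1` B].

Definition bil (R : realType) (m n : nat) (B : 'M[R]_(m, n)) (u : 'rV[R]_m)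
  (v : 'rV[R]_n) : R := (u *m B *m v^T) 0 0.

Definition pairing (R : realType) (n : nat) (al v : 'rV[R]_n) : R :=
  (al *m v^T) 0 0.

(* Smoothness on [A] of a section [u] of the pullback of TN by [f : M -> N]. *)
Definition smooth_section (R : realType) (m n : nat) (M : premanifold R m)
    (N : premanifold R n) (f : M -> N) (A : set M) (u : M -> 'rV[R]_n) : Prop :=
  forall (a : index M) (b : index N),
    Cinfty (fwd a @` (A `&` dom a `&` f @^-1` dom b))
           (fun z => u (bwd a z) *m dfwd b (f (bwd a z))).

Definition form_in_chart (R : realType) (n : nat) (M : premanifold R n)
    (a : index M) (w : M -> 'M[R]_n) (z : 'rV[R]_n) : 'M[R]_n :=
  dbwd a z *m w (bwd a z) *m (dbwd a z)^T.

Definition bivector_in_chart (R : realType) (n : nat) (M : premanifold R n)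
    (a : index M) (p : M -> 'M[R]_n) (z : 'rV[R]_n) : 'M[R]_n :=
  (dfwd a (bwd a z))^T *m p (bwd a z) *m dfwd a (bwd a z).

Definition pd (R : realType) (n : nat) (k : 'I_n) (f : 'rV[R]_n -> R)
  (z : 'rV[R]_n) : R := 'D_(delta_mx 0 k) f z.

Definition smooth_two_form (R : realType) (n : nat) (M : premanifold R n)
    (A : set M) (w : M -> 'M[R]_n) : Prop :=
  (forall x, A x -> (w x)^T = - w x) /\
  forall a : index M, Cinfty (fwd a @` (A `&` dom a)) (form_in_chart a w).

Definition closed_two_form (R : realType) (n : nat) (M : premanifold R n)
    (A : set M) (w : M -> 'M[R]_n) : Prop :=
  smooth_two_form A w /\
  forall (a : index M) (z : 'rV[R]_n), (fwd a @` (A `&` dom a)) z ->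
    forall k l h : 'I_n,
      pd k (fun y => form_in_chart a w y l h) z +
      pd l (fun y => form_in_chart a w y h k) z +
      pd h (fun y => form_in_chart a w y k l) z = 0.

Definition symplectic (R : realType) (n : nat) (M : premanifold R n)
    (A : set M) (w : M -> 'M[R]_n) : Prop :=
  closed_two_form A w /\ forall x, A x -> w x \in unitmx.

Definition pullback_form (R : realType) (m n : nat) (M : premanifold R m)
    (N : premanifold R n) (f : M -> N) (w : N -> 'M[R]_n) (x : M) : 'M[R]_m :=
  dmap f x *m w (f x) *m (dmap f x)^T.

(* [bil (p x) al be] is the value of the bivector on the covectors [al], [be]. *)
Definition sharp (R : realType) (n : nat) (M : premanifold R n)
    (p : M -> 'M[R]_n) (x : M) (al : 'rV[R]_n) : 'rV[R]_n := al *m p x.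

Definition poisson (R : realType) (n : nat) (M : premanifold R n) (A : set M)
    (p : M -> 'M[R]_n) : Prop :=
  [/\ forall x, A x -> (p x)^T = - p x,
      forall a : index M, Cinfty (fwd a @` (A `&` dom a)) (bivector_in_chart a p) &
      forall (a : index M) (z : 'rV[R]_n), (fwd a @` (A `&` dom a)) z ->
        forall k l h : 'I_n,
          \sum_(d < n)
            (bivector_in_chart a p z k d *
               pd d (fun y => bivector_in_chart a p y l h) z +
             bivector_in_chart a p z l d *
               pd d (fun y => bivector_in_chart a p y h k) z +
             bivector_in_chart a p z h d *
               pd d (fun y => bivector_in_chart a p y k l) z) = 0].

Definition poisson_map (R : realType) (m n : nat) (M : premanifold R m)
    (N : premanifold R n) (A : set M) (f : M -> N) (p : M -> 'M[R]_m)
    (q : N -> 'M[R]_n) : Prop :=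
  forall x, A x -> (dmap f x)^T *m p x *m dmap f x = q (f x).

(* With iota_v w = v *m w and pi^sharp(al) = al *m pi, the Poisson structure
   whose graph is {v + iota_v w} is the inverse matrix. *)
Definition inverse_form (R : realType) (n : nat) (M : premanifold R n)
    (w : M -> 'M[R]_n) (x : M) : 'M[R]_n := invmx (w x).

(* A family of subsets of the fibers of TM + T^*M. *)
Definition dirac_family (R : realType) (n : nat) (M : premanifold R n) :=
  M -> set ('rV[R]_n * 'rV[R]_n).

Definition graph (R : realType) (n : nat) (M : premanifold R n)
    (p : M -> 'M[R]_n) : dirac_family M :=
  fun x => [set u | u.1 = sharp p x u.2].

Definition dirac_pullback (R : realType) (m n : nat) (M : premanifold R m)
    (N : premanifold R n) (f : M -> N) (L : dirac_family N) : dirac_family M :=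
  fun x => [set u | exists2 be : 'rV[R]_n,
    L (f x) (u.1 *m dmap f x, be) & u.2 = be *m (dmap f x)^T].

Definition gauge (R : realType) (n : nat) (M : premanifold R n)
    (w : M -> 'M[R]_n) (L : dirac_family M) : dirac_family M :=
  fun x => [set u | exists2 al : 'rV[R]_n,
    L x (u.1, al) & u.2 = al + u.1 *m w x].

Definition cotangent (R : realType) (n : nat) (M : premanifold R n)
    : premanifold R (n + n) :=
  @Premanifold R (n + n) (M * 'rV[R]_n)%type (index M)
    (fun a xi => dom a xi.1)
    (fun a xi => row_mx (fwd a xi.1) (xi.2 *m (dbwd a (fwd a xi.1))^T))
    (fun a z => (bwd a (lsubmx z), rsubmx z *m (dfwd a (bwd a (lsubmx z)))^T))
    (fun xi => pref xi.1).

Definition cpr (R : realType) (n : nat) (M : premanifold R n)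
  (xi : cotangent M) : M := xi.1.

Definition cscale (R : realType) (n : nat) (M : premanifold R n) (t : R)
  (xi : cotangent M) : cotangent M := (xi.1, t *: xi.2).

(* dq /\ dp has the same matrix in all the charts induced by charts of [M]. *)
Definition omega_can (R : realType) (n : nat) (M : premanifold R n)
  (xi : cotangent M) : 'M[R]_(n + n) := block_mx 0 1%:M (- 1%:M) 0.

Definition poisson_spray (R : realType) (n : nat) (M : premanifold R n)
    (p : M -> 'M[R]_n) (chi : cotangent M -> 'rV[R]_(n + n)) : Prop :=
  [/\ smooth_section (fun xi : cotangent M => xi) setT chi,
      forall xi : cotangent M,
        chi xi *m dmap (@cpr R n M) xi = sharp p xi.1 xi.2 &
      forall (t : R) (xi : cotangent M), 0 < t ->
        chi (cscale t xi) = t *: (chi xi *m dmap (@cscale R n M t) xi)].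

Definition zero_nbhd (R : realType) (n : nat) (M : premanifold R n)
    (Sg : set (cotangent M)) : Prop :=
  open Sg /\ forall x : M, Sg (x, 0).

(* [phi] is the (smooth) flow of the vector field [chi], and is defined on
   [0, 1] on [Sg]. *)
Definition is_flow (R : realType) (n : nat) (N : premanifold R n)
    (chi : N -> 'rV[R]_n) (Sg : set N) (phi : R -> N -> N) : Prop :=
  exists D : set (prod_mfd (real_line R) N),
    [/\ open D,
        forall t xi, 0 <= t <= 1 -> Sg xi -> D (t, xi),
        smooth_map D (fun u : prod_mfd (real_line R) N => phi u.1 u.2),
        forall xi, Sg xi -> phi 0 xi = xi &
        forall t xi, D (t, xi) ->
          velocity (fun s => phi s xi) t = chi (phi t xi)].

Definition spray_exp (R : realType) (n : nat) (M : premanifold R n)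
    (phi : R -> cotangent M -> cotangent M) (xi : cotangent M) : M :=
  cpr (phi 1 xi).

Definition Omega (R : realType) (n : nat) (M : premanifold R n)
    (phi : R -> cotangent M -> cotangent M) (xi : cotangent M)
    : 'M[R]_(n + n) :=
  \matrix_(k, l) \int[@lebesgue_measure R]_(t in `[0, 1])
    pullback_form (phi t) (@omega_can R n M) xi k l.

Definition surj_submersion (R : realType) (m n : nat) (N : premanifold R m)
    (M : premanifold R n) (A : set N) (f : N -> M) : Prop :=
  [/\ smooth_map A f, f @` A = setT & forall x, A x -> row_full (dmap f x)].

Definition full_dual_pair (R : realType) (m n : nat) (N : premanifold R m)
    (M : premanifold R n) (A : set N) (w : N -> 'M[R]_m)
    (s t : N -> M) (ps pt : M -> 'M[R]_n) : Prop :=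
  [/\ surj_submersion A s /\ poisson_map A s (inverse_form w) ps,
      surj_submersion A t /\ poisson_map A t (inverse_form w) pt &
      forall x, A x -> forall u : 'rV[R]_m,
        (forall v : 'rV[R]_m, v *m dmap s x = 0 -> bil (w x) u v = 0) <->
        u *m dmap t x = 0].

Definition smooth_frame (R : realType) (k n r : nat) (X : premanifold R k)
    (M : premanifold R n) (i : X -> M) (S : X -> {vspace 'rV[R]_n})
    (V : set X) (s : X -> r.-tuple 'rV[R]_n) : Prop :=
  (forall x, V x -> basis_of (S x) (s x)) /\
  forall d : 'I_r, smooth_section i V (fun x => tnth (s x) d).

Definition subbundle (R : realType) (k n r : nat) (X : premanifold R k)
    (M : premanifold R n) (i : X -> M) (S : X -> {vspace 'rV[R]_n}) : Prop :=
  forall x : X, exists (V : set X) (s : X -> r.-tuple 'rV[R]_n),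
    [/\ open V, V x & smooth_frame i S V s].

(* The total space of the dual of the subbundle [S] of TM|_X, of rank [r].
   A chart (a, V, s) consists of a chart [a] of [X] and a smooth frame [s] of
   [S] over an open set [V] in its domain; a functional has for coordinates its
   values on the frame.  The triples which are not of this form are given the
   empty domain. *)
Section DualBundle.
Variables (R : realType) (k n r : nat) (X : premanifold R k).
Variables (M : premanifold R n) (i : X -> M) (S : X -> {vspace 'rV[R]_n}).

Definition dual_carrier : Type := {x : X & 'Hom(subvs_of (S x), R^o)}.

Definition dual_index : Type :=
  (index X * set X * (X -> r.-tuple 'rV[R]_n))%type.

Definition dual_dom (c : dual_index) : set dual_carrier :=
  [set e | [/\ open c.1.2, c.1.2 `<=` dom c.1.1, smooth_frame i S c.1.2 c.2 &
               c.1.2 (projT1 e)]].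

Definition dual_fwd (c : dual_index) (e : dual_carrier) : 'rV[R]_(k + r) :=
  row_mx (fwd c.1.1 (projT1 e))
    (\row_d projT2 e (vsproj (S (projT1 e)) (tnth (c.2 (projT1 e)) d))).

Definition frame_functional (s : X -> r.-tuple 'rV[R]_n) (y : 'rV[R]_r) (x : X)
    : 'Hom(subvs_of (S x), R^o) :=
  linfun (fun v : subvs_of (S x) =>
    (\sum_(d < r) y 0 d * coord (s x) d (vsval v)) : R^o).

Definition dual_bwd (c : dual_index) (z : 'rV[R]_(k + r)) : dual_carrier :=
  existT (fun x => 'Hom(subvs_of (S x), R^o)) (bwd c.1.1 (lsubmx z))
    (frame_functional c.2 (rsubmx z) (bwd c.1.1 (lsubmx z))).

Definition dual_pref (e : dual_carrier) : dual_index :=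
  @xget {classic dual_index}
    (pref (projT1 e), set0, fun=> [tuple of nseq r 0])
    [set c | dual_dom c e].

Definition dual_bundle : premanifold R (k + r) :=
  @Premanifold R (k + r) dual_carrier dual_index dual_dom dual_fwd dual_bwd
    dual_pref.

Definition dual_pt (x : X) (xi : 'Hom(subvs_of (S x), R^o)) : dual_bundle :=
  existT (fun x => 'Hom(subvs_of (S x), R^o)) x xi.

Definition dual_pr (e : dual_bundle) : X := projT1 e.

Definition zero_section (x : X) : dual_bundle := dual_pt (x := x) 0.

(* The inclusions of TX and of the fiber in the tangent space at the point [x]
   of the zero section. *)
Definition horizontal (x : X) (v : 'rV[R]_k) : 'rV[R]_(k + r) :=
  v *m dmap zero_section x.

Definition vertical (x : X) (xi : 'Hom(subvs_of (S x), R^o)) : 'rV[R]_(k + r) :=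
  velocity (fun t : R => dual_pt (x := x) (t *: xi)) 0.

End DualBundle.

Section LocalModel.
Variables (R : realType) (k n r : nat) (X : premanifold R k).
Variables (M : premanifold R n) (p : M -> 'M[R]_n) (i : X -> M).

Definition conormal (x : X) : {vspace 'rV[R]_n} :=
  lker (linfun (fun al : 'rV[R]_n => al *m (dmap i x)^T)).

Definition perp (x : X) : {vspace 'rV[R]_n} :=
  (linfun (sharp p (i x)) @: conormal x)%VS.

(* u |-> u *m cokermx A is the projection along the row space of A, up to an
   isomorphism of the quotient with its image; so this is the rank, equal to [r]
   at all points, of T^*M|_X -> TM|_X -> TM|_X / TX. *)
Definition coregular : Prop :=
  forall x : X, \rank (p (i x) *m cokermx (dmap i x)) = r.

Definition complement (W : X -> {vspace 'rV[R]_n}) : Prop :=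
  subbundle (n - r) i W /\
  forall x : X, (perp x + W x = fullv)%VS /\ (perp x :&: W x = 0)%VS.

Definition perp_dual : premanifold R (k + r) := dual_bundle r i perp.

Variable W : X -> {vspace 'rV[R]_n}.

(* The functional [xi] composed with the projection onto TX^{perp_pi} along
   [W]. *)
Definition jcov (x : X) (xi : 'Hom(subvs_of (perp x), R^o)) : 'rV[R]_n :=
  \row_(d < n) xi (vsproj (perp x) (daddv_pi (perp x) (W x) (delta_mx 0 d))).

Definition jmap (e : perp_dual) : cotangent M :=
  (i (projT1 e), jcov (projT2 e)).

Definition sigma (x : X) (xi1 xi2 : 'Hom(subvs_of (perp x), R^o)) : R :=
  bil (p (i x)) (jcov xi1) (jcov xi2).

Definition tau (x : X) (v1 : 'rV[R]_k) (xi1 : 'Hom(subvs_of (perp x), R^o))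
    (v2 : 'rV[R]_k) (xi2 : 'Hom(subvs_of (perp x), R^o)) : R :=
  pairing (jcov xi2) (v1 *m dmap i x) - pairing (jcov xi1) (v2 *m dmap i x).

(* [eta], defined on [A], belongs to E_W(- sigma - tau). *)
Definition extension (A : set perp_dual) (eta : perp_dual -> 'M[R]_(k + r))
    : Prop :=
  [/\ open A, forall x, A (zero_section r i perp x), closed_two_form A eta &
      forall (x : X) (v1 v2 : 'rV[R]_k)
             (xi1 xi2 : 'Hom(subvs_of (perp x), R^o)),
        bil (eta (zero_section r i perp x))
          (horizontal r i perp x v1 + vertical r i xi1)
          (horizontal r i perp x v2 + vertical r i xi2) =
        - sigma xi1 xi2 - tau v1 xi1 v2 xi2].

(* [pU] is the Poisson structure pi(W, eta) on [U]. *)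
Definition local_model (U : set perp_dual) (eta pU : perp_dual -> 'M[R]_(k + r))
    : Prop :=
  poisson U pU /\
  forall e, U e ->
    graph pU e =
    gauge eta (dirac_pullback (@dual_pr R k n r X M i perp)
                 (dirac_pullback i (graph p))) e.

(* The embedded submanifold [iP : P -> M] is the local Poisson saturation of
   [X] given by [ex] and [Sg], and [f] is [ex \o jmap] as a map to [P]. *)
Definition local_saturation (Sg : set (cotangent M)) (ex : cotangent M -> M)
    (q : nat) (P : premanifold R q) (iP : P -> M) (pP : P -> 'M[R]_q)
    (f : perp_dual -> P) : Prop :=
  [/\ is_manifold P /\ embedding iP,
      range iP = ex @` (range jmap `&` Sg) /\
      range iP = ex @` (Sg `&` [set xi | range i (cpr xi)]),
      range i `<=` range iP,
      (forall (y : P) (al : 'rV[R]_n),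
        exists u : 'rV[R]_q, sharp p (iP y) al = u *m dmap iP y) /\
      poisson setT pP /\ poisson_map setT iP pP p &
      (forall e, Sg (jmap e) -> iP (f e) = ex (jmap e)) /\
      diffeo (jmap @^-1` Sg) setT f].

End LocalModel.

(* Main.v *)
(* The dual pair gives, pointwise by linear algebra, the identity of Dirac
   structures exp^!(L_pi) = (pr^! L_pi) gauged by - Omega on Sigma.  Pulling it
   back by j and using pr o j = i o pr_X shows that the diffeomorphism exp o j
   onto the Poisson submanifold P transports the local model to L_{pi_P}; so the
   bivector pi(W, eta) is simply the one transported from P.  The value of eta on
   the zero section follows from Omega(x, 0) = [[0, 1], [-1, pi]]: the zero
   section consists of stationary points of the spray, whose linearization A has
   A^2 = 0, so the flow has differential 1 + t A there and the integral defining
   Omega is that of an affine function of t. *)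
From HB Require Import structures.
Require Import Defs.
From mathcomp Require Import all_boot all_order all_algebra.
From mathcomp Require Import all_classical all_reals all_analysis.
From mathcomp Require Import ring lra.
Import Order.TTheory GRing.Theory Num.Theory.
Import numFieldNormedType.Exports.
Local Open Scope classical_set_scope.
Local Open Scope ring_scope.

Set Implicit Arguments.
Unset Strict Implicit.
Unset Printing Implicit Defensive.

(** * Smooth maps between Euclidean spaces *)

(** Vectors at [x] are written in the chart [pref x], which is chosen without any continuity in [x],
    so matrix-valued maps such as [dmap f], [p] or [Omega phi] may jump although the tensor is
    smooth. Pointwise algebra uses these matrices directly, but whatever involves a derivative is
    moved to fixed charts around the point. This is why closedness of [eta] and the Jacobi identity
    of the transported bivector rest on coordinate computations with the chain rule and the symmetry
    of second derivatives. The linearization A squares to zero by homogeneity: the horizontal part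
    of the spray is linear in the covector and its vertical part quadratic, so only the block from
    covectors to base vectors survives, with value pi. The equation for the differential of the flow
    comes from exchanging a time and a space derivative; uniqueness of solutions enters only around
    a rest point, where the field has a linear bound. Conormal projections and inverses of
    rectangular frames are written with Gram matrices, which keeps them rational in the entries,
    hence smooth. *)

Section NearEq.
Variables (R : realType) (V W : normedModType R).

(** The first-order expansion of [f] at [x] is also one of [g], and [diff_unique] makes its linear
    part the differential of [g]. *)
Lemma near_eq_differentiable (f g : V -> W) (x : V) :
  (\near x, f x = g x) -> differentiable f x -> differentiable g x.
Proof.
move=> fg df; have fgx : f x = g x by exact: nbhs_singleton fg.
have E : g \o shift x = cst (g x) + 'd f x +o_ (0:V) id.
  have [_ H] := (diff_locallyP x f).1 df.
  apply/eqaddoP => e e0; move/eqaddoP: H => /(_ e e0) H.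
  have N : \forall h \near (0:V), f (h + x) = g (h + x).
    by move: fg; rewrite (near_shift 0 x); apply: filterS => y /=; rewrite subr0.
  near=> h; have -> : (g \o shift x - (cst (g x) + 'd f x)) h =
    (f \o shift x - (cst (f x) + 'd f x)) h.
    rewrite /= !fctE /= fgx; congr (_ - _); symmetry.
    by near: h.
  by near: h.
have C : continuous ('d f x) by exact: diff_continuous.
by apply/diff_locallyP; rewrite (diff_unique C E).
Unshelve. all: by end_near. Qed.

End NearEq.

Section EuclideanSmoothness.
Variables (R : realType).

Lemma differentiable_mxP (V : normedModType R) (a b : nat) (f : V -> 'M[R]_(a, b)) x :
  differentiable f x <-> forall i j, differentiable (fun y => f y i j : R) x.
Proof.
split=> [df i j|H].
  exact: (@differentiable_comp _ _ _ _ f (fun N : 'M[R]_(a, b) => N i j : R) x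
    df (differentiable_coord _ i j)).
have -> : f = \sum_(i < a) \sum_(j < b) (fun y => f y i j *: delta_mx i j).
  apply/funext => y; rewrite {1}[f y]matrix_sum_delta fct_sumE.
  by apply: eq_bigr => i _; rewrite fct_sumE.
apply: differentiable_sum => i; apply: differentiable_sum => j.
exact: differentiableZl.
Qed.

Lemma for_continuous_mx (T : topologicalType) (a b : nat) (f : T -> 'M[R]_(a, b)) x :
  (forall i j, {for x, continuous (fun y => f y i j : R)}) -> {for x, continuous f}.
Proof.
move=> Cf; rewrite /prop_for /continuous_at; apply/cvgrPdist_le => /= e e0.
near=> y; rewrite [leLHS]/Num.Def.normr/= mx_normrE.
rewrite (bigmax_le _ (ltW e0))//= => -[i j] _; rewrite !mxE /=.
move: i j; near: y; apply: filter_forall => i; apply: filter_forall => j.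
by have /cvgrPdist_le := Cf i j; apply.
Unshelve. all: by end_near. Qed.

Lemma derive_coord (V : normedModType R) (a b : nat) (f : V -> 'M[R]_(a, b)) x v i j :
  differentiable f x -> 'D_v (fun y => f y i j : R) x = 'D_v f x i j.
Proof. by move=> df; rewrite derive_mx ?mxE//; exact: diff_derivable. Qed.

Lemma derive_linear (V W : normedModType R) (f : {linear V -> W}) (x v : V) :
  continuous f -> 'D_v f x = f v.
Proof.
by move=> cf; rewrite deriveE ?diff_lin//; exact: linear_differentiable.
Qed.

Lemma derive_comp_row (m n : nat) (f : 'rV[R]_m -> 'rV[R]_n) (g : 'rV[R]_n -> R)
    (x v : 'rV[R]_m) :
  differentiable f x -> differentiable g (f x) ->
  'D_v (fun y => g (f y)) x =
  \sum_(j < n) 'D_v f x 0 j * 'D_(delta_mx 0 j) g (f x).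
Proof.
move=> df dg; rewrite deriveE; last exact: differentiable_comp.
rewrite (diff_comp df dg) /= -deriveE//.
rewrite -deriveE// {1}['D_v f x]row_sum_delta deriveE// linear_sum.
by apply: eq_bigr => j _; rewrite linearZ /= -deriveE.
Qed.

Section Ck.
Variables (m : nat).
Implicit Types (A : set 'rV[R]_m).

(** On an open set, equality of functions is equality of germs at every point, which is all that
    continuity and derivatives see. *)
Lemma Ck_eq (V : normedModType R) k A (f g : 'rV[R]_m -> V) :
  open A -> (forall x, A x -> f x = g x) -> Ck k A f -> Ck k A g.
Proof.
move=> oA; have near_A x : A x -> \near x, A x by move=> Ax; exact: open_nbhs_nbhs.
elim: k f g => [|k IH] f g fg /=.
  move=> Cf x Ax; have := Cf x Ax; rewrite /prop_for /continuous_at -(fg x Ax).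
  apply: cvg_trans; apply: (@near_eq_cvg _ _ (nbhs x)).
  by apply: filterS (near_A x Ax) => y; exact: fg.
have fgn x : A x -> \near x, f x = g x.
  by move=> Ax; near=> y; apply: fg; near: y; exact: near_A.
move=> [df Df]; split=> [x Ax|v].
  by apply: near_eq_differentiable (df x Ax); exact: fgn.
by apply: IH (Df v) => x Ax; apply: near_eq_derive; exact: fgn.
Unshelve. all: by end_near. Qed.

Lemma Ck_subset (V : normedModType R) k A B (f : 'rV[R]_m -> V) :
  A `<=` B -> Ck k B f -> Ck k A f.
Proof.
move=> AB; elim: k f => [|k IH] f /=; first by move=> H x /AB; exact: H.
by move=> [df Df]; split=> [x /AB|v]; [exact: df|exact: IH].
Qed.

Lemma CkW (V : normedModType R) k A (f : 'rV[R]_m -> V) : Ck k.+1 A f -> Ck k A f.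
Proof.
elim: k f => [|k IH] f [df Df].
  by move=> x Ax; exact/differentiable_continuous/df.
by split=> // v; exact: IH.
Qed.

Lemma Ck_cst (V : normedModType R) k A (c : V) : Ck k A (fun=> c).
Proof.
elim: k c => [|k IH] c /=; first by move=> x _; exact: cst_continuous.
split=> [x _|v]; first exact: differentiable_cst.
by have -> : 'D_v (fun=> c) = (fun=> 0) :> ('rV[R]_m -> V);
  [apply/funext => x; exact: derive_cst | exact: IH].
Qed.

Lemma Ck_linear (V : normedModType R) k A (f : {linear 'rV[R]_m -> V}) :
  continuous f -> Ck k A f.
Proof.
move=> cf; case: k => [|k] /=; first by move=> x _; exact: cf.
split=> [x _|v]; first exact: linear_differentiable.
by have -> : 'D_v f = (fun=> f v); [apply/funext => x; exact: derive_linear|exact: Ck_cst].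
Qed.

Lemma CkD (V : normedModType R) k A (f g : 'rV[R]_m -> V) : open A ->
  Ck k A f -> Ck k A g -> Ck k A (fun x => f x + g x).
Proof.
move=> oA; elim: k f g => [|k IH] f g /=.
  by move=> Cf Cg x Ax; apply: continuousD; [exact: Cf|exact: Cg].
move=> [df Df] [dg Dg]; split=> [x Ax|v].
  by apply: differentiableD; [exact: df|exact: dg].
apply: Ck_eq (IH _ _ (Df v) (Dg v)) => // x Ax.
by rewrite -deriveD//; apply: diff_derivable; [exact: df|exact: dg].
Qed.

Lemma CkN (V : normedModType R) k A (f : 'rV[R]_m -> V) : open A ->
  Ck k A f -> Ck k A (fun x => - f x).
Proof.
move=> oA; elim: k f => [|k IH] f /=.
  by move=> Cf x Ax; apply: continuousN; exact: Cf.
move=> [df Df]; split=> [x Ax|v].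
  by apply: differentiableN; exact: df.
apply: Ck_eq (IH _ (Df v)) => // x Ax.
by rewrite -deriveN//; apply: diff_derivable; exact: df.
Qed.

Lemma CkM k A (f g : 'rV[R]_m -> R) : open A ->
  Ck k A f -> Ck k A g -> Ck k A (fun x => f x * g x).
Proof.
move=> oA; elim: k f g => [|k IH] f g.
  by move=> Cf Cg x Ax; apply: continuousM; [exact: Cf|exact: Cg].
move=> Cf Cg; have [df Df] := Cf; have [dg Dg] := Cg; split=> [x Ax|v].
  by apply: differentiableM; [exact: df|exact: dg].
apply: (@Ck_eq _ _ _ (fun x => f x * 'D_v g x + g x * 'D_v f x)) => //.
  move=> x Ax; rewrite -[RHS]/('D_v (f * g) x) deriveM//.
  - by apply: diff_derivable; exact: df.
  - by apply: diff_derivable; exact: dg.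
by apply: CkD => //; apply: IH => //; first [exact: (CkW Cf)|exact: (CkW Cg)|exact: Df|exact: Dg].
Qed.

(** The derivative is a polynomial in the inverse itself and the derivative of [f], so the induction
    hypothesis applies to it. *)
Lemma CkV k A (f : 'rV[R]_m -> R) : open A -> (forall x, A x -> f x != 0) ->
  Ck k A f -> Ck k A (fun x => (f x)^-1).
Proof.
move=> oA f0; elim: k => [|k IH].
  by move=> Cf x Ax; apply: continuousV; [exact: f0|exact: Cf].
move=> Cf; have [df Df] := Cf; split=> [x Ax|v].
  by apply: differentiableV; [exact: df|exact: f0].
apply: (@Ck_eq _ _ _ (fun x => - ((f x)^-1 * (f x)^-1 * 'D_v f x))) => //.
  move=> x Ax; rewrite deriveV//; last 2 first.
  - exact: f0.
  - by apply: diff_derivable; exact: df.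
  by rewrite -[_ *: _]/(_ * _) mulNr expr2 invfM.
apply: CkN => //; apply: CkM => //; last exact: Df.
by apply: CkM => //; apply: IH; exact: CkW.
Qed.

Lemma Ck_mxP (a b : nat) k A (f : 'rV[R]_m -> 'M[R]_(a, b)) : open A ->
  Ck k A f <-> forall i j, Ck k A (fun x => f x i j : R).
Proof.
move=> oA; elim: k f => [|k IH] f.
  split=> [Cf i j x Ax|Cf x Ax].
    exact: (@continuous_comp _ _ _ f (fun N : 'M[R]_(a, b) => N i j : R) x
      (Cf x Ax) (@coord_continuous _ _ _ i j _)).
  by apply: for_continuous_mx => i j; exact: Cf.
split=> [[df Df] i j|Cf].
  split=> [x Ax|v]; first by move/differentiable_mxP : (df x Ax); apply.
  apply: Ck_eq ((IH _).1 (Df v) i j) => // x Ax.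
  by rewrite derive_coord//; exact: df.
have df x : A x -> differentiable f x.
  by move=> Ax; apply/differentiable_mxP => i j; have [+ _] := Cf i j; apply.
split=> // v; apply/IH => i j; have [_ /(_ v)] := Cf i j.
by apply: Ck_eq => // x Ax; rewrite derive_coord//; exact: df.
Qed.

Lemma Ck_sum k A (I : Type) (r : seq I) (P : pred I) (f : I -> 'rV[R]_m -> R) :
  open A -> (forall i, P i -> Ck k A (f i)) ->
  Ck k A (fun x => \sum_(i <- r | P i) f i x).
Proof.
move=> oA Cf; elim: r => [|i r IH].
  by under eq_fun do rewrite big_nil; exact: Ck_cst.
under eq_fun do rewrite big_cons.
by case Pi : (P i) => //; apply: CkD => //; exact: Cf.
Qed.

End Ck.

Lemma Ck_comp (m n : nat) k (A : set 'rV[R]_m) (B : set 'rV[R]_n)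
    (f : 'rV[R]_m -> 'rV[R]_n) (g : 'rV[R]_n -> R) :
  open A -> open B -> (forall x, A x -> B (f x)) ->
  Ck k A f -> Ck k B g -> Ck k A (fun x => g (f x)).
Proof.
move=> oA oB AB; elim: k g => [|k IH] g.
  move=> Cf Cg x Ax; apply: continuous_comp; first exact: Cf.
  by apply: Cg; exact: AB.
move=> Cf Cg; have [df Df] := Cf; have [dg Dg] := Cg; split=> [x Ax|v].
  by apply: differentiable_comp; [exact: df|apply: dg; exact: AB].
apply: (@Ck_eq _ _ _ _ (fun x => \sum_j 'D_v f x 0 j * 'D_(delta_mx 0 j) g (f x))) => //.
  move=> x Ax; rewrite derive_comp_row//; first exact: df.
  by apply: dg; exact: AB.
apply: Ck_sum => // j _; apply: CkM => //; first exact: (Ck_mxP _ _ oA).1 (Df v) 0 j.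
exact: (IH _ (CkW Cf) (Dg _)).
Qed.

End EuclideanSmoothness.

(* [Ck k [set y] f] concerns the germ of f at y, through the existence of its
   iterated derivatives at the point y itself. *)
Definition smooth_at (R : realType) (m : nat) (V : normedModType R)
    (f : 'rV[R]_m -> V) (x : 'rV[R]_m) : Prop :=
  \forall y \near x, Cinfty [set y] f.

Section SmoothAt.
Variables (R : realType) (m : nat).
Implicit Types (A : set 'rV[R]_m) (x : 'rV[R]_m).

(** Each clause of [Ck] tests single points, and the derivatives involved are those of [f] on the
    whole space; so singletons carry the whole condition. *)
Lemma Ck_points (V : normedModType R) k A (f : 'rV[R]_m -> V) :
  (forall x, A x -> Ck k [set x] f) -> Ck k A f.
Proof.
elim: k f => [|k IH] f Cf; first by move=> x Ax; exact: (Cf x Ax).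
split=> [x Ax|v]; first by have [+ _] := Cf x Ax; exact.
by apply: IH => x Ax; have [_] := Cf x Ax; exact.
Qed.

Lemma smooth_at_Cinfty (V : normedModType R) A (f : 'rV[R]_m -> V) :
  (forall x, A x -> smooth_at f x) -> Cinfty A f.
Proof. by move=> H k; apply: Ck_points => x /H/nbhs_singleton; exact. Qed.

Lemma Cinfty_smooth_at (V : normedModType R) A (f : 'rV[R]_m -> V) x :
  nbhs x A -> Cinfty A f -> smooth_at f x.
Proof. by move=> Ax Cf; apply: filterS Ax => y Ay k; apply: Ck_subset (Cf k) => _ ->. Qed.

Lemma smooth_atP (V : normedModType R) (f : 'rV[R]_m -> V) x :
  smooth_at f x -> exists A, [/\ open A, A x & Cinfty A f].
Proof.
move=> sf; exists [set y | Cinfty [set y] f]°; split; first exact: open_interior.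
  exact: sf.
by move=> k; apply: Ck_points => y /interior_subset; exact.
Qed.

Lemma smooth_at_near (V : normedModType R) (f : 'rV[R]_m -> V) x :
  smooth_at f x -> \forall y \near x, smooth_at f y.
Proof. by move=> /nbhs_interior. Qed.

Lemma smooth_at_eq (V : normedModType R) (f g : 'rV[R]_m -> V) x :
  (\near x, f x = g x) -> smooth_at f x -> smooth_at g x.
Proof.
move=> fg /smooth_atP[A [oA Ax Cf]]; pose B := [set y | f y = g y].
have Bx : nbhs x B by exact: fg.
have oAB : open (A `&` B°) by apply: openI => //; exact: open_interior.
apply: (@Cinfty_smooth_at _ (A `&` B°)); first exact: open_nbhs_nbhs.
move=> k; apply: (Ck_eq oAB) (Ck_subset (@subIsetl _ A B°) (Cf k)) => y [_].
exact: interior_subset.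
Qed.

Lemma smooth_at_differentiable (V : normedModType R) (f : 'rV[R]_m -> V) x :
  smooth_at f x -> differentiable f x.
Proof. by move=> /nbhs_singleton /(_ 1)[+ _]; exact. Qed.

Lemma smooth_at_continuous (V : normedModType R) (f : 'rV[R]_m -> V) x :
  smooth_at f x -> {for x, continuous f}.
Proof. by move=> /smooth_at_differentiable/differentiable_continuous. Qed.

Lemma smooth_at_derive (V : normedModType R) (f : 'rV[R]_m -> V) v x :
  smooth_at f x -> smooth_at ('D_v f) x.
Proof. by apply: filterS => y Cf k; have [_] := Cf k.+1; exact. Qed.

Lemma smooth_at_cst (V : normedModType R) (c : V) x : smooth_at (fun=> c) x.
Proof. by near=> y => k; exact: Ck_cst. Unshelve. all: by end_near. Qed.

Lemma smooth_at_linear (V : normedModType R) (f : {linear 'rV[R]_m -> V}) x :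
  continuous f -> smooth_at f x.
Proof. by move=> cf; near=> y => k; exact: Ck_linear. Unshelve. all: by end_near. Qed.

(** Intersects the two neighborhoods once for all binary operations; only the [Ck] rule on an open
    set remains to be supplied. *)
Lemma smooth_at_bin (V1 V2 V : normedModType R) (op : V1 -> V2 -> V) :
  (forall k A f g, open A -> Ck k A f -> Ck k A g -> Ck k A (fun x => op (f x) (g x))) ->
  forall (f : 'rV[R]_m -> V1) (g : 'rV[R]_m -> V2) x,
  smooth_at f x -> smooth_at g x -> smooth_at (fun y => op (f y) (g y)) x.
Proof.
move=> H f g x /smooth_atP[A [oA Ax Cf]] /smooth_atP[B [oB Bx Cg]].
have oAB : open (A `&` B) by exact: openI.
apply: (@Cinfty_smooth_at _ (A `&` B)); first exact: open_nbhs_nbhs.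
by move=> k; apply: H => //; [apply: Ck_subset (Cf k)|apply: Ck_subset (Cg k)] => y [].
Qed.

Lemma smooth_atD (V : normedModType R) (f g : 'rV[R]_m -> V) x :
  smooth_at f x -> smooth_at g x -> smooth_at (fun y => f y + g y) x.
Proof. by apply: smooth_at_bin => k A ? ?; exact: CkD. Qed.

Lemma smooth_atM (f g : 'rV[R]_m -> R) x :
  smooth_at f x -> smooth_at g x -> smooth_at (fun y => f y * g y) x.
Proof. by apply: smooth_at_bin => k A ? ?; exact: CkM. Qed.

Lemma smooth_atN (V : normedModType R) (f : 'rV[R]_m -> V) x :
  smooth_at f x -> smooth_at (fun y => - f y) x.
Proof.
move=> sf; apply: (@smooth_at_bin V V V (fun _ v => - v)) (sf) (sf) => k A ? ? ? _.
exact: CkN.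
Qed.

Lemma smooth_atB (V : normedModType R) (f g : 'rV[R]_m -> V) x :
  smooth_at f x -> smooth_at g x -> smooth_at (fun y => f y - g y) x.
Proof. by move=> Cf Cg; apply: smooth_atD => //; exact: smooth_atN. Qed.

Lemma smooth_atV (f : 'rV[R]_m -> R) x : f x != 0 ->
  smooth_at f x -> smooth_at (fun y => (f y)^-1) x.
Proof.
move=> fx0 sf; have /smooth_atP[A [oA Ax Cf]] := sf.
have N : nbhs x (A `&` [set y | f y != 0]).
  apply: filterI; first exact: open_nbhs_nbhs.
  exact: (cvgr_neq0 _ (smooth_at_continuous sf) fx0).
apply: (@Cinfty_smooth_at _ (A `&` [set y | f y != 0])°).
  exact: nbhs_interior.
move=> k; apply: CkV; first exact: open_interior.
  by move=> y /interior_subset[].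
by apply: Ck_subset (Cf k) => y /interior_subset[].
Qed.

Lemma smooth_at_sum (I : Type) (r : seq I) (P : pred I) (f : I -> 'rV[R]_m -> R) x :
  (forall i, P i -> smooth_at (f i) x) ->
  smooth_at (fun x => \sum_(i <- r | P i) f i x) x.
Proof.
move=> Cf; elim: r => [|i r IH].
  by under eq_fun do rewrite big_nil; exact: smooth_at_cst.
under eq_fun do rewrite big_cons.
by case Pi : (P i) => //; apply: smooth_atD => //; exact: Cf.
Qed.

Lemma smooth_at_prod (I : Type) (r : seq I) (P : pred I) (f : I -> 'rV[R]_m -> R) x :
  (forall i, P i -> smooth_at (f i) x) ->
  smooth_at (fun x => \prod_(i <- r | P i) f i x) x.
Proof.
move=> Cf; elim: r => [|i r IH].
  by under eq_fun do rewrite big_nil; exact: smooth_at_cst.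
under eq_fun do rewrite big_cons.
by case Pi : (P i) => //; apply: smooth_atM => //; exact: Cf.
Qed.

Lemma smooth_at_mxP (a b : nat) (f : 'rV[R]_m -> 'M[R]_(a, b)) x :
  smooth_at f x <-> forall i j, smooth_at (fun y => f y i j : R) x.
Proof.
split=> [/smooth_atP[A [oA Ax Cf]] i j|Cf].
  apply: (@Cinfty_smooth_at _ A); first exact: open_nbhs_nbhs.
  by move=> k; apply: (Ck_mxP _ _ oA).1 (Cf k) i j.
have N : \forall y \near x, forall i j, Cinfty [set y] (fun z => f z i j : R).
  apply: (@filter_forall _ _ _ (nbhs x)) => i; apply: (@filter_forall _ _ _ (nbhs x)) => j.
  exact: Cf.
apply: (@Cinfty_smooth_at _ [set y | forall i j, Cinfty [set y] (fun z => f z i j : R)]°).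
  exact: nbhs_interior.
move=> k; apply/Ck_mxP => [|i j]; first exact: open_interior.
by apply: Ck_points => y /interior_subset /(_ i j); exact.
Qed.

Lemma smooth_at_entry (a b : nat) (f : 'rV[R]_m -> 'M[R]_(a, b)) i j x :
  smooth_at f x -> smooth_at (fun y => f y i j : R) x.
Proof. by move/smooth_at_mxP; exact. Qed.

Lemma smooth_at_mulmx (a b c : nat) (f : 'rV[R]_m -> 'M[R]_(a, b))
    (g : 'rV[R]_m -> 'M[R]_(b, c)) x :
  smooth_at f x -> smooth_at g x -> smooth_at (fun y => f y *m g y) x.
Proof.
move=> Cf Cg; apply/smooth_at_mxP => i j; under eq_fun do rewrite mxE.
by apply: smooth_at_sum => l _; apply: smooth_atM; exact: smooth_at_entry.
Qed.

Lemma smooth_at_trmx (a b : nat) (f : 'rV[R]_m -> 'M[R]_(a, b)) x :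
  smooth_at f x -> smooth_at (fun y => (f y)^T) x.
Proof.
move=> Cf; apply/smooth_at_mxP => i j; under eq_fun do rewrite mxE.
exact: smooth_at_entry.
Qed.

Lemma smooth_at_row_mx (a b c : nat) (f : 'rV[R]_m -> 'M[R]_(a, b))
    (g : 'rV[R]_m -> 'M[R]_(a, c)) x :
  smooth_at f x -> smooth_at g x -> smooth_at (fun y => row_mx (f y) (g y)) x.
Proof.
move=> Cf Cg; apply/smooth_at_mxP => i j; under eq_fun do rewrite mxE.
by case: (fintype.split j) => l; exact: smooth_at_entry.
Qed.

Lemma smooth_at_col_mx (a b c : nat) (f : 'rV[R]_m -> 'M[R]_(a, c))
    (g : 'rV[R]_m -> 'M[R]_(b, c)) x :
  smooth_at f x -> smooth_at g x -> smooth_at (fun y => col_mx (f y) (g y)) x.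
Proof.
move=> Cf Cg; apply/smooth_at_mxP => i j; under eq_fun do rewrite mxE.
by case: (fintype.split i) => l; exact: smooth_at_entry.
Qed.

Lemma smooth_at_lsubmx (a b c : nat) (f : 'rV[R]_m -> 'M[R]_(a, b + c)) x :
  smooth_at f x -> smooth_at (fun y => lsubmx (f y)) x.
Proof.
move=> Cf; apply/smooth_at_mxP => i j; under eq_fun do rewrite mxE.
exact: smooth_at_entry.
Qed.

Lemma smooth_at_rsubmx (a b c : nat) (f : 'rV[R]_m -> 'M[R]_(a, b + c)) x :
  smooth_at f x -> smooth_at (fun y => rsubmx (f y)) x.
Proof.
move=> Cf; apply/smooth_at_mxP => i j; under eq_fun do rewrite mxE.
exact: smooth_at_entry.
Qed.

Lemma smooth_at_id x : smooth_at (fun y : 'rV[R]_m => y) x.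
Proof. by apply: (@smooth_at_linear _ idfun) => y; exact: cvg_id. Qed.

Lemma smooth_at_det (n : nat) (f : 'rV[R]_m -> 'M[R]_n) x :
  smooth_at f x -> smooth_at (fun y => \det (f y)) x.
Proof.
move=> Cf; apply: smooth_at_sum => s _; apply: smooth_atM; first exact: smooth_at_cst.
by apply: smooth_at_prod => i _; exact: smooth_at_entry.
Qed.

Lemma near_unitmx (n : nat) (f : 'rV[R]_m -> 'M[R]_n) x :
  smooth_at f x -> f x \in unitmx -> \forall y \near x, f y \in unitmx.
Proof.
move=> Cf; rewrite unitmxE unitfE => fx0.
have := @cvgr_neq0 _ _ _ (nbhs x) (nbhs_filter x) _ _
  (smooth_at_continuous (smooth_at_det Cf)) fx0.
by apply: filterS => y; rewrite unitmxE unitfE.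
Qed.

(** Near [x] the inverse is the adjugate divided by the determinant, a rational expression in the
    entries. *)
Lemma smooth_at_invmx (n : nat) (f : 'rV[R]_m -> 'M[R]_n) x : f x \in unitmx ->
  smooth_at f x -> smooth_at (fun y => invmx (f y)) x.
Proof.
move=> ux Cf; apply: (@smooth_at_eq _ (fun y => (\det (f y))^-1 *: \adj (f y))).
  by near=> y; rewrite /invmx ifT//; near: y; exact: near_unitmx.
apply/smooth_at_mxP => i j; under eq_fun do rewrite !mxE.
apply: smooth_atM.
  by apply: smooth_atV; [move: ux; rewrite unitmxE unitfE|exact: smooth_at_det].
apply: smooth_atM; first exact: smooth_at_cst.
apply: smooth_at_det; apply/smooth_at_mxP => k l; under eq_fun do rewrite !mxE.
exact: smooth_at_entry.
Unshelve. all: by end_near. Qed.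

End SmoothAt.

Section SmoothAtComp.
Variables (R : realType) (m n : nat).

Lemma smooth_at_comp_scalar (f : 'rV[R]_m -> 'rV[R]_n) (g : 'rV[R]_n -> R) (x : 'rV[R]_m) :
  smooth_at f x -> smooth_at g (f x) -> smooth_at (fun y => g (f y)) x.
Proof.
move=> sf /smooth_atP[B [oB Bx Cg]]; have /smooth_atP[A [oA Ax Cf]] := sf.
have N : nbhs x (A `&` f @^-1` B).
  apply: filterI; first exact: open_nbhs_nbhs.
  by apply: (smooth_at_continuous sf); exact: open_nbhs_nbhs.
apply: (@Cinfty_smooth_at _ _ _ (A `&` f @^-1` B)°); first exact: nbhs_interior.
move=> k; apply: (Ck_comp (B := B)) => //; first exact: open_interior.
  by move=> y /interior_subset[].
by apply: Ck_subset (Cf k) => y /interior_subset[].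
Qed.

Lemma smooth_at_comp (a b : nat) (f : 'rV[R]_m -> 'rV[R]_n)
    (g : 'rV[R]_n -> 'M[R]_(a, b)) (x : 'rV[R]_m) :
  smooth_at f x -> smooth_at g (f x) -> smooth_at (fun y => g (f y)) x.
Proof.
move=> sf /smooth_at_mxP sg; apply/smooth_at_mxP => i j.
exact: (smooth_at_comp_scalar sf (sg i j)).
Qed.

Lemma jacobianE (f : 'rV[R]_m -> 'rV[R]_n) (x : 'rV[R]_m) i j : differentiable f x ->
  jacobian f x i j = 'D_(delta_mx 0 i) f x 0 j.
Proof. by move=> df; rewrite deriveEjacobian// -rowE [RHS]mxE. Qed.

Lemma smooth_at_jacobian (f : 'rV[R]_m -> 'rV[R]_n) (x : 'rV[R]_m) :
  smooth_at f x -> smooth_at (jacobian f) x.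
Proof.
move=> sf; apply/smooth_at_mxP => i j.
apply: (@smooth_at_eq _ _ _ (fun y => 'D_(delta_mx 0 i) f y 0 j)).
  apply: filterS (smooth_at_near sf) => y /smooth_at_differentiable df.
  by rewrite jacobianE.
by apply: smooth_at_entry; exact: smooth_at_derive.
Qed.

Lemma jacobian_eq (f g : 'rV[R]_m -> 'rV[R]_n) (x : 'rV[R]_m) :
  (\near x, f x = g x) -> differentiable f x -> jacobian f x = jacobian g x.
Proof.
move=> fg df; have dg := near_eq_differentiable fg df.
apply/matrixP => i j.
rewrite [LHS](jacobianE i j df) [RHS](jacobianE i j dg).
by congr (fun_of_matrix _ _ _); exact: near_eq_derive.
Qed.

Lemma jacobian_linear (f : {linear 'rV[R]_m -> 'rV[R]_n}) (x : 'rV[R]_m) :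
  continuous f -> jacobian f x = lin1_mx f.
Proof. by move=> cf; rewrite /jacobian; apply/matrixP => i j; rewrite !mxE diff_lin. Qed.

Lemma jacobian_comp (l : nat) (f : 'rV[R]_m -> 'rV[R]_n) (g : 'rV[R]_n -> 'rV[R]_l) (x : 'rV[R]_m) :
  differentiable f x -> differentiable g (f x) ->
  jacobian (fun y => g (f y)) x = jacobian f x *m jacobian g (f x).
Proof.
move=> df dg; have dgf : differentiable (fun y => g (f y)) x.
  exact: (differentiable_comp df dg).
apply/row_matrixP => i; rewrite !rowE mulmxA -(deriveEjacobian _ dgf).
rewrite -(deriveEjacobian _ df) -(deriveEjacobian _ dg) (deriveE _ dgf).
by rewrite (deriveE _ df) (deriveE _ dg) (diff_comp df dg).
Qed.

End SmoothAtComp.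

Lemma jacobian_id (R : realType) (m : nat) (x : 'rV[R]_m) : jacobian id x = 1%:M.
Proof.
rewrite (@jacobian_linear _ _ _ idfun); last by move=> y; exact: cvg_id.
by apply/row_matrixP => i; rewrite !rowE mul_rV_lin1 mulmx1.
Qed.

(** * Derivatives along lines and symmetry of second derivatives *)

Section DeriveLine.
Variables (R : realType) (V W : normedModType R).

(** The difference quotients agree as functions, which transfers derivability and the value of the
    derivative at once. *)
Let line_growth (f : V -> W) (y u : V) (a : R) :
  (fun h : R => h^-1 *: (((fun s : R => f (y + s *: u)) \o shift a) (h *: 1) -
    f (y + a *: u))) =
  (fun h : R => h^-1 *: ((f \o shift (y + a *: u)) (h *: u) - f (y + a *: u))).
Proof.
apply/funext => h /=.
by congr (_ *: (f _ - _)); rewrite [h *: 1]mulr1 scalerDl addrCA.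
Qed.

Lemma derive_line (f : V -> W) (y u : V) (a : R) :
  'D_1 (fun s : R => f (y + s *: u)) a = 'D_u f (y + a *: u).
Proof. by rewrite /derive line_growth. Qed.

Lemma is_derive_line (f : V -> W) (y u : V) (a : R) :
  differentiable f (y + a *: u) ->
  is_derive a 1 (fun s : R => f (y + s *: u)) ('D_u f (y + a *: u)).
Proof.
move=> df; apply: DeriveDef; last exact: derive_line.
by rewrite /derivable line_growth; exact: diff_derivable.
Qed.

End DeriveLine.

Section Schwarz.
Variables (R : realType) (m : nat).

Lemma mean_value (f df : R -> R) (s : R) : 0 < s ->
  (forall a, 0 <= a <= s -> is_derive a 1 f (df a)) ->
  exists2 a, 0 <= a <= s & f s - f 0 = df a * s.
Proof.
move=> s0 H; have [a|x|a as_ ->] := @MVT R f df 0 s s0.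
- by rewrite in_itv /= => /andP[a0 a1]; apply: H; rewrite !ltW.
- apply: derivable_within_continuous => a; rewrite in_itv /= => as_.
  by have [] := H _ as_.
- exists a; last by rewrite subr0.
  by move: as_; rewrite in_itv /= => /andP[a0 a1]; rewrite !ltW.
Qed.

(** The mean value theorem is applied along [u] to the increment of [f] by [s *: v], and along [v]
    to the resulting derivative in the direction [u]. *)
Lemma second_difference (f : 'rV[R]_m -> R) (x u v : 'rV[R]_m) (s : R) : 0 < s ->
  (forall a b, 0 <= a <= s -> 0 <= b <= s -> smooth_at f (x + a *: u + b *: v)) ->
  exists a b, [/\ 0 <= a <= s, 0 <= b <= s &
    f (x + s *: u + s *: v) - f (x + s *: u) - f (x + s *: v) + f x =
    'D_v ('D_u f) (x + a *: u + b *: v) * s * s].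
Proof.
move=> s0 sf.
have sf0 a : 0 <= a <= s -> smooth_at f (x + a *: u).
  by move=> as_; rewrite -[_ + _]addr0 -(scale0r v); apply: sf => //; rewrite lexx ltW.
have sfs a : 0 <= a <= s -> smooth_at f (x + s *: v + a *: u).
  by move=> as_; rewrite addrAC; apply: sf => //; rewrite lexx ltW.
pose phi a := f (x + s *: v + a *: u) - f (x + a *: u).
pose dphi a := 'D_u f (x + s *: v + a *: u) - 'D_u f (x + a *: u).
have dp a : 0 <= a <= s -> is_derive a 1 phi (dphi a).
  move=> as_; apply: is_deriveB.
    by apply: is_derive_line; apply: smooth_at_differentiable; exact: sfs.
  by apply: is_derive_line; apply: smooth_at_differentiable; exact: sf0.
have [a as_ Ea] := mean_value s0 dp.
pose psi b := 'D_u f (x + a *: u + b *: v).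
have dq b : 0 <= b <= s -> is_derive b 1 psi ('D_v ('D_u f) (x + a *: u + b *: v)).
  move=> bs; apply: is_derive_line; apply: smooth_at_differentiable.
  by apply: smooth_at_derive; exact: sf.
have [b bs Eb] := mean_value s0 dq.
exists a, b; split => //.
rewrite -Eb /psi scale0r addr0 -/(dphi a) (addrAC x (a *: u)) -Ea /phi scale0r.
by rewrite !addr0 (addrAC x (s *: v)); ring.
Qed.

(** The second difference is symmetric in [u] and [v], so the two mixed derivatives take a common
    value at two points arbitrarily close to [x]; both are continuous at [x]. *)
Lemma derive_comm (f : 'rV[R]_m -> R) (x u v : 'rV[R]_m) :
  smooth_at f x -> 'D_u ('D_v f) x = 'D_v ('D_u f) x.
Proof.
move=> sf; apply/eqP; rewrite -subr_eq0 -normr_le0.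
apply/ler_addgt0Pl => e e0; rewrite addr0.
have e2 : 0 < e / 2 by rewrite divr_gt0.
have cA : {for x, continuous ('D_u ('D_v f))}.
  by apply: smooth_at_continuous; do 2!apply: smooth_at_derive.
have cB : {for x, continuous ('D_v ('D_u f))}.
  by apply: smooth_at_continuous; do 2!apply: smooth_at_derive.
have N : nbhs x [set y | [/\ smooth_at f y,
    `|'D_u ('D_v f) x - 'D_u ('D_v f) y| < e / 2 &
    `|'D_v ('D_u f) x - 'D_v ('D_u f) y| < e / 2]].
  have /cvgrPdist_lt/(_ _ e2) NA := cA; have /cvgrPdist_lt/(_ _ e2) NB := cB.
  apply: (@filterS3 _ (nbhs x) _ _ _ _ _ _ (smooth_at_near sf) NA NB).
  by move=> y A1 A2 A3; exact: And3 A1 A2 A3.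
have [d d0 dP] := (@nbhs_ballP _ _ _ _).1 N.
(* With [s * K = d / 2], every corner and intermediate point of the parallelogram lies in the ball
   of radius [d]. The summand 1 keeps [K] positive when [u] and [v] vanish. *)
pose K := `|u| + `|v| + 1; have K0 : 0 < K by rewrite ltr_wpDl// addr_ge0.
pose s := d / 2 / K; have s0 : 0 < s by rewrite !divr_gt0.
have inball (a b : R) (w1 w2 : 'rV[R]_m) : 0 <= a <= s -> 0 <= b <= s ->
    `|w1| + `|w2| = `|u| + `|v| -> ball x d (x + a *: w1 + b *: w2).
  move=> /andP[a0 a1] /andP[b0 b1] E; rewrite -ball_normE /=.
  rewrite opprD opprD !addrA subrr add0r -opprD normrN.
  apply: (@le_lt_trans _ _ (s * K)); last first.
    by rewrite /s divfK ?gt_eqF// ltr_pdivrMr// ltr_pMr// ltr1n.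
  apply: le_trans (ler_normD _ _) _; rewrite !normrZ (ger0_norm a0) (ger0_norm b0).
  rewrite /K -E mulrDr mulr1; apply: ler_wpDr; first exact: ltW.
  rewrite mulrDr.
  by apply: lerD; apply: ler_wpM2r.
have [a [b [as_ bs E1]]] : exists a b, [/\ 0 <= a <= s, 0 <= b <= s &
    f (x + s *: u + s *: v) - f (x + s *: u) - f (x + s *: v) + f x =
    'D_v ('D_u f) (x + a *: u + b *: v) * s * s].
  apply: second_difference => // a b as_ bs.
  by have [] := dP _ (inball a b u v as_ bs erefl).
have [a' [b' [as' bs' E2]]] : exists a b, [/\ 0 <= a <= s, 0 <= b <= s &
    f (x + s *: v + s *: u) - f (x + s *: v) - f (x + s *: u) + f x =
    'D_u ('D_v f) (x + a *: v + b *: u) * s * s].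
  apply: second_difference => // a' b' as' bs'.
  by have [] := dP _ (inball a' b' v u as' bs' (addrC _ _)).
have E : 'D_v ('D_u f) (x + a *: u + b *: v) = 'D_u ('D_v f) (x + a' *: v + b' *: u).
  have cancel2 (c c' r r' : R) : c = r * s * s -> c' = r' * s * s -> c = c' -> r = r'.
    by move=> -> -> /(mulIf (lt0r_neq0 s0))/(mulIf (lt0r_neq0 s0)).
  apply: (cancel2 _ _ _ _ E1 E2).
  by rewrite (addrAC x (s *: u)) (addrAC (f _)).
have [_ _ B1] := dP _ (inball a b u v as_ bs erefl).
have [_ A1 _] := dP _ (inball a' b' v u as' bs' (addrC _ _)).
rewrite E in B1; apply: le_trans (ler_distD _ _ _) _; last first.
  by rewrite (splitr e); apply: lerD; [exact: ltW A1|rewrite distrC; exact: ltW B1].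
Qed.

End Schwarz.

(** * Pullback of closed forms and transport of the Jacobi identity *)

Section MatrixEntries.
Variables (R : pzRingType) (m n : nat).

Lemma addmxE (A B : 'M[R]_(m, n)) i j : (A + B) i j = A i j + B i j.
Proof. by rewrite mxE. Qed.

Lemma oppmxE (A : 'M[R]_(m, n)) i j : (- A) i j = - A i j.
Proof. by rewrite mxE. Qed.

Lemma scalemx_entry a (A : 'M[R]_(m, n)) i j : (a *: A) i j = a * A i j.
Proof. by rewrite mxE. Qed.

Lemma trmxE (A : 'M[R]_(m, n)) i j : A^T i j = A j i.
Proof. by rewrite mxE. Qed.

Lemma congruence_entry (A : 'M[R]_(m, n)) (B : 'M[R]_n) i j :
  (A *m B *m A^T) i j = \sum_a \sum_b A i a * B a b * A j b.
Proof.
rewrite mxE exchange_big; apply: eq_bigr => b _ /=.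
by rewrite !mxE mulr_suml.
Qed.

End MatrixEntries.

Section MatrixDerive.
Variables (R : realType) (m : nat).
Implicit Types (x v : 'rV[R]_m).

(** Here and in the rules below the derivative comes with differentiability, so that the rules chain
    through matrix products. *)
Lemma derive_sum_fun (I : Type) (r : seq I) (f : I -> 'rV[R]_m -> R) x v :
  (forall i, differentiable (f i) x) ->
  'D_v (fun y => \sum_(i <- r) f i y) x = \sum_(i <- r) 'D_v (f i) x /\
  differentiable (fun y => \sum_(i <- r) f i y) x.
Proof.
move=> df; elim: r => [|i r [IH1 IH2]].
  under eq_fun do rewrite big_nil; rewrite big_nil.
  by split; [exact: derive_cst|exact: differentiable_cst].
under eq_fun do rewrite big_cons; rewrite big_cons -IH1; split.
  by apply: deriveD; exact: diff_derivable.
exact: differentiableD.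
Qed.

Lemma derive_mulmx (a b c : nat) (f : 'rV[R]_m -> 'M[R]_(a, b))
    (g : 'rV[R]_m -> 'M[R]_(b, c)) x v :
  differentiable f x -> differentiable g x ->
  'D_v (fun y => f y *m g y) x = 'D_v f x *m g x + f x *m 'D_v g x /\
  differentiable (fun y => f y *m g y) x.
Proof.
move=> df dg.
have df' i j := (differentiable_mxP f x).1 df i j.
have dg' i j := (differentiable_mxP g x).1 dg i j.
have dfg i j l : differentiable (fun y => f y i l * g y l j) x.
  exact: differentiableM.
have dm : differentiable (fun y => f y *m g y) x.
  apply/differentiable_mxP => i j; under eq_fun do rewrite mxE.
  exact: (derive_sum_fun _ v (dfg i j)).2.
split => //; apply/matrixP => i j; rewrite -derive_coord//.
under eq_fun do rewrite mxE.
rewrite (derive_sum_fun _ v (dfg i j)).1 !mxE -big_split; apply: eq_bigr => l _ /=.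
rewrite -[LHS]/('D_v ((fun y => f y i l) * (fun y => g y l j)) x).
rewrite deriveM; [|exact/diff_derivable|exact/diff_derivable].
rewrite addrC -!derive_coord//; congr (_ + _); exact: mulrC.
Qed.

Lemma derive_trmx (a b : nat) (f : 'rV[R]_m -> 'M[R]_(a, b)) x v :
  differentiable f x -> 'D_v (fun y => (f y)^T) x = ('D_v f x)^T /\
  differentiable (fun y => (f y)^T) x.
Proof.
move=> df.
have dT : differentiable (fun y => (f y)^T) x.
  apply/differentiable_mxP => i j; under eq_fun do rewrite mxE.
  exact: (differentiable_mxP f x).1.
split => //; apply/matrixP => i j; rewrite -derive_coord// mxE -derive_coord//.
by under eq_fun do rewrite mxE.
Qed.

Lemma derive_congruence (a b : nat) (f : 'rV[R]_m -> 'M[R]_(a, b))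
    (g : 'rV[R]_m -> 'M[R]_b) x v :
  differentiable f x -> differentiable g x ->
  'D_v (fun y => f y *m g y *m (f y)^T) x =
    'D_v f x *m g x *m (f x)^T + f x *m 'D_v g x *m (f x)^T +
    f x *m g x *m ('D_v f x)^T /\
  differentiable (fun y => f y *m g y *m (f y)^T) x.
Proof.
move=> df dg.
have [D2 d2] := derive_mulmx v df dg; have [D3 d3] := derive_trmx v df.
have [D4 d4] := derive_mulmx v d2 d3; split=> //.
by rewrite D4 D2 D3 mulmxDl.
Qed.

Lemma derive_comp_mx (n a b : nat) (f : 'rV[R]_m -> 'rV[R]_n)
    (w : 'rV[R]_n -> 'M[R]_(a, b)) x v :
  differentiable f x -> differentiable w (f x) ->
  'D_v (fun y => w (f y)) x =
  \sum_(c < n) 'D_v f x 0 c *: 'D_(delta_mx 0 c) w (f x) /\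
  differentiable (fun y => w (f y)) x.
Proof.
move=> df dw; have dwf : differentiable (fun y => w (f y)) x.
  exact: (differentiable_comp df dw).
split => //; apply/matrixP => i j; rewrite -derive_coord//.
rewrite (@derive_comp_row _ _ _ f (fun y => w y i j))//; last exact: (differentiable_mxP _ _).1.
rewrite summxE; apply: eq_bigr => c _; rewrite [RHS]mxE; congr (_ * _).
exact: derive_coord.
Qed.

(** The entries on both sides are second partial derivatives of the coordinates of [f], so this is
    the symmetry of the Hessian. *)
Lemma derive_jacobian_sym (n : nat) (f : 'rV[R]_m -> 'rV[R]_n) x (k l : 'I_m) :
  smooth_at f x ->
  row l ('D_(delta_mx 0 k) (jacobian f) x) = row k ('D_(delta_mx 0 l) (jacobian f) x).
Proof.
move=> sf; apply/rowP => j; rewrite [LHS]mxE [RHS]mxE.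
have dJ := smooth_at_differentiable (smooth_at_jacobian sf).
have E (i i' : 'I_m) : 'D_(delta_mx 0 i) (jacobian f) x i' j =
    'D_(delta_mx 0 i) ('D_(delta_mx 0 i') (fun y => f y 0 j)) x.
  rewrite -derive_coord//; apply: near_eq_derive.
  apply: (@filterS _ (nbhs x)) (smooth_at_near sf) => y /smooth_at_differentiable df.
  by rewrite jacobianE// derive_coord.
rewrite [LHS]E [RHS]E; apply: derive_comm; exact: smooth_at_entry.
Qed.

End MatrixDerive.

Definition closed_at (R : realType) (n : nat) (w : 'rV[R]_n -> 'M[R]_n) z :=
  forall k l h : 'I_n, pd k (fun y => w y l h) z + pd l (fun y => w y h k) z +
    pd h (fun y => w y k l) z = 0.

Definition jacobi_at (R : realType) (n : nat) (S : 'rV[R]_n -> 'M[R]_n) z :=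
  forall k l h : 'I_n,
    \sum_(d < n)
      (S z k d * pd d (fun y => S y l h) z + S z l d * pd d (fun y => S y h k) z +
       S z h d * pd d (fun y => S y k l) z) = 0.

Section Transport.
Variables (R : realType) (m n : nat).

(** In the product rule [E], the terms [t] contain the second derivatives of [f] and [s] the
    derivative of [w]. As [t] is symmetric in its first two indices, the [t] terms cancel in the
    cyclic sum; the [s] terms give the cyclic sum of [w], contracted with three copies of the
    Jacobian. *)
Lemma closed_at_pullback (f : 'rV[R]_m -> 'rV[R]_n) (w : 'rV[R]_n -> 'M[R]_n) z :
  smooth_at f z -> smooth_at w (f z) -> (w (f z))^T = - w (f z) ->
  closed_at w (f z) ->
  closed_at (fun y => jacobian f y *m w (f y) *m (jacobian f y)^T) z.
Proof.
move=> sf sw skew cw.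
have df := smooth_at_differentiable sf; have dw := smooth_at_differentiable sw.
have dJ := smooth_at_differentiable (smooth_at_jacobian sf).
pose J := jacobian f z; pose W := w (f z).
pose H : 'I_m -> 'M[R]_(m, n) := fun k => 'D_(delta_mx 0 k) (jacobian f) z.
pose D : 'I_n -> 'M[R]_n := fun c => 'D_(delta_mx 0 c) w (f z).
pose t k l h := (H k *m W *m J^T) l h.
pose s k l h := (J *m (\sum_c J k c *: D c) *m J^T) l h.
have E k l h : pd k (fun y => (jacobian f y *m w (f y) *m (jacobian f y)^T) l h) z =
    t k l h + s k l h - t k h l.
  have [D1 d1] := derive_comp_mx (delta_mx 0 k) df dw.
  have [D4 d4] := derive_congruence (delta_mx 0 k) dJ d1.
  rewrite /pd derive_coord// D4 D1 -/(H k) -/J -/W.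
  have -> : \sum_(c < n) ('D_'e_k f z) 0 c *: 'D_'e_c w (f z) = \sum_c J k c *: D c.
    by apply: eq_bigr => c _; rewrite /J jacobianE.
  rewrite addmxE addmxE; congr (_ + _ + _).
  rewrite /t -[LHS]trmxE -oppmxE; congr (fun_of_matrix _ h l).
  by rewrite !trmx_mul trmxK skew mulNmx mulmxN mulmxA.
have tsym k l h : t k l h = t l k h.
  have tE k' l' : t k' l' h = (row l' (H k') *m W *m J^T) 0 h.
    by rewrite -!row_mul [RHS]mxE.
  by rewrite !tE /H derive_jacobian_sym.
have sE k l h : s k l h = \sum_c \sum_a \sum_b J k c * J l a * J h b * D c a b.
  rewrite /s mulmx_sumr mulmx_suml summxE; apply: eq_bigr => c _.
  rewrite -scalemxAr -scalemxAl [LHS]mxE congruence_entry mulr_sumr; apply: eq_bigr => a _.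
  by rewrite mulr_sumr; apply: eq_bigr => b _; ring.
have s_cyc k l h : s k l h + s l h k + s h k l = 0.
  rewrite !sE.
  have -> : \sum_c \sum_a \sum_b J l c * J h a * J k b * D c a b =
            \sum_c \sum_a \sum_b J k c * J l a * J h b * D a b c.
    under eq_bigr do rewrite exchange_big /=.
    rewrite exchange_big /=; apply: eq_bigr => c _; apply: eq_bigr => a _.
    by apply: eq_bigr => b _; ring.
  have -> : \sum_c \sum_a \sum_b J h c * J k a * J l b * D c a b =
            \sum_c \sum_a \sum_b J k c * J l a * J h b * D b c a.
    rewrite exchange_big /=; apply: eq_bigr => c _; rewrite exchange_big /=.
    by apply: eq_bigr => a _; apply: eq_bigr => b _; ring.
  rewrite -!big_split big1 //= => c _; rewrite -!big_split big1 //= => a _.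
  rewrite -!big_split big1 //= => b _; rewrite -!mulrDr.
  have := cw c a b; rewrite /pd !derive_coord// => ->; exact: mulr0.
move=> k l h; rewrite !E.
have := s_cyc k l h; rewrite (tsym k l) (tsym l h) (tsym h k).
move: (s k l h) (s l h k) (s h k l) => s1 s2 s3 H0.
by rewrite -[RHS]H0; ring.
Qed.

(** The factor [J] in [T (g y) = P *m J] turns the contracted derivatives of [T] into derivatives of
    [T] composed with [g], so the computation takes place in the source and [J] is never inverted.
    The terms [X] carry the second derivatives of [g]; they are symmetric in their outer indices and
    cancel in the cyclic sum, while the terms [Y] add up to the identity for [S]. *)
Lemma jacobi_at_pushforward (g : 'rV[R]_m -> 'rV[R]_n) (S : 'rV[R]_m -> 'M[R]_m)
    (T : 'rV[R]_n -> 'M[R]_n) y :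
  smooth_at g y -> smooth_at S y -> smooth_at T (g y) ->
  (\forall x \near y, T (g x) = (jacobian g x)^T *m S x *m jacobian g x) ->
  (S y)^T = - S y -> jacobi_at S y -> jacobi_at T (g y).
Proof.
move=> sg sS sT TE skew jS.
have dg := smooth_at_differentiable sg; have dS := smooth_at_differentiable sS.
have dT := smooth_at_differentiable sT.
have dJ := smooth_at_differentiable (smooth_at_jacobian sg).
pose J := jacobian g y; pose A := J^T; pose P := A *m S y.
pose H : 'I_m -> 'M[R]_(n, m) := fun d => ('D_(delta_mx 0 d) (jacobian g) y)^T.
pose D : 'I_m -> 'M[R]_m := fun d => 'D_(delta_mx 0 d) S y.
pose E : 'I_n -> 'M[R]_n := fun c => 'D_(delta_mx 0 c) T (g y).
have chain d : \sum_(e < n) J d e *: E e =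
    H d *m S y *m A^T + A *m D d *m A^T + A *m S y *m (H d)^T.
  have [D1 d1] := derive_comp_mx (delta_mx 0 d) dg dT.
  have [D2 d2] := derive_trmx (delta_mx 0 d) dJ.
  have [D3 d3] := derive_congruence (delta_mx 0 d) d2 dS.
  transitivity ('D_(delta_mx 0 d) (fun x => T (g x)) y).
    by rewrite D1; apply: eq_bigr => c _; rewrite /J jacobianE.
  rewrite /H /A /J -D2 -/(D d) -D3; apply: near_eq_derive.
  by apply: (@filterS _ (nbhs y)) TE => x ->; rewrite trmxK.
pose X a b c := \sum_d P a d * (H d *m S y *m A^T) b c.
pose Y a b c := \sum_d P a d * (A *m D d *m A^T) b c.
have TyE : T (g y) = P *m J by rewrite (nbhs_singleton TE).
have main a b c : \sum_e T (g y) a e * E e b c = X a b c + Y a b c - X a c b.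
  transitivity (\sum_d P a d * (\sum_(e < n) J d e *: E e) b c).
    rewrite TyE; under eq_bigr => e _ do rewrite mxE mulr_suml.
    rewrite exchange_big; apply: eq_bigr => d _ /=; rewrite summxE mulr_sumr.
    by apply: eq_bigr => e _; rewrite scalemx_entry mulrA.
  rewrite /X /Y -sumrN -!big_split; apply: eq_bigr => d _ /=.
  rewrite chain !addmxE !mulrDr; congr (_ + _ + _); rewrite -mulrN; congr (_ * _).
  rewrite -[LHS]trmxE -oppmxE; congr (fun_of_matrix _ c b).
  by rewrite !trmx_mul trmxK skew mulNmx mulmxN mulmxA.
have Hsym d l b : H d b l = H l b d.
  rewrite /H [LHS]trmxE [RHS]trmxE.
  by have /rowP/(_ b) := derive_jacobian_sym d l sg; rewrite [LHS]mxE [RHS]mxE.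
clearbody H.
have Xsym a b c : X a b c = X c b a.
  have XE a' c' : X a' b c' = - \sum_d \sum_l P a' d * P c' l * H d b l.
    rewrite /X -sumrN; apply: eq_bigr => d _; rewrite -mulmxA [M in P a' d * M]mxE.
    rewrite mulr_sumr -sumrN; apply: eq_bigr => l _.
    have -> : (S y *m A^T) l c' = - P c' l.
      by rewrite -[LHS]trmxE trmx_mul trmxK skew mulmxN oppmxE.
    by rewrite !mulrN mulrA mulrAC.
  rewrite !XE exchange_big; congr (- _); apply: eq_bigr => l _; apply: eq_bigr => d _ /=.
  by rewrite (Hsym d l b); congr (_ * _); exact: mulrC.
have YE a b c : Y a b c = \sum_k \sum_l \sum_h A a k * A b l * A c h *
    \sum_d S y k d * D d l h.
  transitivity (\sum_d \sum_k \sum_l \sum_h A a k * A b l * A c h * (S y k d * D d l h)).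
    rewrite /Y; apply: eq_bigr => d _; rewrite congruence_entry /P [P' in P' * _]mxE.
    rewrite mulr_suml; apply: eq_bigr => k _; rewrite mulr_sumr; apply: eq_bigr => l _.
    by rewrite mulr_sumr; apply: eq_bigr => h _; ring.
  rewrite exchange_big; apply: eq_bigr => k _; rewrite exchange_big.
  apply: eq_bigr => l _; rewrite exchange_big; apply: eq_bigr => h _ /=.
  by rewrite mulr_sumr.
have Ycyc a b c : Y a b c + Y b c a + Y c a b = 0.
  rewrite !YE.
  have -> : \sum_k \sum_l \sum_h A b k * A c l * A a h * (\sum_d S y k d * D d l h) =
      \sum_k \sum_l \sum_h A a k * A b l * A c h * (\sum_d S y l d * D d h k).
    under eq_bigr do rewrite exchange_big /=.
    rewrite exchange_big; apply: eq_bigr => k _; apply: eq_bigr => l _.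
    by apply: eq_bigr => h _ /=; congr (_ * _); ring.
  have -> : \sum_k \sum_l \sum_h A c k * A a l * A b h * (\sum_d S y k d * D d l h) =
      \sum_k \sum_l \sum_h A a k * A b l * A c h * (\sum_d S y h d * D d k l).
    rewrite exchange_big; apply: eq_bigr => k _ /=; rewrite exchange_big.
    apply: eq_bigr => l _; apply: eq_bigr => h _ /=.
    by congr (_ * _); ring.
  rewrite -!big_split big1 //= => k _; rewrite -!big_split big1 //= => l _.
  rewrite -!big_split big1 //= => h _; rewrite -!mulrDr -!big_split /=.
  suff -> : \sum_(i < m) (S y k i * D i l h + S y l i * D i h k + S y h i * D i k l) = 0.
    exact: mulr0.
  rewrite -[RHS](jS k l h); apply: eq_bigr => d _.
  by rewrite /pd !derive_coord.
move=> a b c; under eq_bigr => d _ do rewrite /pd !derive_coord//.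
rewrite !big_split /= -/(E _) !main (Xsym a b c) (Xsym b c a) (Xsym c a b).
by have := Ycyc a b c; move: (Y a b c) (Y b c a) => Y1 Y2 Y0; rewrite -[RHS]Y0; ring.
Qed.

End Transport.

(** * Calculus in charts *)

(** The chart conditions of [is_manifold], split off so that they can be established by chart
    computations alone for the cotangent bundle, the product with the time line and the dual
    bundle. *)
Record atlas (R : realType) (n : nat) (M : premanifold R n) : Prop := Atlas {
  atlas_pref : forall x : M, dom (pref x) x;
  atlas_fwdK : forall (a : Defs.index M) (x : M), dom a x -> bwd a (fwd a x) = x;
  atlas_open : forall a b : Defs.index M, open (fwd a @` (dom a `&` dom b));
  atlas_smooth : forall a b : Defs.index M,
    Cinfty (fwd a @` (dom a `&` dom b)) (fun z => fwd b (bwd a z)) }.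

Lemma manifold_atlas (R : realType) (n : nat) (M : premanifold R n) :
  is_manifold M -> atlas M.
Proof. by case=> *; split. Qed.

Definition local_rep (R : realType) (m n : nat) (M : premanifold R m)
    (N : premanifold R n) (a : Defs.index M) (b : Defs.index N) (f : M -> N) z :=
  fwd b (f (bwd a z)).

(** The first clause stands for continuity of [f]: outside its domain the values of the chart [b]
    mean nothing, and smoothness of the representative would say nothing about [f]. *)
Definition chart_smooth (R : realType) (m n : nat) (M : premanifold R m)
    (N : premanifold R n) (a : Defs.index M) (b : Defs.index N) (f : M -> N) (x : M) : Prop :=
  (\forall z \near fwd a x, dom b (f (bwd a z))) /\
  smooth_at (local_rep a b f) (fwd a x).

Definition chart_jacobian (R : realType) (m n : nat) (M : premanifold R m)
    (N : premanifold R n) (a : Defs.index M) (b : Defs.index N) (f : M -> N) (x : M)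
    : 'M[R]_(m, n) :=
  jacobian (local_rep a b f) (fwd a x).

Section ChartCalculus.
Variables (R : realType).

Lemma chart_smooth_comp (m n l : nat) (M : premanifold R m) (N : premanifold R n)
    (L : premanifold R l) (a : Defs.index M) (b : Defs.index N) (c : Defs.index L)
    (f : M -> N) (g : N -> L) (x : M) :
  atlas N -> bwd a (fwd a x) = x -> dom b (f x) ->
  chart_smooth a b f x -> chart_smooth b c g (f x) ->
  chart_smooth a c (fun y => g (f y)) x /\
  chart_jacobian a c (fun y => g (f y)) x =
    chart_jacobian a b f x *m chart_jacobian b c g (f x).
Proof.
move=> aN ax bfx [domf sf] [domg sg].
have fx : local_rep a b f (fwd a x) = fwd b (f x) by rewrite /local_rep ax.
have E : \forall z \near fwd a x,
    local_rep b c g (local_rep a b f z) = local_rep a c (fun y => g (f y)) z.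
  apply: (@filterS _ (nbhs (fwd a x))) domf => z bz.
  by rewrite /local_rep (atlas_fwdK aN).
have sgf : smooth_at (fun z => local_rep b c g (local_rep a b f z)) (fwd a x).
  by apply: smooth_at_comp => //; rewrite fx.
split; first split.
- have /(_ _ _)/= C := smooth_at_continuous sf; rewrite fx in C.
  apply: (@filterS2 _ (nbhs (fwd a x))) domf (C _ domg) => z bz /=.
  by rewrite /local_rep (atlas_fwdK aN).
- exact: smooth_at_eq E sgf.
- rewrite /chart_jacobian -fx -(jacobian_eq E); last exact: smooth_at_differentiable.
  apply: jacobian_comp; first exact: smooth_at_differentiable.
  by rewrite fx; exact: smooth_at_differentiable.
Qed.

Section OneManifold.
Variables (n : nat) (M : premanifold R n).
Hypothesis aM : atlas M.
Implicit Types (a b : Defs.index M) (x : M).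

Lemma chart_image_nbhs a b x : dom a x -> dom b x ->
  nbhs (fwd a x) (fwd a @` (dom a `&` dom b)).
Proof.
by move=> ax bx; apply: open_nbhs_nbhs; split; [exact: atlas_open|exists x].
Qed.

Lemma near_bwd_dom a b x : dom a x -> dom b x ->
  \forall z \near fwd a x,
    [/\ dom a (bwd a z), dom b (bwd a z) & fwd a (bwd a z) = z].
Proof.
move=> ax bx; apply: (@filterS _ (nbhs (fwd a x))) (chart_image_nbhs ax bx).
by move=> _ [y [ay by_] <-]; rewrite (atlas_fwdK aM).
Qed.

Lemma chart_smooth_id a b x : dom a x -> dom b x ->
  chart_smooth a b (fun y => y) x.
Proof.
move=> ax bx; split.
  by apply: (@filterS _ (nbhs (fwd a x))) (near_bwd_dom ax bx) => z [].
apply: Cinfty_smooth_at (chart_image_nbhs ax bx) _.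
exact: atlas_smooth.
Qed.

Lemma chart_jacobian_id a x : dom a x -> chart_jacobian a a (fun y => y) x = 1%:M.
Proof.
move=> ax; rewrite /chart_jacobian -[RHS](jacobian_id (fwd a x)).
apply: jacobian_eq; last first.
  by apply: smooth_at_differentiable; have [] := chart_smooth_id ax ax.
by apply: (@filterS _ (nbhs (fwd a x))) (near_bwd_dom ax ax) => z [].
Qed.

Lemma chart_jacobian_idM a b c x : dom a x -> dom b x -> dom c x ->
  chart_jacobian a b (fun y => y) x *m chart_jacobian b c (fun y => y) x =
  chart_jacobian a c (fun y => y) x.
Proof.
move=> ax bx cx; have [|_ ->//] := @chart_smooth_comp n n n M M M a b c id id x aM _ bx
  (chart_smooth_id ax bx) (chart_smooth_id bx cx).
exact: atlas_fwdK.
Qed.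

Lemma dfwdE a x : dfwd a x = chart_jacobian (pref x) a (fun y => y) x.
Proof. by []. Qed.

Lemma dbwdE a x : dom a x ->
  dbwd a (fwd a x) = chart_jacobian a (pref x) (fun y => y) x.
Proof. by move=> ax; rewrite /dbwd /dmap /= (atlas_fwdK aM). Qed.

Lemma dfwd_dbwd a x : dom a x -> dfwd a x *m dbwd a (fwd a x) = 1%:M.
Proof.
move=> ax; rewrite dfwdE dbwdE// chart_jacobian_idM ?chart_jacobian_id//;
  exact: atlas_pref.
Qed.

Lemma dbwd_dfwd a x : dom a x -> dbwd a (fwd a x) *m dfwd a x = 1%:M.
Proof.
by move=> ax; rewrite dfwdE dbwdE// chart_jacobian_idM ?chart_jacobian_id//;
  exact: atlas_pref.
Qed.

Lemma dom_open a : open (dom a).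
Proof.
move=> b z [y dy <-]; rewrite (atlas_fwdK aM)// => ay.
apply: (@filterS _ (nbhs (fwd b y))) (near_bwd_dom dy ay) => z' [_ az' _].
by move=> _.
Qed.

Lemma open_near (A : set M) a x : open A -> A x -> dom a x ->
  \forall z \near fwd a x, A (bwd a z).
Proof.
move=> oA Ax ax.
have H : \forall z \near fwd a x, (fwd a @` dom a) z -> A (bwd a z).
  by apply: (oA a (fwd a x)); [exists x|rewrite (atlas_fwdK aM)].
apply: (@filterS2 _ (nbhs (fwd a x))) H (near_bwd_dom ax ax) => z + [az _ zE].
by apply; exists (bwd a z).
Qed.

End OneManifold.

Section TwoManifolds.
Variables (m n : nat) (M : premanifold R m) (N : premanifold R n).
Implicit Types (f : M -> N) (x : M).

(** Existential, so that it can be proved in convenient charts; [smooth_pt_charts] recovers it in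
    all charts. *)
Definition smooth_pt f x := exists a b,
  [/\ dom a x, dom b (f x) & chart_smooth a b f x].

Hypotheses (aM : atlas M) (aN : atlas N).

Lemma chart_change (a a' : Defs.index M) (b b' : Defs.index N) f x :
  dom a x -> dom a' x -> dom b (f x) -> dom b' (f x) ->
  chart_smooth a b f x ->
  chart_smooth a' b' f x /\
  chart_jacobian a' b' f x = chart_jacobian a' a (fun y => y) x *m
    chart_jacobian a b f x *m chart_jacobian b b' (fun y => y) (f x).
Proof.
move=> ax ax' bx bx' sf.
have [s1 j1] := chart_smooth_comp aN (atlas_fwdK aM ax) bx sf (chart_smooth_id aN bx bx').
have [s2 j2] := chart_smooth_comp aM (atlas_fwdK aM ax') ax (chart_smooth_id aM ax' ax) s1.
by split => //; rewrite -mulmxA -j1 -j2.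
Qed.

Lemma smooth_pt_charts (a : Defs.index M) (b : Defs.index N) f x :
  smooth_pt f x -> dom a x -> dom b (f x) -> chart_smooth a b f x.
Proof.
move=> [a' [b' [ax' bx' sf]]] ax bx.
by have [] := chart_change ax' ax bx' bx sf.
Qed.

Lemma dmapE f x : dmap f x = chart_jacobian (pref x) (pref (f x)) f x.
Proof. by []. Qed.

Lemma dmap_charts (a : Defs.index M) (b : Defs.index N) f x :
  smooth_pt f x -> dom a x -> dom b (f x) ->
  dmap f x = dfwd a x *m chart_jacobian a b f x *m dbwd b (fwd b (f x)).
Proof.
move=> sf ax bx; have s := smooth_pt_charts sf ax bx.
have [_] := chart_change ax (atlas_pref aM x) bx (atlas_pref aN (f x)) s.
by rewrite (dbwdE aN).
Qed.

Lemma chart_jacobian_dmap (a : Defs.index M) (b : Defs.index N) f x :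
  smooth_pt f x -> dom a x -> dom b (f x) ->
  chart_jacobian a b f x = dbwd a (fwd a x) *m dmap f x *m dfwd b (f x).
Proof.
move=> sf ax bx; rewrite (dmap_charts sf ax bx) !mulmxA (dbwd_dfwd aM)// mul1mx.
by rewrite -mulmxA (dbwd_dfwd aN)// mulmx1.
Qed.

Lemma smooth_map_pt (A : set M) f x : open A -> smooth_map A f -> A x ->
  smooth_pt f x.
Proof.
move=> oA [cf sf] Ax; exists (pref x), (pref (f x)).
have ax := atlas_pref aM x; have bx := atlas_pref aN (f x).
have oB := cf _ (dom_open aN (a := pref (f x))).
have N1 := open_near aM oB (conj Ax bx) ax.
split => //; split.
  by apply: (@filterS _ (nbhs (fwd (pref x) x))) N1 => z [].
apply: Cinfty_smooth_at (sf (pref x) (pref (f x))).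
apply: (@filterS2 _ (nbhs (fwd (pref x) x))) N1 (near_bwd_dom aM ax ax).
by move=> z [Az bz] [az _ zE]; exists (bwd (pref x) z).
Qed.

End TwoManifolds.

Lemma dmap_comp (m n l : nat) (M : premanifold R m) (N : premanifold R n)
    (L : premanifold R l) (f : M -> N) (g : N -> L) (x : M) :
  atlas M -> atlas N -> atlas L -> smooth_pt f x -> smooth_pt g (f x) ->
  smooth_pt (fun y => g (f y)) x /\
  dmap (fun y => g (f y)) x = dmap f x *m dmap g (f x).
Proof.
move=> aM aN aL sf sg.
have px := atlas_pref aM x; have py := atlas_pref aN (f x).
have pz := atlas_pref aL (g (f x)).
have [s j] := chart_smooth_comp aN (atlas_fwdK aM px) py
  (smooth_pt_charts aM aN sf px py) (smooth_pt_charts aN aL sg py pz).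
by split=> //; exists (pref x), (pref (g (f x))).
Qed.

Lemma near_eq_dmap (m n : nat) (M : premanifold R m) (N : premanifold R n)
    (A : set M) (f g : M -> N) (x : M) :
  atlas M -> atlas N -> open A -> A x -> (forall y, A y -> f y = g y) ->
  smooth_pt f x -> smooth_pt g x /\ dmap g x = dmap f x.
Proof.
move=> aM aN oA Ax fg sf.
have ax := atlas_pref aM x; have bx := atlas_pref aN (f x).
have [s1 s2] := smooth_pt_charts aM aN sf ax bx.
have N1 := open_near aM oA Ax ax.
have E : \forall z \near fwd (pref x) x,
    local_rep (pref x) (pref (f x)) f z = local_rep (pref x) (pref (f x)) g z.
  by apply: (@filterS _ (nbhs (fwd (pref x) x))) N1 => z Az; congr (fwd _ _); exact: fg.
split.
  exists (pref x), (pref (f x)); rewrite -fg//; split=> //; split.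
    by apply: (@filterS2 _ (nbhs (fwd (pref x) x))) s1 N1 => z + Az; rewrite (fg _ Az).
  exact: smooth_at_eq E s2.
rewrite [LHS]dmapE [RHS]dmapE -(fg _ Ax); apply/esym/jacobian_eq; first exact: E.
exact: smooth_at_differentiable s2.
Qed.

End ChartCalculus.

Lemma congruence_cancel (R : comPzRingType) (m n : nat) (F D : 'M[R]_n) (P : 'M[R]_n)
    (G : 'M[R]_(n, m)) :
  F *m D = 1%:M ->
  (D *m G)^T *m (F^T *m P *m F) *m (D *m G) = G^T *m P *m G.
Proof.
move=> FD; have DF : D^T *m F^T = 1%:M by rewrite -trmx_mul FD trmx1.
by rewrite trmx_mul !mulmxA -(mulmxA _ D^T) DF mulmx1 -(mulmxA _ F D) FD mulmx1.
Qed.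

(** * Pullback of forms and pushforward of bivectors on manifolds *)

Section TensorTransport.
Variables (R : realType) (m n : nat) (M : premanifold R m) (N : premanifold R n).
Hypotheses (aM : atlas M) (aN : atlas N).

Lemma chart_set_nbhs (k : nat) (L : premanifold R k) (A : set L) (a : Defs.index L) (x : L) :
  atlas L -> open A -> A x -> dom a x -> nbhs (fwd a x) (fwd a @` (A `&` dom a)).
Proof.
move=> aL oA Ax ax.
apply: (@filterS2 _ (nbhs (fwd a x))) (open_near aL oA Ax ax) (near_bwd_dom aL ax ax).
by move=> z Az [az _ zE]; exists (bwd a z).
Qed.

Lemma form_in_chart_pullback (a : Defs.index M) (b : Defs.index N) (f : M -> N)
    (w : N -> 'M[R]_n) (x : M) :
  smooth_pt f x -> dom a x -> dom b (f x) ->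
  form_in_chart a (pullback_form f w) (fwd a x) =
  chart_jacobian a b f x *m form_in_chart b w (fwd b (f x)) *m (chart_jacobian a b f x)^T.
Proof.
move=> sf ax bx; rewrite /form_in_chart /pullback_form (atlas_fwdK aM)// (atlas_fwdK aN)//.
have -> : chart_jacobian a b f x = dbwd a (fwd a x) *m dmap f x *m dfwd b (f x).
  exact: chart_jacobian_dmap.
set D := dbwd a _; set F := dfwd b _; set B := dbwd b _.
have FB : F *m B = 1%:M by exact: dfwd_dbwd.
rewrite -!mulmxA -[in RHS]trmx_mul -!mulmxA !(mulmxA F B) FB mul1mx.
by rewrite mulmx1 trmx_mul !mulmxA.
Qed.

Lemma bivector_in_chart_pushforward (a : Defs.index M) (b : Defs.index N) (g : N -> M)
    (p : N -> 'M[R]_n) (y : N) (q : M -> 'M[R]_m) :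
  smooth_pt g y -> dom b y -> dom a (g y) ->
  q (g y) = (dmap g y)^T *m p y *m dmap g y ->
  bivector_in_chart a q (fwd a (g y)) =
  (chart_jacobian b a g y)^T *m bivector_in_chart b p (fwd b y) *m chart_jacobian b a g y.
Proof.
move=> sg by_ ay qE.
rewrite /bivector_in_chart (atlas_fwdK aM ay) (atlas_fwdK aN by_) qE.
have -> : chart_jacobian b a g y = dbwd b (fwd b y) *m dmap g y *m dfwd a (g y).
  exact: chart_jacobian_dmap.
rewrite -(mulmxA (dbwd b _)) (congruence_cancel _ _ (dfwd_dbwd aN by_)).
by rewrite trmx_mul !mulmxA.
Qed.

(** By [loc], the pulled back form read in a chart coincides near each point with the Euclidean
    pullback by the local representative, to which [closed_at_pullback] applies. *)
Lemma closed_two_form_pullback (A : set M) (B : set N) (f : M -> N) (w : N -> 'M[R]_n) :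
  open A -> open B -> (forall x, A x -> smooth_pt f x) -> (forall x, A x -> B (f x)) ->
  closed_two_form B w -> closed_two_form A (pullback_form f w).
Proof.
move=> oA oB sf AB [[skew sw] cw].
have loc (a : Defs.index M) (x : M) : A x -> dom a x -> exists b : Defs.index N,
  [/\ dom b (f x), smooth_at (form_in_chart b w) (local_rep a b f (fwd a x)),
    smooth_at (local_rep a b f) (fwd a x) &
    \forall z \near fwd a x,
    jacobian (local_rep a b f) z *m form_in_chart b w (local_rep a b f z) *m
      (jacobian (local_rep a b f) z)^T = form_in_chart a (pullback_form f w) z].
  move=> Ax ax; exists (pref (f x)); have bx := atlas_pref aN (f x).
  have [nb sF] := smooth_pt_charts aM aN (sf x Ax) ax bx.
  split=> //.
    rewrite /local_rep (atlas_fwdK aM)//.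
    apply: Cinfty_smooth_at (sw (pref (f x))).
    by apply: chart_set_nbhs => //; exact: AB.
  apply: (@filterS3 _ (nbhs (fwd a x))) nb (open_near aM oA Ax ax) (near_bwd_dom aM ax ax).
  move=> z bz Az [az _ zE].
  rewrite -{4}zE (form_in_chart_pullback w (sf _ Az) az bz).
  by rewrite /chart_jacobian zE.
have skew' x : A x -> (pullback_form f w x)^T = - pullback_form f w x.
  move=> Ax; rewrite /pullback_form !trmx_mul trmxK skew; last exact: AB.
  by rewrite mulNmx mulmxN mulmxA.
split; first split=> //.
- move=> a; apply: smooth_at_Cinfty => _ [x [Ax ax] <-].
  have [b [bx s1 s2 E]] := loc a x Ax ax.
  apply: smooth_at_eq E _; apply: smooth_at_mulmx; last first.
    by apply: smooth_at_trmx; exact: smooth_at_jacobian.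
  by apply: smooth_at_mulmx; [exact: smooth_at_jacobian|exact: smooth_at_comp].
- move=> a _ [x [Ax ax] <-].
  have [b [bx s1 s2 E]] := loc a x Ax ax.
  have fx : local_rep a b f (fwd a x) = fwd b (f x).
    by rewrite /local_rep (atlas_fwdK aM).
  have skb : (form_in_chart b w (fwd b (f x)))^T = - form_in_chart b w (fwd b (f x)).
    rewrite /form_in_chart !trmx_mul trmxK (atlas_fwdK aN)// skew; last exact: AB.
    by rewrite mulNmx mulmxN mulmxA.
  have C := @closed_at_pullback _ _ _ (local_rep a b f) (form_in_chart b w) (fwd a x) s2 s1.
  rewrite fx in C; have {}C := C skb (cw b _ _).
  have {}C := C (ex_intro2 _ _ (f x) (conj (AB _ Ax) bx) erefl).
  move=> k l h; rewrite -[RHS](C k l h).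
  have pdE i i' j : pd j (fun y => form_in_chart a (pullback_form f w) y i i') (fwd a x) =
    pd j (fun y => (jacobian (local_rep a b f) y *m
      form_in_chart b w (local_rep a b f y) *m (jacobian (local_rep a b f) y)^T) i i') (fwd a x).
    apply: near_eq_derive.
    by apply: (@filterS _ (nbhs (fwd a x))) E => z ->.
  by congr (_ + _ + _); exact: pdE.
Qed.

(** Both directions of the diffeomorphism serve: smoothness of [q] is seen by composing with [f],
    whereas the Jacobi identity is carried along [g] from [f x] back to [x]. *)
Lemma poisson_pushforward (A : set M) (B : set N) (f : M -> N) (g : N -> M)
    (p : N -> 'M[R]_n) (q : M -> 'M[R]_m) :
  open A -> open B -> (forall x, A x -> smooth_pt f x) -> (forall x, A x -> B (f x)) ->
  (forall y, B y -> smooth_pt g y) -> (forall y, B y -> A (g y)) ->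
  (forall x, A x -> g (f x) = x) -> (forall y, B y -> f (g y) = y) ->
  (forall x, A x -> q x = (dmap g (f x))^T *m p (f x) *m dmap g (f x)) ->
  poisson B p -> poisson A q.
Proof.
move=> oA oB sf AB sg BA gf fg qE [skew sp jp].
have bE a b x : A x -> dom a x -> dom b (f x) ->
    bivector_in_chart a q (fwd a x) =
    (chart_jacobian b a g (f x))^T *m bivector_in_chart b p (fwd b (f x)) *m
    chart_jacobian b a g (f x).
  move=> Ax ax bx; rewrite -{1}(gf x Ax).
  apply: bivector_in_chart_pushforward => //; rewrite ?gf//; [|exact: qE].
  exact/sg/AB.
have sq (a : Defs.index M) x : A x -> dom a x -> smooth_at (bivector_in_chart a q) (fwd a x).
  move=> Ax ax; pose b := pref (f x); have bx : dom b (f x) := atlas_pref aN (f x).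
  have [nb sF] := smooth_pt_charts aM aN (sf x Ax) ax bx.
  have ax' : dom a (g (f x)) by rewrite gf.
  have [na sG] := smooth_pt_charts aN aM (sg _ (AB x Ax)) bx ax'.
  have fx : local_rep a b f (fwd a x) = fwd b (f x).
    by rewrite /local_rep (atlas_fwdK aM).
  pose K z := jacobian (local_rep b a g) (local_rep a b f z).
  apply: (@smooth_at_eq _ _ _
     (fun z => (K z)^T *m bivector_in_chart b p (local_rep a b f z) *m K z)).
    apply: (@filterS3 _ (nbhs (fwd a x))) nb (open_near aM oA Ax ax) (near_bwd_dom aM ax ax).
    by move=> z bz Az [az _ zE]; rewrite -[in RHS]zE (bE a b _ Az az bz).
  have sK : smooth_at K (fwd a x).
    apply: (@smooth_at_comp _ _ _ _ _ (local_rep a b f)) => //.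
    by apply: smooth_at_jacobian; rewrite fx.
  apply: smooth_at_mulmx => //; apply: smooth_at_mulmx; first exact: smooth_at_trmx.
  apply: smooth_at_comp => //; rewrite fx; apply: Cinfty_smooth_at (sp b).
  by apply: chart_set_nbhs => //; exact: AB.
split=> [x Ax|a|a _ [x [Ax ax] <-]].
- rewrite qE// !trmx_mul trmxK skew; last exact: AB.
  by rewrite mulNmx mulmxN mulmxA.
- by apply: smooth_at_Cinfty => _ [x [Ax ax] <-]; exact: sq.
- pose b := pref (f x); have bx : dom b (f x) := atlas_pref aN (f x).
  have ax' : dom a (g (f x)) by rewrite gf.
  have [na sG] := smooth_pt_charts aN aM (sg _ (AB x Ax)) bx ax'.
  have gx : local_rep b a g (fwd b (f x)) = fwd a x.
    by rewrite /local_rep (atlas_fwdK aN)// gf.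
  have sp' : smooth_at (bivector_in_chart b p) (fwd b (f x)).
    apply: Cinfty_smooth_at (sp b).
    by apply: chart_set_nbhs => //; exact: AB.
  have TE : \forall z \near fwd b (f x), bivector_in_chart a q (local_rep b a g z) =
     (jacobian (local_rep b a g) z)^T *m bivector_in_chart b p z *m
     jacobian (local_rep b a g) z.
    apply: (@filterS3 _ (nbhs (fwd b (f x)))) na (open_near aN oB (AB _ Ax) bx)
      (near_bwd_dom aN bx bx).
    move=> z az Bz [bz _ zE].
    have bz' : dom b (f (g (bwd b z))) by rewrite fg.
    rewrite {1}/local_rep (bE a b _ (BA _ Bz) az bz') (fg _ Bz).
    by rewrite /chart_jacobian zE.
  have sk : (bivector_in_chart b p (fwd b (f x)))^T = - bivector_in_chart b p (fwd b (f x)).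
    rewrite /bivector_in_chart !trmx_mul trmxK (atlas_fwdK aN)// skew; last exact: AB.
    by rewrite mulNmx mulmxN mulmxA.
  have sT : smooth_at (bivector_in_chart a q) (local_rep b a g (fwd b (f x))).
    by rewrite gx; exact: sq.
  have := jacobi_at_pushforward sG sp' sT TE sk; rewrite gx; apply.
  by move=> k l h; apply: jp; exists (f x) => //; split => //; exact: AB.
Qed.

End TensorTransport.

(** * The cotangent bundle *)

Section Cotangent.
Variables (R : realType) (n : nat) (M : premanifold R n).
Hypothesis aM : atlas M.

Lemma cotangent_image (a b : Defs.index M) :
  fwd (p := cotangent M) a @` (dom (p := cotangent M) a `&` dom (p := cotangent M) b) =
  lsubmx @^-1` (fwd a @` (dom a `&` dom b)).
Proof.
apply/seteqP; split=> [_ [xi [ax bx] <-]|z [x [ax bx] zE]] /=.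
  by rewrite row_mxKl; exists xi.1.
exists (x, rsubmx z *m (dfwd a x)^T) => //=.
by rewrite -mulmxA -trmx_mul (dbwd_dfwd aM ax) trmx1 mulmx1 zE hsubmxK.
Qed.

Lemma cotangent_transition (a b : Defs.index M) (x : M) (y : 'rV[R]_n) :
  dom a x -> dom b x ->
  fwd (p := cotangent M) b (bwd (p := cotangent M) a (row_mx (fwd a x) y)) =
  row_mx (fwd b x) (y *m (chart_jacobian b a (fun y => y) x)^T).
Proof.
move=> ax bx.
have -> : bwd (p := cotangent M) a (row_mx (fwd a x) y) = (x, y *m (dfwd a x)^T).
  by rewrite /bwd /= row_mxKl row_mxKr (atlas_fwdK aM ax).
transitivity (row_mx (fwd b x) (y *m (dfwd a x)^T *m (dbwd b (fwd b x))^T)); first by [].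
apply: (congr1 (row_mx (fwd b x))); rewrite -mulmxA -trmx_mul.
apply: (congr1 (fun K => y *m K^T)); rewrite (dbwdE aM bx).
exact: (chart_jacobian_idM aM bx (atlas_pref aM x) ax).
Qed.

Lemma lsubmx_continuous (k l : nat) : continuous (lsubmx : 'rV[R]_(k + l) -> 'rV[R]_k).
Proof.
by move=> z; apply: smooth_at_continuous; apply: smooth_at_lsubmx; exact: smooth_at_id.
Qed.

Lemma cotangent_smooth (a b : Defs.index M) :
  Cinfty (fwd (p := cotangent M) a @`
      (dom (p := cotangent M) a `&` dom (p := cotangent M) b))
    (fun z => fwd (p := cotangent M) b (bwd (p := cotangent M) a z)).
Proof.
apply: smooth_at_Cinfty; rewrite cotangent_image => z [x [ax bx] zE].
  pose K (y : 'rV[R]_n) := @chart_jacobian R n n M M b a (fun y => y) (bwd (p := M) a y).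
  have sl : smooth_at (lsubmx : 'rV[R]_(n + n) -> 'rV[R]_n) z.
    by apply: smooth_at_lsubmx; exact: smooth_at_id.
  apply: (@smooth_at_eq _ _ _ (fun z : 'rV[R]_(n + n) => row_mx
      (@local_rep R n n M M a b (fun y => y) (lsubmx z))
      (rsubmx z *m (K (lsubmx z))^T))).
    have N := chart_image_nbhs aM ax bx; rewrite zE in N.
    apply: (@filterS _ (nbhs z)) (lsubmx_continuous N) => z' [y [ay by_] yE].
    have -> : z' = row_mx (fwd a y) (rsubmx z') by rewrite yE hsubmxK.
    rewrite (cotangent_transition _ ay by_) row_mxKl row_mxKr /K /local_rep.
    by rewrite (atlas_fwdK aM ay).
  have [nb sab] := chart_smooth_id aM ax bx; have [_ sba] := chart_smooth_id aM bx ax.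
  apply: smooth_at_row_mx; first by apply: smooth_at_comp => //; rewrite -zE.
  apply: smooth_at_mulmx; first by apply: smooth_at_rsubmx; exact: smooth_at_id.
  apply: smooth_at_trmx; apply: (@smooth_at_comp _ _ _ _ _ lsubmx) => //; rewrite -zE.
  apply: smooth_at_comp => //; apply: smooth_at_jacobian.
  by rewrite /local_rep (atlas_fwdK aM ax).
Qed.

Lemma cotangent_atlas : atlas (cotangent M).
Proof.
split=> [xi|a xi ax|a b|]; last exact: cotangent_smooth.
- exact: (atlas_pref aM xi.1).
- rewrite /= row_mxKl row_mxKr (atlas_fwdK aM ax) -mulmxA -trmx_mul.
  by rewrite (dfwd_dbwd aM ax) trmx1 mulmx1 -surjective_pairing.
- rewrite cotangent_image; apply: open_comp; last exact: atlas_open.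
  by move=> z _; exact: lsubmx_continuous.
Qed.

Lemma cotangent_near (a : Defs.index M) (xi : cotangent M) : dom a xi.1 ->
  \forall z \near fwd (p := cotangent M) a xi,
    (fwd a @` (dom a)) (lsubmx z).
Proof.
move=> ax; have E : lsubmx (fwd (p := cotangent M) a xi) = fwd a xi.1 by rewrite /= row_mxKl.
have N := chart_image_nbhs aM ax ax; rewrite -E in N.
apply: (@filterS _ (nbhs (fwd (p := cotangent M) a xi))) (lsubmx_continuous N).
by move=> z /= [x [ax' _] <-]; exists x.
Qed.

Lemma jacobian_lsubmx (k l : nat) (z : 'rV[R]_(k + l)) :
  jacobian (lsubmx : 'rV[R]_(k + l) -> 'rV[R]_k) z = col_mx 1%:M 0.
Proof.
rewrite (jacobian_linear (f := lsubmx)); last exact: lsubmx_continuous.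
apply/row_matrixP => i; rewrite !rowE mul_rV_lin1 /= -(hsubmxK (delta_mx 0 i)).
by rewrite row_mxKl mul_row_col mulmx1 mulmx0 addr0.
Qed.

Lemma dmap_cpr (xi : cotangent M) : dmap (@cpr R n M) xi = col_mx 1%:M 0.
Proof.
have ax := atlas_pref aM xi.1.
rewrite dmapE -[RHS](jacobian_lsubmx (fwd (p := cotangent M) (pref xi.1) xi)).
apply/esym/jacobian_eq.
  apply: (@filterS _ (nbhs (fwd (p := cotangent M) (pref xi.1) xi))) (cotangent_near ax).
  by move=> z [x ax' xE]; rewrite /local_rep /cpr /= -xE (atlas_fwdK aM).
apply: smooth_at_differentiable; apply: smooth_at_lsubmx; exact: smooth_at_id.
Qed.

(** The preferred chart of a covector depends only on its base point, so [xi] and its multiple are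
    read in the same chart, where the scaling is linear. *)
Lemma dmap_cscale (t : R) (xi : cotangent M) :
  dmap (@Defs.cscale R n M t) xi = block_mx 1%:M 0 0 t%:M.
Proof.
have ax := atlas_pref aM xi.1.
pose L : {linear 'rV[R]_(n + n) -> 'rV[R]_(n + n)} := mulmxr (block_mx 1%:M 0 0 t%:M).
have sL z : smooth_at L z.
  by apply: smooth_at_mulmx; [exact: smooth_at_id|exact: smooth_at_cst].
transitivity (jacobian L (fwd (p := cotangent M) (pref xi.1) xi)).
  rewrite dmapE; apply/esym/jacobian_eq; last first.
    by apply: smooth_at_differentiable.
  apply: (@filterS _ (nbhs (fwd (p := cotangent M) (pref xi.1) xi))) (cotangent_near ax).
  move=> z [x ax' xE].
  rewrite /local_rep /Defs.cscale /= -xE (atlas_fwdK aM ax') -scalemxAl -mulmxA -trmx_mul.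
  rewrite (dbwd_dfwd aM ax') trmx1 mulmx1 -[in LHS](hsubmxK z) mul_row_block.
  by rewrite mulmx1 !mulmx0 addr0 add0r mul_mx_scalar xE.
rewrite jacobian_linear; last by move=> z; exact: smooth_at_continuous.
by apply/row_matrixP => i; rewrite !rowE mul_rV_lin1.
Qed.

End Cotangent.

(** * Uniqueness of solutions and stationary points of flows *)

Section ODE.
Variables (R : realType).

(** The product of [g] with [expR (- K * s)] has nonpositive derivative. *)
Lemma gronwall_forward (g dg : R -> R) (K T : R) : 0 < T ->
  (forall s, 0 <= s <= T -> is_derive s 1 g (dg s)) ->
  (forall s, 0 <= s <= T -> dg s <= K * g s) -> g 0 <= 0 -> g T <= 0.
Proof.
move=> T0 dgP le g0.
pose phi s := g s * expR (- K * s).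
pose dphi s := (dg s - K * g s) * expR (- K * s).
have dp s : 0 <= s <= T -> is_derive s 1 phi (dphi s).
  move=> sT; have H1 := dgP s sT.
  have H2 : is_derive s 1 (fun s : R => expR (- K * s)) (- K * expR (- K * s)).
    have H3 : is_derive s 1 (fun s : R => - K * s) (- K).
      by apply: is_derive_eq; rewrite -[RHS]mulr1.
    by apply: is_derive_eq; rewrite mulrC.
  apply: (is_derive_eq (is_deriveM H1 H2)).
  by rewrite /dphi /GRing.scale /=; ring.
have [a aT E] := mean_value T0 dp.
have : phi T - phi 0 <= 0.
  rewrite E pmulr_lle0// /dphi pmulr_lle0 ?expR_gt0// subr_le0.
  exact: le.
rewrite /phi mulr0 expR0 mulr1 subr_le0 => H.
have := le_trans H g0; rewrite pmulr_lle0//; exact: expR_gt0.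
Qed.

Lemma mx_norm_coord (a b : nat) (u : 'M[R]_(a, b)) i j : `|u i j| <= `|u|.
Proof. by rewrite [leRHS]/Num.Def.normr/= mx_normrE; exact: (le_bigmax _ _ (i, j)). Qed.

Lemma mx_norm_le (a b : nat) (u : 'M[R]_(a, b)) (e : R) :
  0 <= e -> (forall i j, `|u i j| <= e) -> `|u| <= e.
Proof.
by move=> e0 H; rewrite [leLHS]/Num.Def.normr/= mx_normrE; apply: bigmax_le => // -[i j] _.
Qed.

Lemma differentiable_lipschitz (V W : normedModType R) (f : V -> W) (x : V) :
  differentiable f x ->
  exists2 K, 0 <= K & \forall y \near x, `|f y - f x| <= K * `|y - x|.
Proof.
move=> df; have [k k0 kP] := linear_lipschitz (diff_continuous df).
(* [k] bounds the differential and 1 the remainder of the first-order expansion. *)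
exists (k + 1); first by rewrite addr_ge0// ltW.
have /eqaddoP/(_ 1 ltr01) H := diff_locally df.
rewrite (near_shift 0 x) /=.
apply: (@filterS _ (nbhs (0 : V))) H => h /= H; rewrite subr0 addrK.
rewrite mulrDl mul1r; apply: le_trans (_ : `|'d f x h| + `|f (h + x) - (f x + 'd f x h)| <= _).
  have -> : f (h + x) - f x = 'd f x h + (f (h + x) - (f x + 'd f x h)).
    by rewrite opprD (addrA (f (h + x))) addrCA subrr addr0.
  exact: ler_normD.
by apply: lerD; [exact: kP|move: H; rewrite mul1r].
Qed.

Lemma derive_direction1 (f : R -> R) (x c : R) :
  differentiable f x -> 'D_c f x = c * 'D_1 f x.
Proof.
move=> df; rewrite [LHS](deriveE _ df) ['D_1 f x](deriveE _ df) -[c in LHS]mulr1.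
exact: (linearZZ ('d f x) c 1).
Qed.

(** The maximum norm need not be differentiable, so the Gronwall estimate is made for the sum of
    squares [h], which dominates the square of the norm; summing over the coordinates produces the
    constant [2 * |K| * n]. *)
Lemma vector_ode_zero (n : nat) (u : R -> 'rV[R]_n) (t0 K : R) : u t0 = 0 ->
  (\forall t \near t0, derivable u t 1 /\ `|'D_1 u t| <= K * `|u t|) ->
  \forall t \near t0, u t = 0.
Proof.
move=> u0 H; pose h t := \sum_i u t 0 i ^+ 2.
have [d d0 dP] := (@nbhs_ballP _ _ _ _).1 H.
have normh t : `|u t| ^+ 2 <= h t.
  have h0 : 0 <= h t by apply: sumr_ge0 => i _; exact: sqr_ge0.
  rewrite -[leRHS]sqr_sqrtr// ler_sqr ?nnegrE ?sqrtr_ge0//.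
  apply: mx_norm_le; first exact: sqrtr_ge0.
  move=> i j; rewrite (ord1 i) -sqrtr_sqr ler_sqrt//.
  by rewrite /h (bigD1 j)//= lerDl; apply: sumr_ge0 => l _; exact: sqr_ge0.
have dh t : derivable u t 1 -> is_derive t 1 h (\sum_i 2 * u t 0 i * 'D_1 u t 0 i).
  move=> du; have du' i : is_derive t 1 (fun t => u t 0 i) ('D_1 u t 0 i).
    apply: DeriveDef; first exact: (derivable_mxP u t 1).1.
    by rewrite derive_mx// mxE.
  have -> : h = \sum_(i < n) (fun t => u t 0 i ^+ 2).
    by apply/funext => s; rewrite fct_sumE.
  apply: is_derive_sum => i.
  apply: (is_derive_eq (is_deriveM (du' i) (du' i))).
  by rewrite /GRing.scale /=; ring.
have bound t : `|'D_1 u t| <= K * `|u t| ->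
    `|\sum_i 2 * u t 0 i * 'D_1 u t 0 i| <= 2 * `|K| * n%:R * h t.
  move=> le; apply: le_trans (ler_norm_sum _ _ _) _.
  apply: le_trans (_ : \sum_(i < n) 2 * `|K| * h t <= _); last first.
    by rewrite sumr_const card_ord -[_ *+ n]mulr_natr (mulrAC _ (h t)).
  apply: ler_sum => i _; rewrite !normrM (ger0_norm (ler0n _ 2)) -!mulrA ler_pM2l//.
  apply: le_trans (_ : `|u t| * (`|K| * `|u t|) <= _).
    apply: ler_pM => //; first exact: mx_norm_coord.
    apply: le_trans (mx_norm_coord _ _ _) _; apply: le_trans le _.
    by apply: ler_wpM2r => //; exact: ler_norm.
  by rewrite mulrCA -expr2; apply: ler_wpM2l.
have h_le0 t : ball t0 d t -> h t <= 0.
  move=> bt; have [->|tt0] := eqVneq t t0.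
    by rewrite /h u0 big1// => i _; rewrite mxE expr0n.
  (* Moving from [t0] with velocity [sg] reaches [t] in the positive time [T], so the forward
     estimate also covers the times before [t0]. *)
  pose T := `|t - t0|; pose sg := Num.sg (t - t0).
  have T0 : 0 < T by rewrite normr_gt0 subr_eq0.
  have tE : t = t0 + T *: sg.
    by rewrite -[T *: sg]mulrC -numEsg addrC subrK.
  have inb s : 0 <= s <= T -> ball t0 d (t0 + s *: sg).
    move=> /andP[s0 sT]; rewrite -ball_normE /= opprD addrA subrr add0r normrN.
    rewrite normrZ (ger0_norm s0) normr_sg subr_eq0 tt0 mulr1.
    by apply: le_lt_trans sT _; move: bt; rewrite -ball_normE /= distrC.
  rewrite tE; pose dg s := 'D_sg h (t0 + s *: sg).
  apply: (@gronwall_forward (fun s => h (t0 + s *: sg)) dg (2 * `|K| * n%:R) T T0).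
  - move=> s sT; have [du _] := dP _ (inb s sT).
    apply: is_derive_line; apply/derivable1_diffP.
    by have [] := dh _ du.
  - move=> s sT; have [du le] := dP _ (inb s sT).
    have Dh := dh _ du.
    rewrite /dg; have -> : 'D_sg h (t0 + s *: sg) = sg * 'D_1 h (t0 + s *: sg).
      have df : differentiable h (t0 + s *: sg) by apply/derivable1_diffP; have [] := Dh.
      exact: derive_direction1.
    rewrite (@derive_val _ _ _ _ _ _ _ Dh).
    apply: le_trans (ler_norm _) _; rewrite normrM.
    apply: le_trans (ler_piMl _ _) (bound _ le) => //.
    by rewrite normr_sg; case: (_ != 0).
  - by rewrite scale0r addr0 /h u0 big1// => i _; rewrite mxE expr0n.
apply: (@filterS _ (nbhs t0) _ (ball t0 d)); last exact: nbhsx_ballx.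
move=> t bt; apply/eqP; rewrite -normr_eq0 -sqrf_eq0 eq_le sqr_ge0 andbT.
exact: le_trans (normh t) (h_le0 t bt).
Qed.

End ODE.

(** * Charts of the real line and of products *)

Section ProductAtlas.
Variables (R : realType).

Lemma real_line_atlas : atlas (real_line R).
Proof.
have K (z : 'rV[R]_1) : const_mx (z 0 0) = z by apply/rowP => i; rewrite ord1 mxE.
split=> // [a x _|a b|a b] /=; first by rewrite mxE.
  have -> : [set (const_mx t : 'rV[R]_1) | t in ([set: R] `&` [set: R])] = setT.
    by apply/seteqP; split=> // z _; exists (z 0 0).
  exact: openT.
apply: smooth_at_Cinfty => z _; apply: (@smooth_at_eq _ _ _ (fun y => y)).
  by near=> y; rewrite K.
exact: smooth_at_id.
Unshelve. all: by end_near. Qed.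

Variables (m n : nat) (M : premanifold R m) (N : premanifold R n).
Hypotheses (aM : atlas M) (aN : atlas N).

Lemma rsubmx_continuous (k l : nat) : continuous (rsubmx : 'rV[R]_(k + l) -> 'rV[R]_l).
Proof.
by move=> z; apply: smooth_at_continuous; apply: smooth_at_rsubmx; exact: smooth_at_id.
Qed.

Lemma prod_image (a b : Defs.index (prod_mfd M N)) :
  fwd a @` (dom a `&` dom b) =
  lsubmx @^-1` (fwd a.1 @` (dom a.1 `&` dom b.1)) `&`
  rsubmx @^-1` (fwd a.2 @` (dom a.2 `&` dom b.2)).
Proof.
apply/seteqP; split=> [_ [[x y] [[/= a1 a2] [/= b1 b2]] <-]|z [/= [x [ax bx] xE] [y [ay by_] yE]]].
  by rewrite /= row_mxKl row_mxKr; split; [exists x|exists y].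
by exists (x, y) => //=; rewrite xE yE hsubmxK.
Qed.

Lemma prod_atlas : atlas (prod_mfd M N).
Proof.
split=> [x|[a1 a2] [x1 x2] [/= ax1 ax2]|a b|a b].
- by split; [exact: (atlas_pref aM)|exact: (atlas_pref aN)].
- by rewrite row_mxKl row_mxKr (atlas_fwdK aM ax1) (atlas_fwdK aN ax2).
- rewrite prod_image; apply: openI; apply: open_comp.
  + by move=> z _; exact: lsubmx_continuous.
  + exact: (atlas_open aM).
  + by move=> z _; exact: rsubmx_continuous.
  + exact: (atlas_open aN).
- apply: smooth_at_Cinfty => z; rewrite prod_image => -[[x [ax bx] xE] [y [ay by_] yE]].
  have sl : smooth_at (lsubmx : 'rV[R]_(m + n) -> _) z.
    by apply: smooth_at_lsubmx; exact: smooth_at_id.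
  have sr : smooth_at (rsubmx : 'rV[R]_(m + n) -> _) z.
    by apply: smooth_at_rsubmx; exact: smooth_at_id.
  have [_ s1] := chart_smooth_id aM ax bx; rewrite xE in s1.
  have [_ s2] := chart_smooth_id aN ay by_; rewrite yE in s2.
  apply: smooth_at_row_mx; first exact: (smooth_at_comp sl s1).
  exact: (smooth_at_comp sr s2).
Qed.

End ProductAtlas.

Section CurveDerivative.
Variables (R : realType).

Lemma derive_comm_mx (m a b : nat) (f : 'rV[R]_m -> 'M[R]_(a, b)) (x u v : 'rV[R]_m) :
  smooth_at f x -> 'D_u ('D_v f) x = 'D_v ('D_u f) x.
Proof.
move=> sf.
have dD (w : 'rV[R]_m) : differentiable ('D_w f) x.
  by apply: smooth_at_differentiable; exact: smooth_at_derive.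
have E (w w' : 'rV[R]_m) i j : 'D_w ('D_w' f) x i j = 'D_w ('D_w' (fun y => f y i j)) x.
  rewrite -(derive_coord w i j (dD w')); apply: near_eq_derive.
  apply: (@filterS _ (nbhs x)) (smooth_at_near sf) => y /smooth_at_differentiable df.
  by rewrite [RHS]derive_coord.
apply/matrixP => i j; rewrite [LHS]E [RHS]E; apply: derive_comm.
exact: smooth_at_entry.
Qed.

Lemma is_derive_mulmxr (a b c : nat) (f : R -> 'M[R]_(a, b)) (df : 'M[R]_(a, b))
    (A : 'M[R]_(b, c)) (s : R) :
  is_derive s 1 f df -> is_derive s 1 (fun t => f t *m A) (df *m A).
Proof.
move=> H; have [d D] := H; have fE i j : is_derive s 1 (fun t => f t i j) (df i j).
  apply: DeriveDef; first exact: (derivable_mxP f s 1).1.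
  by rewrite -D derive_mx// mxE.
have E i j : is_derive s 1 (fun t => (f t *m A) i j) ((df *m A) i j).
  have -> : (fun t => (f t *m A) i j) = \sum_(l < b) (fun t => f t i l * A l j).
    by apply/funext => t; rewrite fct_sumE mxE.
  rewrite mxE; apply: is_derive_sum => l.
  apply: (is_derive_eq (is_deriveM (fE i l) (is_derive_cst (A l j) s 1))).
  by rewrite scaler0 add0r /GRing.scale /= mulrC.
have dm : derivable (fun t => f t *m A) s 1.
  by apply/derivable_mxP => i j; have [] := E i j.
apply: DeriveDef => //; apply/matrixP => i j; rewrite derive_mx// mxE.
by have [_ ->] := E i j.
Qed.

Lemma constant_derivative (a b : nat) (f : R -> 'M[R]_(a, b)) (c : 'M[R]_(a, b)) :
  (forall s : R, 0 <= s <= 1 -> is_derive s 1 f c) ->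
  forall t : R, 0 <= t <= 1 -> f t = f 0 + t *: c.
Proof.
move=> H t /andP[t0 t1]; have [->|tn0] := eqVneq t 0.
  by rewrite scale0r addr0.
have {}t0 : 0 < t by rewrite lt_neqAle eq_sym tn0.
apply/matrixP => i j; rewrite addmxE scalemx_entry.
have [s st|s _ E] := @mean_value R (fun s => f s i j) (fun=> c i j) t t0.
  have [d D] : is_derive s 1 f c.
    by apply: H; move: st => /andP[-> /le_trans ->].
  apply: DeriveDef; first exact: (derivable_mxP f s 1).1.
  by rewrite -D derive_mx// mxE.
by rewrite mulrC -E addrC subrK.
Qed.

End CurveDerivative.

(** * Flows at rest points and their linearization *)

Section Flow.
Variables (R : realType) (n : nat) (N : premanifold R n).
Hypothesis aN : atlas N.
Variables (chi : N -> 'rV[R]_n) (Sg : set N) (phi : R -> N -> N).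
Hypothesis schi : smooth_section (fun x : N => x) setT chi.

Let aT := prod_atlas (real_line_atlas R) aN.
Let Phi (u : prod_mfd (real_line R) N) : N := phi u.1 u.2.
(** The time direction in the charts of the product. *)
Let e0 : 'rV[R]_(1 + n) := row_mx (const_mx 1) 0.

Definition field_in_chart (b : Defs.index N) (z : 'rV[R]_n) : 'rV[R]_n :=
  chi (bwd b z) *m dfwd b (bwd b z).

Lemma smooth_field_in_chart (b : Defs.index N) (x : N) : dom b x ->
  smooth_at (field_in_chart b) (fwd b x).
Proof.
move=> bx; apply: Cinfty_smooth_at (schi b b).
apply: (@filterS _ (nbhs (fwd b x))) (near_bwd_dom aN bx bx) => z [bz _ zE].
by exists (bwd b z).
Qed.

Variable D : set (prod_mfd (real_line R) N).
Hypotheses (oD : open D) (sPhi : smooth_map D Phi).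
Hypothesis vPhi : forall t x, D (t, x) ->
  velocity (fun s => phi s x) t = chi (phi t x).

Lemma flow_smooth_pt t x : D (t, x) -> smooth_pt Phi (t, x).
Proof. by move=> Dt; apply: (smooth_map_pt aT aN oD sPhi). Qed.

Lemma row_time (s : R) (z : 'rV[R]_n) :
  (row_mx 0 z + s *: e0 : 'rV[R]_(1 + n)) = row_mx (const_mx s) z.
Proof.
rewrite /e0 scale_row_mx scaler0 add_row_mx add0r addr0; congr row_mx.
by apply/rowP => i; rewrite !mxE mulr1.
Qed.

Lemma flow_rep (a b : Defs.index N) s z :
  local_rep (M := prod_mfd (real_line R) N) (tt, a) b Phi (row_mx (const_mx s) z) =
  fwd b (phi s (bwd a z)).
Proof. by rewrite /local_rep /Phi /= row_mxKl row_mxKr mxE. Qed.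

(** [velocity] is measured in the preferred chart of [phi t x]; the change to the chart [b] accounts
    for the factor [dfwd b]. *)
Lemma flow_derive_time (a b : Defs.index N) t x :
  D (t, x) -> dom a x -> dom b (phi t x) ->
  'D_e0 (local_rep (M := prod_mfd (real_line R) N) (tt, a) b Phi)
    (row_mx (const_mx t) (fwd a x)) = chi (phi t x) *m dfwd b (phi t x).
Proof.
move=> Dt ax bx; have sP := flow_smooth_pt Dt.
have ax' : dom (p := prod_mfd (real_line R) N) (tt, a) (t, x) by [].
have px := atlas_pref aN (phi t x).
have [_ s1] := smooth_pt_charts aT aN sP ax' px.
have [_ J] := chart_change aT aN ax' ax' px bx (smooth_pt_charts aT aN sP ax' px).
have [_ s2] := smooth_pt_charts aT aN sP ax' bx.
have d1 := smooth_at_differentiable s1; have d2 := smooth_at_differentiable s2.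
rewrite (deriveEjacobian _ d2).
rewrite /chart_jacobian /= in J; rewrite J.
have aid := chart_jacobian_id aT ax'; rewrite /chart_jacobian /= in aid.
rewrite aid mul1mx mulmxA -(deriveEjacobian _ d1); congr (_ *m _).
have E : fwd (p := prod_mfd (real_line R) N) (tt, a) (t, x) = row_mx 0 (fwd a x) + t *: e0.
  by rewrite row_time.
rewrite -(vPhi Dt) /velocity derive1E E -derive_line.
congr ('D_1 _ t); apply/funext => s.
by rewrite row_time flow_rep (atlas_fwdK aN ax).
Qed.

Lemma near_flow (a b : Defs.index N) t x :
  D (t, x) -> dom a x -> dom b (phi t x) ->
  \forall z \near (row_mx (const_mx t) (fwd a x) : 'rV[R]_(1 + n)),
    [/\ D ((lsubmx z) 0 0, bwd a (rsubmx z)), dom a (bwd a (rsubmx z)),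
        fwd a (bwd a (rsubmx z)) = rsubmx z & dom b (phi ((lsubmx z) 0 0) (bwd a (rsubmx z)))].
Proof.
move=> Dt ax bx; have sP := flow_smooth_pt Dt.
have ax' : dom (p := prod_mfd (real_line R) N) (tt, a) (t, x) by [].
have [nb _] := smooth_pt_charts aT aN sP ax' bx.
apply: (@filterS3 _ (nbhs (row_mx (const_mx t) (fwd a x) : 'rV[R]_(1 + n))))
  nb (open_near aT oD Dt ax') (near_bwd_dom aT ax' ax') => z /= bz Dz [[_ az] _ zE].
split=> //; have /(congr1 rsubmx) := zE; by rewrite row_mxKr.
Qed.

Lemma flow_smooth_at (a b : Defs.index N) t x :
  D (t, x) -> dom a x -> dom b (phi t x) ->
  smooth_at (local_rep (M := prod_mfd (real_line R) N) (tt, a) b Phi)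
    (row_mx (const_mx t) (fwd a x)).
Proof.
move=> Dt ax bx; have sP := flow_smooth_pt Dt.
have ax' : dom (p := prod_mfd (real_line R) N) (tt, a) (t, x) by [].
by have [] := smooth_pt_charts aT aN sP ax' bx.
Qed.

(** The equation is stated on a neighborhood in time and space so that it can be differentiated with
    respect to the initial condition. *)
Lemma flow_equation (a b : Defs.index N) t x :
  D (t, x) -> dom a x -> dom b (phi t x) ->
  \forall z \near (row_mx (const_mx t) (fwd a x) : 'rV[R]_(1 + n)),
  'D_e0 (local_rep (M := prod_mfd (real_line R) N) (tt, a) b Phi) z =
  field_in_chart b (local_rep (M := prod_mfd (real_line R) N) (tt, a) b Phi z).
Proof.
move=> Dt ax bx.
apply: (@filterS _ (nbhs (row_mx (const_mx t) (fwd a x) : 'rV[R]_(1 + n))))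
  (near_flow Dt ax bx) => z [Dz az zE bz].
have zE' : z = row_mx (const_mx ((lsubmx z) 0 0)) (fwd a (bwd a (rsubmx z))).
  rewrite zE -{1}(hsubmxK z); congr row_mx.
  by apply/rowP => i; rewrite ord1 [RHS]mxE.
pose F := 'D_e0 (local_rep (M := prod_mfd (real_line R) N) (tt, a) b Phi).
rewrite -[LHS]/(F z) (congr1 F zE') /F (flow_derive_time Dz az bz) /field_in_chart.
have -> : local_rep (M := prod_mfd (real_line R) N) (tt, a) b Phi z =
    fwd b (phi ((lsubmx z) 0 0) (bwd a (rsubmx z))) by [].
by rewrite (atlas_fwdK aN bz).
Qed.

Lemma continuous_row_time (z : 'rV[R]_n) :
  continuous (fun s : R => row_mx (const_mx s) z : 'rV[R]_(1 + n)).
Proof.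
move=> t.
have -> : (fun s : R => row_mx (const_mx s) z : 'rV[R]_(1 + n)) =
    (fun s => row_mx 0 z + s *: e0) by apply/funext => s; rewrite row_time.
have d : differentiable (fun s : R => row_mx 0 z + s *: e0 : 'rV[R]_(1 + n)) t.
  apply: differentiableD; first exact: differentiable_cst.
  by apply: differentiableZl.
exact: differentiable_continuous d.
Qed.

Lemma near_row_time (P : set 'rV[R]_(1 + n)) t (z : 'rV[R]_n) :
  nbhs (row_mx (const_mx t) z : 'rV[R]_(1 + n)) P ->
  \forall s \near t, P (row_mx (const_mx s) z).
Proof. by move=> NP; exact: (@continuous_row_time z t _ NP). Qed.

(** In a chart the displacement [u] from [x] vanishes at time [t] and satisfies a linear
    differential inequality, because the field vanishes at [x] and is Lipschitz there;
    [vector_ode_zero] concludes. *)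
Lemma flow_stationary_near (t : R) (x : N) : chi x = 0 -> D (t, x) -> phi t x = x ->
  \forall s \near t, phi s x = x.
Proof.
move=> chi0 Dt tx; pose b := pref x; have bx : dom b x := atlas_pref aN x.
have btx : dom b (phi t x) by rewrite tx.
pose rep := local_rep (M := prod_mfd (real_line R) N) (tt, b) b Phi.
pose u s := rep (row_mx (const_mx s) (fwd b x)) - fwd b x.
have repE (s : R) : rep (row_mx (const_mx s) (fwd b x)) = fwd b (phi s x).
  by rewrite /rep flow_rep (atlas_fwdK aN bx).
have u0 : u t = 0 by rewrite /u repE tx subrr.
have F0 : field_in_chart b (fwd b x) = 0.
  by rewrite /field_in_chart (atlas_fwdK aN bx) chi0 mul0mx.
have [K K0 KP] := differentiable_lipschitz
  (smooth_at_differentiable (smooth_field_in_chart bx)).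
have srep := flow_smooth_at Dt bx btx.
have KP' : \forall z \near (row_mx (const_mx t) (fwd b x) : 'rV[R]_(1 + n)),
    `|field_in_chart b (rep z)| <= K * `|rep z - fwd b x|.
  have E : rep (row_mx (const_mx t) (fwd b x)) = fwd b x by rewrite repE tx.
  have KP1 : nbhs (rep (row_mx (const_mx t) (fwd b x)))
      [set y | `|field_in_chart b y| <= K * `|y - fwd b x|].
    by rewrite E; apply: (@filterS _ (nbhs (fwd b x))) KP => y; rewrite F0 subr0.
  exact: (smooth_at_continuous srep KP1).
have N1 := near_row_time (smooth_at_near srep).
have N2 := near_row_time (flow_equation Dt bx btx).
have N3 := near_row_time KP'.
have N4 := near_row_time (near_flow Dt bx btx).
have uz : \forall s \near t, u s = 0.
  apply: (vector_ode_zero u0 (K := K)).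
  apply: (@filterS3 _ (nbhs t)) N1 N2 N3 => s s1 E s3.
  have is_d : is_derive s 1 u (field_in_chart b (rep (row_mx (const_mx s) (fwd b x)))).
    have uE : u = (fun s => rep (row_mx 0 (fwd b x) + s *: e0)) - cst (fwd b x).
      by apply/funext => s'; rewrite /u fctE /= row_time.
    have d : is_derive s 1 (fun s => rep (row_mx 0 (fwd b x) + s *: e0))
        ('D_e0 rep (row_mx 0 (fwd b x) + s *: e0)).
      by apply: is_derive_line; rewrite row_time; exact: smooth_at_differentiable.
    rewrite uE; apply: (is_derive_eq (is_deriveB d (is_derive_cst (fwd b x) s 1))).
    by rewrite subr0 row_time.
  have [du Du] := is_d; split=> //.
  by rewrite Du.
apply: (@filterS2 _ (nbhs t)) uz N4 => s us [_ _ _ bs].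
rewrite row_mxKl row_mxKr mxE (atlas_fwdK aN bx) in bs.
move/eqP: us; rewrite /u repE subr_eq0 => /eqP us.
by rewrite -(atlas_fwdK aN bs) us (atlas_fwdK aN bx).
Qed.

(** Two cases stand in for a separation axiom, which [atlas] does not include. If [x] is outside the
    chart around [phi t x], nearby points of the orbit stay in that chart and so differ from [x];
    otherwise coordinates are compared by continuity. *)
Lemma flow_nonstationary_near (t : R) (x : N) : D (t, x) -> phi t x <> x ->
  \forall s \near t, phi s x <> x.
Proof.
move=> Dt tx; pose a := pref x; have ax : dom a x := atlas_pref aN x.
pose b := pref (phi t x); have bx : dom b (phi t x) := atlas_pref aN _.
have N4 := near_row_time (near_flow Dt ax bx).
have [bx'|nb] := pselect (dom b x); last first.
  apply: (@filterS _ (nbhs t)) N4 => s [_ _ _ bs] sx.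
  by rewrite row_mxKl row_mxKr mxE (atlas_fwdK aN ax) sx in bs.
pose rep := local_rep (M := prod_mfd (real_line R) N) (tt, a) b Phi.
have repE (s : R) : rep (row_mx (const_mx s) (fwd a x)) = fwd b (phi s x).
  by rewrite /rep flow_rep (atlas_fwdK aN ax).
have ne : rep (row_mx (const_mx t) (fwd a x)) - fwd b x != 0.
  rewrite subr_eq0 repE; apply/eqP => E; apply: tx.
  by rewrite -(atlas_fwdK aN bx) E (atlas_fwdK aN bx').
have c : {for (row_mx (const_mx t) (fwd a x) : 'rV[R]_(1 + n)),
    continuous (fun z => rep z - fwd b x)}.
  apply: smooth_at_continuous; apply: smooth_atB; last exact: smooth_at_cst.
  exact: (flow_smooth_at Dt ax bx).
have := near_row_time (@cvgr_neq0 _ _ _ _ (nbhs_filter _) _ _ c ne).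
apply: (@filterS _ (nbhs t)) => s + sx.
by rewrite repE sx subrr eqxx.
Qed.

(* The times at which the flow is stationary form a subset of [0, 1] that is open
   by uniqueness of solutions, and closed. *)
Lemma flow_stationary (x : N) : chi x = 0 -> (forall t : R, 0 <= t <= 1 -> D (t, x)) ->
  phi 0 x = x -> forall t : R, 0 <= t <= 1 -> phi t x = x.
Proof.
move=> chi0 Dt x0.
pose I := [set t : R | 0 <= t <= 1].
have cI : connected I.
  have -> : I = `[0, 1]%classic by apply/seteqP; split=> t /=; rewrite in_itv.
  exact: segment_connected.
have I0 : I 0 by rewrite /I /= lexx ler01.
suff E : I = I `&` [set t | phi t x = x].
  by move=> t It; have : I t by []; rewrite E => -[].
apply/esym/cI; first by exists 0.
- exists [set t | phi t x = x]°; first exact: open_interior.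
  apply/seteqP; split=> t [It tx]; split=> //; last exact: interior_subset tx.
  exact: (flow_stationary_near chi0 (Dt t It) tx).
- exists (~` [set t | phi t x <> x]°); first by rewrite closedC; exact: open_interior.
  apply/seteqP; split=> t [It tx]; split=> //.
    by move=> /interior_subset.
  apply: contrapT => ntx; apply: tx.
  exact: (flow_nonstationary_near (Dt t It) ntx).
Qed.

(* By symmetry of second derivatives Y t = dmap (phi t) x solves Y' = Y A, so
   that Y A is constant and Y is affine. *)
Lemma flow_linearization (x : N) : chi x = 0 ->
  (forall t : R, 0 <= t <= 1 -> D (t, x)) -> open Sg -> Sg x ->
  (forall y, Sg y -> phi 0 y = y) ->
  let A := jacobian (field_in_chart (pref x)) (fwd (pref x) x) in
  A *m A = 0 -> forall t : R, 0 <= t <= 1 -> dmap (phi t) x = 1%:M + t *: A.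
Proof.
move=> chi0 Dt oSg Sgx phi0 A AA.
have stat := flow_stationary chi0 Dt (phi0 x Sgx).
set a := pref x in A AA *; have ax : dom a x := atlas_pref aN x.
pose rep := local_rep (M := prod_mfd (real_line R) N) (tt, a) a Phi.
pose pt (s : R) : 'rV[R]_(1 + n) := row_mx (const_mx s) (fwd a x).
pose e (v : 'rV[R]_n) : 'rV[R]_(1 + n) := row_mx 0 v.
pose y (v : 'rV[R]_n) (s : R) := 'D_(e v) rep (pt s).
have srep (s : R) : 0 <= s <= 1 -> smooth_at rep (pt s).
  by move=> s01; apply: (flow_smooth_at (Dt s s01) ax); rewrite (stat s s01).
have repE (s : R) : 0 <= s <= 1 -> rep (pt s) = fwd a x.
  by move=> s01; rewrite /rep flow_rep (atlas_fwdK aN ax) stat.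
have Y1 v (s : R) : 0 <= s <= 1 -> v *m dmap (phi s) x = y v s.
  move=> s01; pose h z := rep (row_mx (const_mx s) z).
  have sh : smooth_at h (fwd a x).
    apply: (@smooth_at_comp _ _ _ _ _ (fun z => row_mx (const_mx s) z)); last exact: srep.
    by apply: smooth_at_row_mx; [exact: smooth_at_cst|exact: smooth_at_id].
  have -> : dmap (phi s) x = jacobian h (fwd a x).
    have -> : h = (fun z => fwd a (phi s (bwd a z))).
      by apply/funext => z; rewrite /h /rep flow_rep.
    by rewrite /dmap (stat s s01).
  rewrite -deriveEjacobian; last exact: smooth_at_differentiable.
  rewrite /y -[fwd a x]addr0 -[pt s]addr0 -(scale0r v) -(scale0r (e v)).
  have E : (fun r : R => h (fwd a x + r *: v)) = (fun r => rep (pt s + r *: e v)).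
    apply/funext => r.
    by rewrite /h /pt /e scale_row_mx scaler0 add_row_mx addr0.
  by rewrite -derive_line E derive_line.
have Y2 v (s : R) : 0 <= s <= 1 -> is_derive s 1 (y v) (y v s *m A).
  move=> s01.
  have -> : y v = (fun s => 'D_(e v) rep (row_mx 0 (fwd a x) + s *: e0)).
    by apply/funext => r; rewrite row_time.
  have d : differentiable ('D_(e v) rep) (row_mx 0 (fwd a x) + s *: e0).
    apply: smooth_at_differentiable; apply: smooth_at_derive; rewrite row_time; exact: srep.
  apply: (is_derive_eq (is_derive_line d)); rewrite row_time -/(pt s).
  rewrite derive_comm_mx; last exact: srep.
  have dr := smooth_at_differentiable (srep s s01).
  have dF : differentiable (field_in_chart a) (rep (pt s)).
    by rewrite repE//; apply: smooth_at_differentiable; exact: smooth_field_in_chart.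
  transitivity ('D_(e v) (fun z => field_in_chart a (rep z)) (pt s)).
    by apply: near_eq_derive; apply: (flow_equation (Dt s s01) ax); rewrite (stat s s01).
  rewrite (deriveEjacobian _ (differentiable_comp dr dF)).
  by rewrite jacobian_comp// mulmxA -(deriveEjacobian _ dr) repE.
(* The differential of [phi 0] at [x] is the identity because [phi 0] fixes the whole open set [Sg],
   not merely [x]. *)
have Y0 v : y v 0 = v.
  have z01 : 0 <= (0 : R) <= 1 by rewrite lexx ler01.
  rewrite -(Y1 v 0 z01) /dmap (stat 0 z01) -[RHS]mulmx1 -[in RHS](jacobian_id (fwd a x)).
  apply: (congr1 (mulmx v)); apply: esym; apply: jacobian_eq; last first.
    by apply: smooth_at_differentiable; exact: smooth_at_id.
  apply: (@filterS2 _ (nbhs (fwd a x))) (open_near aN oSg Sgx ax) (near_bwd_dom aN ax ax).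
  by move=> z Sz [_ _ zE]; rewrite phi0.
move=> t t01.
have YA v (s : R) : 0 <= s <= 1 -> y v s *m A = v *m A.
  move=> s01; have := @constant_derivative _ _ _ (fun s => y v s *m A) 0 _ s s01.
  rewrite scaler0 addr0 Y0; apply => r r01.
  by rewrite -(mulmx0 _ (y v r)) -AA mulmxA; apply: is_derive_mulmxr; exact: Y2.
apply/row_matrixP => i; rewrite !rowE Y1// mulmxDr mulmx1 -scalemxAr.
rewrite -[X in X + _](Y0 (delta_mx 0 i)); apply: constant_derivative t01 => s s01.
by rewrite -(YA _ _ s01); exact: Y2.
Qed.

End Flow.

(** * Sprays along the zero section *)

Section SprayFlow.
Variables (R : realType).

Lemma Rintegral01_affine (c d : R) :
  \int[@lebesgue_measure R]_(t in `[0, 1]) (c + t * d) = c + d / 2.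
Proof.
pose F (t : R) := c * t + d / 2 * (t * t).
have dF (t : R) : is_derive t 1 F (c + t * d).
  have H1 : is_derive t 1 (fun t : R => c * t) c.
    by apply: is_derive_eq; rewrite -[RHS]mulr1.
  have H2 : is_derive t 1 (fun t : R => t * t) (t + t).
    apply: (is_derive_eq (is_deriveM (is_derive_id t 1) (is_derive_id t 1))).
    by rewrite /GRing.scale /= mulr1.
  have H3 : is_derive t 1 (fun t : R => d / 2 * (t * t)) (d / 2 * (t + t)).
    exact: (is_deriveZ (d / 2) H2).
  apply: (is_derive_eq (is_deriveD H1 H3)); congr (_ + _).
  by field.
have cF : continuous F.
  by move=> t; apply/differentiable_continuous/derivable1_diffP; have [] := dF t.
rewrite /Rintegral (@continuous_FTC2 _ (fun t => c + t * d) F 0 1)//.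
- by rewrite -EFinD /= /F; lra.
- apply: continuous_subspaceT => t; apply: cvgD; first exact: cvg_cst.
  by apply: cvgM; [exact: cvg_id|exact: cvg_cst].
- split.
  + by move=> t _; have [] := dF t.
  + by apply: cvg_at_right_filter; exact: cF.
  + by apply: cvg_at_left_filter; exact: cF.
- by move=> t _; rewrite derive1E; have [_ ->] := dF t.
Qed.

Variables (n : nat) (M : premanifold R n).
Hypothesis aM : atlas M.
Variables (p : M -> 'M[R]_n) (chi : cotangent M -> 'rV[R]_(n + n)).
Hypothesis hchi : poisson_spray p chi.

Lemma spray_horizontal (x : M) (w : 'rV[R]_n) : lsubmx (chi (x, w)) = w *m p x.
Proof.
have [_ H _] := hchi; rewrite -[RHS](H (x, w)) (dmap_cpr aM).
by rewrite -[in RHS](hsubmxK (chi _)) mul_row_col mulmx1 mulmx0 addr0.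
Qed.

Lemma spray_scale (x : M) (w : 'rV[R]_n) (t : R) : 0 < t ->
  chi (x, t *: w) = row_mx (t *: lsubmx (chi (x, w))) ((t * t) *: rsubmx (chi (x, w))).
Proof.
move=> t0; have [_ _ H] := hchi; rewrite -[LHS]/(chi (Defs.cscale t (x, w))) H//.
rewrite (dmap_cscale aM) -[in LHS](hsubmxK (chi (x, w))) mul_row_block.
by rewrite mulmx1 !mulmx0 addr0 add0r mul_mx_scalar scale_row_mx scalerA.
Qed.

(** Homogeneity is given for positive factors only. Scaling by 2 fixes the zero covector, so the
    vertical part there equals four times itself. *)
Lemma spray_zero (x : M) : chi (x, 0) = 0.
Proof.
have E := @spray_scale x 0 2 ltac:(by []); rewrite scaler0 spray_horizontal mul0mx scaler0 in E.
rewrite -[LHS]hsubmxK spray_horizontal mul0mx.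
suff -> : rsubmx (chi (x, 0)) = 0 by rewrite row_mx0.
have /(congr1 rsubmx) := E; rewrite row_mxKr => {}E.
apply/eqP; have : (2 * 2 - 1 : R) *: rsubmx (chi (x, 0)) == 0.
  by rewrite scalerBl scale1r -E subrr.
by rewrite scaler_eq0 => /orP[|//]; rewrite subr_eq0 -natrM pnatr_eq1.
Qed.

(* On the fibers the horizontal part of the spray is linear and its vertical part
   is homogeneous of degree two. *)
Lemma jacobian_spray_zero (x : M) :
  jacobian (field_in_chart (N := cotangent M) chi (pref x))
    (fwd (p := cotangent M) (pref x) (x, 0)) = block_mx 0 0 (p x) 0.
Proof.
have [schi _ _] := hchi; have aT := cotangent_atlas aM.
set a := pref x; have ax : dom a x := atlas_pref aM x.
pose C := field_in_chart (N := cotangent M) chi a.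
pose z0 := fwd (p := cotangent M) a (x, 0).
have z0E : z0 = row_mx (fwd a x) 0 by rewrite /z0 /= mul0mx.
have dC : differentiable C z0.
  apply: smooth_at_differentiable.
  by apply: (smooth_field_in_chart (N := cotangent M) aT schi).
have C0 (q : 'rV[R]_n) : C (row_mx q 0) = 0.
  by rewrite /C /field_in_chart /= row_mxKl row_mxKr mul0mx spray_zero mul0mx.
have Cx (w : 'rV[R]_n) : C (row_mx (fwd a x) w) = chi (x, w).
  have d1 : dfwd a x = 1%:M by rewrite dfwdE (chart_jacobian_id aM ax).
  rewrite /C /field_in_chart.
  have -> : bwd (p := cotangent M) a (row_mx (fwd a x) w) = (x, w).
    by rewrite /= row_mxKl row_mxKr (atlas_fwdK aM ax) d1 trmx1 mulmx1.
  have -> : dfwd (M := cotangent M) a (x, w) = 1%:M.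
    exact: (chart_jacobian_id aT (a := a) (x := (x, w)) ax).
  by rewrite mulmx1.
have H1 (u : 'rV[R]_n) : row_mx u 0 *m jacobian C z0 = 0.
  rewrite -deriveEjacobian// -[z0]addr0 -(scale0r (row_mx u 0)) -derive_line.
  have -> : (fun s : R => C (z0 + s *: row_mx u 0)) = cst 0.
    apply/funext => s; rewrite z0E scale_row_mx scaler0 add_row_mx addr0.
    exact: C0.
  by rewrite scale0r; exact: derive_cst.
have H2 (w : 'rV[R]_n) : row_mx 0 w *m jacobian C z0 = row_mx (w *m p x) 0.
  have L1 := spray_horizontal x w.
  rewrite -deriveEjacobian//.
  (* Homogeneity controls positive [s] only; since the derivative exists, it may be computed as a
     limit from the right. *)
  have dv : derivable C z0 (row_mx 0 w) by exact: diff_derivable.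
  rewrite /derive cvg_at_rightE//; apply/cvg_lim => //.
  pose g (s : R) := row_mx (w *m p x) (s *: rsubmx (chi (x, w))).
  have cg : g s @[s --> 0^'+] --> row_mx (w *m p x) 0.
    have -> : row_mx (w *m p x) 0 = g 0 by rewrite /g scale0r.
    apply: cvg_at_right_filter; apply: for_continuous_mx => i j.
    have -> : (fun s => g s i j) = (fun s => row_mx (w *m p x) 0 i j + s * row_mx 0 (rsubmx (chi (x, w))) i j).
      apply/funext => s; rewrite -scalemx_entry -addmxE scale_row_mx add_row_mx.
      by rewrite scaler0 addr0 add0r.
    apply: continuousD; first exact: cst_continuous.
    by apply: continuousM; [exact: cvg_id|exact: cst_continuous].
  apply: cvg_trans cg; apply: near_eq_cvg.
  near=> s; have s0 : 0 < s by near: s; exact: nbhs_right_gt.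
  rewrite /= z0E scale_row_mx scaler0 add_row_mx addr0 add0r C0 subr0 Cx spray_scale//.
  rewrite scale_row_mx !scalerA mulVf ?gt_eqF// scale1r mulrA mulVf ?gt_eqF// mul1r.
  by rewrite L1.
rewrite -/C -/z0; apply/row_matrixP => i; rewrite !rowE -(hsubmxK (delta_mx 0 i)).
set u := lsubmx _; set w := rsubmx _.
have -> : row_mx u w = row_mx u 0 + row_mx 0 w by rewrite add_row_mx addr0 add0r.
rewrite mulmxDl H1 H2 add0r mulmxDl !mul_row_block.
by rewrite !(mulmx0, mul0mx, addr0, add0r) row_mx0 add0r.
Unshelve. all: by end_near. Qed.

Variables (Sg : set (cotangent M)) (phi : R -> cotangent M -> cotangent M).
Hypotheses (hSg : zero_nbhd Sg) (hphi : is_flow chi Sg phi).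
Hypothesis skew : forall x, (p x)^T = - p x.

(** The linearization has only its lower left block, so its square vanishes as [flow_linearization]
    requires. *)
Lemma dmap_spray_flow_zero (x : M) (t : R) : 0 <= t <= 1 ->
  phi t (x, 0) = (x, 0) /\
  dmap (phi t) (x, 0 : 'rV[R]_n) = block_mx 1%:M 0 (t *: p x) 1%:M.
Proof.
move=> t01; have [schi _ _] := hchi; have aT := cotangent_atlas aM.
have [D [oD DP sP p0 vP]] := hphi; have [oSg Sg0] := hSg.
have Dt (s : R) : 0 <= s <= 1 -> D (s, (x, 0)) by move=> s01; exact: DP.
split; first exact: (flow_stationary aT schi oD sP vP (spray_zero x) Dt (p0 _ (Sg0 x))).
rewrite (flow_linearization aT schi oD sP vP (spray_zero x) Dt oSg (Sg0 x) p0 _ t01).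
  rewrite jacobian_spray_zero scale_block_mx !scaler0.
  by rewrite (scalar_mx_block n n 1) add_block_mx !addr0 add0r.
rewrite jacobian_spray_zero mulmx_block.
by rewrite !(mulmx0, mul0mx, addr0); exact: block_mx0.
Qed.

Lemma Omega_zero (x : M) :
  Omega phi (x, 0 : 'rV[R]_n) = block_mx 0 1%:M (- 1%:M) (p x).
Proof.
pose c : 'M[R]_(n + n) := block_mx 0 1%:M (- 1%:M) 0.
(* Each of the two outer factors of the pullback contributes [t *: p x] to the lower right block,
   one of them through the skewness of [p]; integrating [t] over [0, 1] removes the 2. *)
pose d : 'M[R]_(n + n) := block_mx 0 0 0 (2 *: p x).
have E (t : R) : 0 <= t <= 1 ->
    pullback_form (phi t) (@omega_can R n M) (x, 0 : 'rV[R]_n) = c + t *: d.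
  move=> t01; have [st dst] := dmap_spray_flow_zero x t01.
  rewrite /pullback_form dst /omega_can tr_block_mx !mulmx_block !trmx1 trmx0.
  rewrite !(mulmx0, mul0mx, mul1mx, mulmx1, addr0, add0r).
  rewrite /c /d scale_block_mx add_block_mx !scaler0 !addr0 add0r.
  rewrite linearZ /= skew scalerN mulNmx mul1mx opprK scalerA mulrC -scalerA.
  by rewrite scaler_nat mulr2n -scalerDr.
have -> : block_mx 0 1%:M (- 1%:M) (p x) = c + 2^-1 *: d.
  rewrite /c /d scale_block_mx add_block_mx !scaler0 !addr0 add0r.
  by rewrite scalerA mulVf// scale1r.
apply/matrixP => k l; rewrite mxE.
transitivity (\int[@lebesgue_measure R]_(t in `[0, 1]) (c k l + t * d k l)).
  apply: eq_Rintegral => t; rewrite inE /= in_itv /= => t01.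
  by rewrite E// addmxE scalemx_entry.
by rewrite Rintegral01_affine addmxE scalemx_entry [in RHS]mulrC.
Qed.

End SprayFlow.

(** * Linear algebra of dual pairs *)

Section PointwiseLinearAlgebra.
Variables (R : realFieldType).

Lemma mulmx_tr_eq0 (m n : nat) (A : 'M[R]_(m, n)) : A *m A^T = 0 -> A = 0.
Proof.
move=> A0; apply/matrixP => i j; rewrite [RHS]mxE; apply/eqP.
have /eqP := congr1 (fun M : 'M[R]_m => M i i) A0; rewrite /= !mxE.
rewrite psumr_eq0 => [/allP/(_ j)|l _]; last by rewrite mxE -expr2 sqr_ge0.
by rewrite mem_index_enum mxE -expr2 sqrf_eq0 => /(_ isT).
Qed.

(** Definiteness of a sum of squares. It trades row freeness of a rectangular matrix for
    invertibility of a square one, which is an open condition with a smooth inverse. *)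
Lemma gram_unitmx (m n : nat) (A : 'M[R]_(m, n)) : row_free A -> A *m A^T \in unitmx.
Proof.
move=> fA; rewrite -row_free_unit -kermx_eq0; apply/eqP.
apply: (row_free_inj fA); rewrite mul0mx; apply: mulmx_tr_eq0.
by rewrite trmx_mul mulmxA -(mulmxA _ A) mulmx_ker mul0mx.
Qed.

Lemma gram_row_free (m n : nat) (A : 'M[R]_(m, n)) : A *m A^T \in unitmx -> row_free A.
Proof.
move=> uA; apply/row_freeP; exists (A^T *m invmx (A *m A^T)).
by rewrite mulmxA mulmxV.
Qed.

(** Duality: the columns of [cokermx T^T] lie in the kernel of [T], and killing them is the
    criterion [submxE] for membership in the row space of [T^T]. *)
Lemma annihilator_row (m n : nat) (c : 'rV[R]_m) (T : 'M[R]_(m, n)) :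
  (forall v : 'rV[R]_m, v *m T = 0 -> c *m v^T = 0) -> exists g, c = g *m T^T.
Proof.
move=> H; apply/submxP; rewrite submxE; apply/eqP/row_matrixP => i.
apply/rowP => j; rewrite !mxE.
pose v := (col j (cokermx T^T))^T.
have vT : v *m T = 0.
  by rewrite -[LHS]trmxK trmx_mul /v trmxK colE mulmxA mulmx_coker mul0mx trmx0.
have := congr1 (fun M : 'M[R]_1 => M 0 0) (H v vT); rewrite /v trmxK !mxE => E.
by rewrite -[RHS]E; apply: eq_bigr => l _; rewrite !mxE (ord1 i).
Qed.

Section DualPair.
Variables (m n1 n2 : nat) (S : 'M[R]_(m, n1)) (T : 'M[R]_(m, n2)) (w : 'M[R]_m).
Variables (ps : 'M[R]_n1) (pt : 'M[R]_n2).
Hypotheses (uw : w \in unitmx) (skew : w^T = - w).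
Hypotheses (hS : S^T *m invmx w *m S = ps) (hT : T^T *m invmx w *m T = - pt).
Hypothesis orth : forall u : 'rV[R]_m,
  (forall v : 'rV[R]_m, v *m S = 0 -> u *m w *m v^T = 0) <-> u *m T = 0.

(* With the next lemma: the pullback of graph pt by T is the pullback of graph ps
   by S gauged by - w. *)
Lemma dual_pair_forward (v : 'rV[R]_m) (b : 'rV[R]_n1) : v *m S = b *m ps ->
  exists2 g, b *m S^T - v *m w = g *m T^T & v *m T = g *m pt.
Proof.
(* [y] is the Hamiltonian vector of the covector pulled back by [S]. It is orthogonal to the kernel
   of [S], hence killed by [T], and it has the same image as [v] under [S]; so [v - y] is in the
   kernel of [S] and its contraction with [w] factors through [T]. *)
move=> vS; pose y := b *m S^T *m invmx w.
have yT : y *m T = 0.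
  apply/orth => u uS; rewrite /y mulmxKV//.
  by rewrite -mulmxA -trmx_mul uS trmx0 mulmx0.
have uS : (v - y) *m S = 0.
  by rewrite mulmxBl vS /y -hS !mulmxA subrr.
have [g gE] : exists g, - ((v - y) *m w) = g *m T^T.
  apply: annihilator_row => z zT; rewrite mulNmx.
  have /orth/(_ _ uS) := zT; move/(congr1 trmx).
  by rewrite trmx_mul trmxK trmx_mul skew mulNmx mulmxN mulmxA trmx0 => ->.
have gE' : b *m S^T - v *m w = g *m T^T.
  by rewrite -gE mulmxBl opprB /y mulmxKV.
exists g => //.
have vE : v = y - g *m T^T *m invmx w.
  by rewrite -gE mulNmx opprK mulmxK// addrC subrK.
by rewrite [in LHS]vE mulmxBl yT sub0r -!mulmxA (mulmxA T^T) hT mulmxN opprK.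
Qed.

Lemma dual_pair_backward (v : 'rV[R]_m) (g : 'rV[R]_n2) : v *m T = g *m pt ->
  exists2 b, g *m T^T + v *m w = b *m S^T & v *m S = b *m ps.
Proof.
(* The plus sign reflects that [T] is Poisson onto [- pt]: it makes [y] lie in the kernel of [T]. *)
move=> vT; pose y := v + g *m T^T *m invmx w.
have yT : y *m T = 0.
  by rewrite mulmxDl vT -!mulmxA (mulmxA T^T) hT mulmxN subrr.
have yw : y *m w = g *m T^T + v *m w by rewrite mulmxDl mulmxKV// addrC.
have [b bE] : exists b, y *m w = b *m S^T.
  by apply: annihilator_row => u uS; apply/orth: u uS.
exists b; first by rewrite -yw.
(* Covectors pulled back by [S] commute with those pulled back by [T]: Hamiltonian vectors of the
   former are in the kernel of [T], and skewness of the inverse of [w] transposes this. *)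
have zero : g *m T^T *m invmx w *m S = 0.
  suff H : S^T *m invmx w *m T = 0.
    have iw : (invmx w)^T = - invmx w.
      apply: (can_inj (mulmxK uw)); rewrite mulNmx mulVmx//.
      have -> : (invmx w)^T *m w = - ((invmx w)^T *m w^T) by rewrite skew mulmxN opprK.
      by rewrite -trmx_mul mulmxV// trmx1.
    have := congr1 trmx H; rewrite !trmx_mul trmxK trmx0 iw mulNmx mulmxN => /eqP.
    by rewrite oppr_eq0 => /eqP H'; rewrite -!mulmxA H' mulmx0.
  apply/row_matrixP => l; rewrite !row_mul row0.
  apply/orth => u uS; rewrite mulmxKV//.
  by rewrite -row_mul -trmx_mul uS trmx0 row0.
have -> : v = y - g *m T^T *m invmx w by rewrite addrK.
by rewrite mulmxBl zero subr0 -hS !mulmxA -bE mulmxK.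
Qed.

End DualPair.

(** Here [J] is the differential of j, [S] and [T] those of pr and exp, [A] that of the projection
    to X, [D] of i, [F] of f with inverse [G], and [I] of the inclusion of P. The sign in [hT] says
    that exp is anti-Poisson, and the right-hand side is the gauged pullback with its definitions
    unfolded. *)
Lemma local_model_graph (m l k n q : nat) (J : 'M[R]_(m, l)) (S T : 'M[R]_(l, n))
    (w : 'M[R]_l) (ps pt : 'M[R]_n) (A : 'M[R]_(m, k)) (D : 'M[R]_(k, n))
    (F : 'M[R]_(m, q)) (G : 'M[R]_(q, m)) (I : 'M[R]_(q, n)) (pP : 'M[R]_q) :
  w \in unitmx -> w^T = - w ->
  S^T *m invmx w *m S = ps -> T^T *m invmx w *m T = - pt ->
  (forall u : 'rV[R]_l,
    (forall v : 'rV[R]_l, v *m S = 0 -> u *m w *m v^T = 0) <-> u *m T = 0) ->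
  A *m D = J *m S -> F *m I = J *m T -> F *m G = 1%:M -> G *m F = 1%:M ->
  row_free I -> I^T *m pP *m I = pt ->
  forall v a : 'rV[R]_m,
  v = a *m (G^T *m pP *m G) <->
  exists2 al : 'rV[R]_m,
    exists2 be1 : 'rV[R]_k,
      exists2 be : 'rV[R]_n, v *m A *m D = be *m ps & be1 = be *m D^T &
      al = be1 *m A^T &
    a = al + v *m (- (J *m w *m J^T)).
Proof.
move=> uw skew hS hT orth AD FI FG GF fI hI v a.
have GFT : F^T *m G^T = 1%:M by rewrite -trmx_mul GF trmx1.
have FGT : G^T *m F^T = 1%:M by rewrite -trmx_mul FG trmx1.
split=> [vE|[al [be1 [be E1 ->] ->] ->]].
  (* Covectors on P extend to M because [I] is injective. *)
  have [g gE] : exists g, a *m G^T = g *m I^T.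
    apply/submxP; apply: submx_full; rewrite /row_full mxrank_tr.
    exact: fI.
  have aE : a = g *m I^T *m F^T by rewrite -gE -mulmxA FGT mulmx1.
  have vT : (v *m J) *m T = g *m pt.
    rewrite -mulmxA -FI vE -hI !mulmxA gE; congr (_ *m _).
    by rewrite -!mulmxA GF mulmx1.
  have [be b1 b2] := dual_pair_backward uw skew hS hT orth vT.
  exists (be *m D^T *m A^T).
    exists (be *m D^T) => //; exists be => //.
    by rewrite -mulmxA AD mulmxA.
  rewrite -mulmxA -trmx_mul AD trmx_mul mulmxA -b1 mulmxDl mulmxN !mulmxA addrK.
  by rewrite -(mulmxA g) -trmx_mul -FI trmx_mul mulmxA.
have vS : (v *m J) *m S = be *m ps by rewrite -mulmxA -AD mulmxA.
have [g g1 g2] := dual_pair_forward uw skew hS hT orth vS.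
have -> : be *m D^T *m A^T + v *m (- (J *m w *m J^T)) = g *m I^T *m F^T.
  rewrite -mulmxA -trmx_mul AD trmx_mul mulmxN !mulmxA -mulmxBl g1.
  by rewrite -!mulmxA -!trmx_mul FI.
have vF : v *m F = g *m I^T *m pP.
  apply: (row_free_inj fI) => /=; rewrite -(mulmxA v) FI mulmxA g2 -hI.
  by rewrite !mulmxA.
rewrite !mulmxA -(mulmxA _ F^T) GFT mulmx1 -vF -mulmxA FG.
by rewrite mulmx1.
Qed.

End PointwiseLinearAlgebra.

(** * Frames of subbundles *)

Section TupleMatrix.
Variables (R : fieldType) (r n : nat).

Definition frame_mx (s : r.-tuple 'rV[R]_n) : 'M[R]_(r, n) := \matrix_d tnth s d.

Definition mx_rows (U : 'M[R]_(r, n)) : r.-tuple 'rV[R]_n := [tuple row d U | d < r].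

Lemma mx_rowsK (U : 'M[R]_(r, n)) : frame_mx (mx_rows U) = U.
Proof. by apply/row_matrixP => d; rewrite rowK tnth_mktuple. Qed.

Lemma frame_mx_sum (s : r.-tuple 'rV[R]_n) (c : 'rV[R]_r) :
  c *m frame_mx s = \sum_(d < r) c 0 d *: s`_d.
Proof.
rewrite mulmx_sum_row; apply: eq_bigr => d _.
by rewrite rowK (tnth_nth 0).
Qed.

Lemma mem_span_frame (s : r.-tuple 'rV[R]_n) (v : 'rV[R]_n) :
  v \in span s <-> exists c, v = c *m frame_mx s.
Proof.
split=> [/coord_span vE|[c ->]].
  exists (\row_d coord s d v); rewrite frame_mx_sum [LHS]vE.
  by apply: eq_bigr => d _; rewrite mxE.
rewrite frame_mx_sum; apply: memv_suml => d _; apply: memvZ.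
by apply: memv_span; rewrite mem_nth// size_tuple.
Qed.

Lemma free_frame (s : r.-tuple 'rV[R]_n) : free s = row_free (frame_mx s).
Proof.
apply/freeP/idP => [H|H c c0 d].
  rewrite -kermx_eq0; apply/eqP/row_matrixP => l; apply/rowP => d; rewrite row0 [RHS]mxE.
  apply: (H (fun d => row l (kermx (frame_mx s)) 0 d)).
  by rewrite -frame_mx_sum -row_mul mulmx_ker row0.
have : (\row_d c d) *m frame_mx s = 0.
  by rewrite frame_mx_sum -[RHS]c0; apply: eq_bigr => l _; rewrite mxE.
rewrite -(mul0mx _ (frame_mx s)) => /(row_free_inj H)/rowP/(_ d).
by rewrite !mxE.
Qed.

Lemma rank_select (m : nat) (N : 'M[R]_(m, n)) : \rank N = r ->
  exists C : 'M[R]_(r, m), row_free (C *m N).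
Proof.
move=> <-; have /submxP[C CE] : (row_base N <= N)%MS by rewrite eq_row_base.
by exists C; rewrite -CE row_base_free.
Qed.

End TupleMatrix.

Section SmoothMatrix.
Variables (R : realType) (k : nat) (X : premanifold R k).
Hypothesis aX : atlas X.

Definition mx_smooth (a b : nat) (F : X -> 'M[R]_(a, b)) (x : X) : Prop :=
  smooth_at (fun z => F (bwd (pref x) z)) (fwd (pref x) x).

Lemma mx_smooth_charts (a b : nat) (F : X -> 'M[R]_(a, b)) (x : X) (c c' : Defs.index X) :
  dom c x -> dom c' x -> smooth_at (fun z => F (bwd c z)) (fwd c x) ->
  smooth_at (fun z => F (bwd c' z)) (fwd c' x).
Proof.
move=> cx c'x sF; have [_ s] := chart_smooth_id aX c'x cx.
apply: (@smooth_at_eq _ _ _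
    (fun z => F (bwd c (local_rep (M := X) (N := X) c' c (fun y => y) z)))).
  apply: (@filterS _ (nbhs (fwd c' x))) (near_bwd_dom aX c'x cx) => z [_ cz _].
  by rewrite /local_rep (atlas_fwdK aX cz).
apply: (@smooth_at_comp _ _ _ _ _ (local_rep c' c (fun y => y)) (fun z => F (bwd c z))) => //.
by rewrite /local_rep (atlas_fwdK aX c'x).
Qed.

Lemma mx_smoothP (a b : nat) (F : X -> 'M[R]_(a, b)) (x : X) (c : Defs.index X) :
  dom c x -> mx_smooth F x <-> smooth_at (fun z => F (bwd c z)) (fwd c x).
Proof.
by move=> cx; split; apply: mx_smooth_charts => //; exact: atlas_pref.
Qed.

Lemma mx_smooth_eq (a b : nat) (A : set X) (F G : X -> 'M[R]_(a, b)) (x : X) :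
  open A -> A x -> (forall y, A y -> F y = G y) -> mx_smooth F x -> mx_smooth G x.
Proof.
move=> oA Ax FG; apply: smooth_at_eq.
apply: (@filterS _ (nbhs (fwd (pref x) x))) (open_near aX oA Ax (atlas_pref aX x)) => z Az.
exact: FG.
Qed.

Lemma open_charts (A : set X) :
  (forall x, A x -> exists2 c, dom c x & \forall z \near fwd c x, A (bwd c z)) -> open A.
Proof.
move=> H; suff: chart_open A by [].
move=> c z [x cx <-]; rewrite (atlas_fwdK aX cx) => Ax.
have [c' c'x N] := H x Ax; have [_ s] := chart_smooth_id aX cx c'x.
have E : local_rep c c' (fun y => y) (fwd c x) = fwd c' x.
  by rewrite /local_rep (atlas_fwdK aX cx).
have N' : nbhs (local_rep c c' (fun y => y) (fwd c x)) [set z | A (bwd c' z)] by rewrite E.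
apply: (@filterS2 _ (nbhs (fwd c x))) (smooth_at_continuous s N') (near_bwd_dom aX cx c'x).
by move=> z' + [_ c'z _] _; rewrite /= /local_rep (atlas_fwdK aX c'z).
Qed.

(** Row freeness is invertibility of the Gram matrix, an open condition on the determinant. *)
Lemma open_row_free (a b : nat) (F : X -> 'M[R]_(a, b)) (A : set X) :
  open A -> (forall x, A x -> mx_smooth F x) -> open (A `&` [set x | row_free (F x)]).
Proof.
move=> oA sF; apply: open_charts => x [Ax fx]; exists (pref x); first exact: atlas_pref.
have sFF : smooth_at (fun z => F (bwd (pref x) z) *m (F (bwd (pref x) z))^T) (fwd (pref x) x).
  apply: smooth_at_mulmx; first exact: sF.
  by apply: smooth_at_trmx; exact: sF.
have u : F (bwd (pref x) (fwd (pref x) x)) *m (F (bwd (pref x) (fwd (pref x) x)))^T \in unitmx.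
  by rewrite (atlas_fwdK aX (atlas_pref aX x)); exact: gram_unitmx.
apply: (@filterS2 _ (nbhs (fwd (pref x) x))) (near_unitmx sFF u)
  (open_near aX oA Ax (atlas_pref aX x)).
by move=> z uz Az; split=> //; exact: gram_row_free.
Qed.

Variables (n : nat) (M : premanifold R n) (i : X -> M).
Hypotheses (aM : atlas M) (si : forall x, smooth_pt i x).

Lemma mx_smooth_comp (a b : nat) (c : Defs.index M) (H : 'rV[R]_n -> 'M[R]_(a, b)) (x : X) :
  dom c (i x) -> smooth_at H (fwd c (i x)) -> mx_smooth (fun y => H (fwd c (i y))) x.
Proof.
move=> cx sH; have px := atlas_pref aX x.
have [_ s] := smooth_pt_charts aX aM (si x) px cx.
apply: (@smooth_at_comp _ _ _ _ _ (local_rep (pref x) c i) H) => //.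
by rewrite /local_rep (atlas_fwdK aX px).
Qed.

Lemma open_preimage_dom (c : Defs.index M) : open (i @^-1` dom c).
Proof.
apply: open_charts => x cx; exists (pref x); first exact: atlas_pref.
by have [] := smooth_pt_charts aX aM (si x) (atlas_pref aX x) cx.
Qed.

Lemma mx_smooth_chart_change (b b' : Defs.index M) (x : X) :
  dom b (i x) -> dom b' (i x) ->
  mx_smooth (fun y => chart_jacobian b b' (fun y => y) (i y)) x.
Proof.
move=> bx b'x; apply: (@mx_smooth_comp _ _ b (jacobian (local_rep (M := M) (N := M) b b' (fun y => y)))) => //.
by apply: smooth_at_jacobian; have [] := chart_smooth_id aM bx b'x.
Qed.

Lemma mx_smooth_chart_jacobian (a : Defs.index X) (b : Defs.index M) (x : X) :
  dom a x -> dom b (i x) -> mx_smooth (fun y => chart_jacobian a b i y) x.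
Proof.
move=> ax bx; apply/(mx_smoothP _ ax).
have [_ s] := smooth_pt_charts aX aM (si x) ax bx.
apply: (@smooth_at_eq _ _ _ (jacobian (local_rep a b i))).
  apply: (@filterS _ (nbhs (fwd a x))) (near_bwd_dom aX ax ax) => z [_ _ zE].
  by rewrite /chart_jacobian zE.
exact: smooth_at_jacobian.
Qed.

Lemma smooth_section_mx (V : set X) (u : X -> 'rV[R]_n) : open V ->
  smooth_section i V u <-> forall (x : X) (b : Defs.index M), V x -> dom b (i x) ->
    mx_smooth (fun y => u y *m dfwd b (i y)) x.
Proof.
move=> oV; split=> [su x b Vx bx|H a b].
  apply: Cinfty_smooth_at (su (pref x) b).
  have px := atlas_pref aX x.
  have oVb : open (V `&` i @^-1` dom b) by apply: openI => //; exact: open_preimage_dom.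
  apply: (@filterS _ (nbhs (fwd (pref x) x))) (chart_set_nbhs aX oVb (conj Vx bx) px).
  by move=> _ [y [[Vy by_] ay] <-]; exists y.
apply: smooth_at_Cinfty => _ [x [[Vx ax] bx] <-].
exact: (mx_smoothP (fun y => u y *m dfwd b (i y)) ax).1 (H x b Vx bx).
Qed.

Lemma smooth_section_chart (V : set X) (b : Defs.index M) (u : X -> 'rV[R]_n) : open V ->
  (forall x, V x -> dom b (i x) /\ mx_smooth (fun y => u y *m dfwd b (i y)) x) ->
  smooth_section i V u.
Proof.
move=> oV H; apply/(smooth_section_mx _ oV) => x b' Vx b'x.
have [bx sb] := H x Vx.
have oA : open (i @^-1` dom b `&` i @^-1` dom b') by apply: openI; exact: open_preimage_dom.
apply: (@mx_smooth_eq _ _ _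
    (fun y => u y *m dfwd b (i y) *m chart_jacobian b b' (fun y => y) (i y)) _ _ oA).
- exact: conj bx b'x.
- move=> y [by_ b'y]; rewrite -mulmxA !dfwdE.
  by rewrite (chart_jacobian_idM aM (atlas_pref aM (i y)) by_ b'y).
- by apply: smooth_at_mulmx; [exact: sb|exact: (mx_smooth_chart_change bx b'x)].
Qed.

Lemma frame_mx_smooth (r : nat) (S : X -> {vspace 'rV[R]_n}) (V : set X)
    (s : X -> r.-tuple 'rV[R]_n) (x : X) (b : Defs.index M) :
  open V -> smooth_frame i S V s -> V x -> dom b (i x) ->
  mx_smooth (fun y => frame_mx (s y) *m dfwd b (i y)) x.
Proof.
move=> oV [_ ss] Vx bx; apply/smooth_at_mxP => d j.
have /(smooth_section_mx _ oV)/(_ x b Vx bx) s1 := ss d.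
have E : (fun z => (frame_mx (s (bwd (pref x) z)) *m dfwd b (i (bwd (pref x) z))) d j) =
    (fun z => (tnth (s (bwd (pref x) z)) d *m dfwd b (i (bwd (pref x) z))) 0 j).
  apply/funext => z; rewrite -[tnth _ d](rowK (fun d => tnth (s (bwd (pref x) z)) d)) -row_mul.
  by rewrite [RHS]mxE.
by rewrite E; exact: smooth_at_entry.
Qed.

End SmoothMatrix.

(** * Local smooth frames of the perp bundle *)

Section PerpBundle.
Variables (R : realType) (k n r : nat) (X : premanifold R k) (M : premanifold R n).
Variables (p : M -> 'M[R]_n) (i : X -> M).
Hypotheses (aX : atlas X) (aM : atlas M) (si : forall x, smooth_pt i x).
Hypotheses (fi : forall x, row_free (dmap i x)) (hp : poisson setT p).
Hypothesis hr : coregular r p i.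

Lemma conormalP (x : X) (al : 'rV[R]_n) :
  al \in conormal i x <-> al *m (dmap i x)^T = 0.
Proof.
rewrite /conormal memv_ker (lfunE (mulmxr (dmap i x)^T)) /=.
by split => [/eqP|->].
Qed.

Lemma perpP (x : X) (v : 'rV[R]_n) :
  v \in perp p i x <-> exists2 al, al *m (dmap i x)^T = 0 & v = al *m p (i x).
Proof.
have shE al : linfun (sharp p (i x)) al = al *m p (i x).
  exact: (lfunE (mulmxr (p (i x)))).
split=> [/memv_imgP[al /conormalP al0 ->]|[al /conormalP al0 ->]].
  by exists al.
by rewrite -shE; exact: memv_img.
Qed.

(** [Q] has the row space of the transposed cokernel of [dmap i x]. Coregularity concerns [p]
    followed by that cokernel, and passes to [Q *m p (i x)] by transposition and skewness of [p]. *)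
Lemma perp_rows (x : X) (Q : 'M[R]_n) :
  Q *m (dmap i x)^T = 0 ->
  (forall al : 'rV[R]_n, al *m (dmap i x)^T = 0 -> exists g, al = g *m Q) ->
  \rank (Q *m p (i x)) = r /\
  forall v : 'rV[R]_n, v \in perp p i x <-> exists c, v = c *m (Q *m p (i x)).
Proof.
move=> Q0 Qgen; split; last first.
  move=> v; rewrite perpP; split=> [[al /Qgen[g ->] ->]|[c ->]].
    by exists g; rewrite mulmxA.
  by exists (c *m Q); rewrite ?mulmxA// -mulmxA Q0 mulmx0.
pose K := (cokermx (dmap i x))^T.
have KQ : (K == Q)%MS.
  apply/andP; split; apply/row_subP => l; apply/submxP.
    apply: Qgen; rewrite -row_mul -trmx_mul mulmx_coker trmx0; exact: row0.
  apply: annihilator_row => v /eqP; rewrite -submxE => /submxP[c ->].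
  by rewrite trmx_mul mulmxA -row_mul Q0 row0 mul0mx.
rewrite -(hr x) -(eqmxMr (p (i x)) (eqmxP KQ)) -mxrank_tr trmx_mul trmxK.
have [skew _ _] := hp; rewrite skew// mulNmx.
exact: mxrank_opp.
Qed.

(** The Euclidean orthogonal projection, in coordinates, onto the annihilator of the rows of [D]. It
    presents the same space as [cokermx D], but as a smooth function of [D]. *)
Definition conormal_projector (D : 'M[R]_(k, n)) : 'M[R]_n :=
  1%:M - D^T *m invmx (D *m D^T) *m D.

Lemma conormal_projectorP (D : 'M[R]_(k, n)) : row_free D ->
  conormal_projector D *m D^T = 0 /\
  forall al : 'rV[R]_n, al *m D^T = 0 -> al *m conormal_projector D = al.
Proof.
move=> fD; have uD := gram_unitmx fD; split=> [|al al0].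
  by rewrite mulmxBl mul1mx -!mulmxA mulVmx// mulmx1 subrr.
by rewrite mulmxBr mulmx1 !mulmxA al0 !mul0mx subr0.
Qed.

Lemma perp_dim (x : X) : \dim (perp p i x) = r.
Proof.
have [Q0 Qg] := conormal_projectorP (fi x).
set Q := conormal_projector _ in Q0 Qg.
have [|rk mem] := @perp_rows x Q Q0; first by move=> al /Qg E; exists al.
have [C fC] := rank_select rk.
pose s := mx_rows (C *m (Q *m p (i x))).
suff b : basis_of (perp p i x) s by rewrite -(size_basis b).
have sub : (Q *m p (i x) <= C *m (Q *m p (i x)))%MS.
  have /eqP rC : \rank (C *m (Q *m p (i x))) == r by exact: fC.
  by rewrite -(geq_leqif (mxrank_leqif_sup (submxMl C _))) rC rk.
rewrite /basis_of free_frame mx_rowsK fC andbT; apply/eqP/vspaceP => v.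
apply/idP/idP => [/mem_span_frame[c ->]|/mem[c ->]].
  by rewrite mx_rowsK; apply/mem; exists (c *m C); rewrite mulmxA.
apply/mem_span_frame; rewrite mx_rowsK.
by apply/submxP; apply: submx_trans sub; exact: submxMl.
Qed.

Lemma chart_jacobian_row_free (a : Defs.index X) (b : Defs.index M) (x : X) :
  dom a x -> dom b (i x) -> row_free (chart_jacobian a b i x).
Proof.
move=> ax bx; rewrite (chart_jacobian_dmap aX aM (si x) ax bx).
have fF : row_free (dfwd b (i x)) by apply/row_freeP; exists (dbwd b (fwd b (i x))); exact: dfwd_dbwd.
have fB : row_free (dbwd a (fwd a x)) by apply/row_freeP; exists (dfwd a x); exact: dbwd_dfwd.
by rewrite /row_free (mxrankMfree _ fF) (mxrankMfree _ (fi x)); exact: fB.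
Qed.

(** The projector is formed in the fixed charts [a] and [b], where it varies smoothly; the factor
    [dfwd b] converts its rows to the preferred chart. *)
Lemma perp_chart_rows (a : Defs.index X) (b : Defs.index M) (x : X) :
  dom a x -> dom b (i x) ->
  let Q := conormal_projector (chart_jacobian a b i x) *m (dfwd b (i x))^T in
  \rank (Q *m p (i x)) = r /\
  forall v : 'rV[R]_n, v \in perp p i x <-> exists c, v = c *m (Q *m p (i x)).
Proof.
move=> ax bx Q.
have [Q0 Qg] := conormal_projectorP (chart_jacobian_row_free ax bx).
have JE := chart_jacobian_dmap aX aM (si x) ax bx.
have FB : (dbwd b (fwd b (i x)))^T *m (dfwd b (i x))^T = 1%:M.
  by rewrite -trmx_mul (dfwd_dbwd aM bx) trmx1.
have JE' : (dfwd b (i x))^T *m (dmap i x)^T = (chart_jacobian a b i x)^T *m (dfwd a x)^T.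
  rewrite -!trmx_mul JE !mulmxA (dfwd_dbwd aX ax) mul1mx; congr (_^T).
apply: perp_rows => [|al al0].
  by rewrite /Q -mulmxA JE' mulmxA Q0 mul0mx.
exists (al *m (dbwd b (fwd b (i x)))^T); rewrite /Q mulmxA Qg.
  by rewrite -mulmxA FB mulmx1.
rewrite JE trmx_mul mulmxA -(mulmxA al) FB mulmx1.
by rewrite trmx_mul mulmxA al0 mul0mx.
Qed.

(** The constant matrix [C] selects [r] combinations of the generators that are independent at [x0].
    They remain independent nearby, and there form bases because the dimension is constantly [r]. *)
Lemma perp_subbundle : subbundle r i (perp p i).
Proof.
move=> x0; pose a := pref x0; pose b := pref (i x0).
have ax0 : dom a x0 := atlas_pref aX x0; have bx0 : dom b (i x0) := atlas_pref aM (i x0).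
pose Q x := conormal_projector (chart_jacobian a b i x).
pose N x := Q x *m (dfwd b (i x))^T *m p (i x).
have [rk0 _] := perp_chart_rows ax0 bx0.
have [C fC] := rank_select rk0.
pose U x := C *m N x.
pose A := dom a `&` i @^-1` dom b.
have oA : open A.
  by apply: openI; [exact: dom_open|exact: (open_preimage_dom aX aM si)].
have sU x : A x -> mx_smooth (fun y => U y *m dfwd b (i y)) x.
  move=> [ax bx].
  have sJ := mx_smooth_chart_jacobian aX aM si ax bx.
  have px := atlas_pref aX x.
  have uJ : chart_jacobian a b i (bwd (pref x) (fwd (pref x) x)) *m
      (chart_jacobian a b i (bwd (pref x) (fwd (pref x) x)))^T \in unitmx.
    rewrite (atlas_fwdK aX px); apply: gram_unitmx; exact: chart_jacobian_row_free.
  have sQ : mx_smooth Q x.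
    rewrite /mx_smooth /Q /conormal_projector; apply: smooth_atB; first exact: smooth_at_cst.
    apply: smooth_at_mulmx; last exact: sJ.
    apply: smooth_at_mulmx; first exact: smooth_at_trmx sJ.
    apply: smooth_at_invmx => //; apply: smooth_at_mulmx; first exact: sJ.
    exact: smooth_at_trmx sJ.
  have sP : mx_smooth (fun y => bivector_in_chart b p (fwd b (i y))) x.
    apply: (mx_smooth_comp aX aM si bx).
    have [_ sp _] := hp; apply: Cinfty_smooth_at (sp b).
    by apply: chart_set_nbhs => //; exact: openT.
  apply: (@mx_smooth_eq _ _ _ aX _ _ A
    (fun y => C *m (Q y *m bivector_in_chart b p (fwd b (i y)))) _ _ oA) => //.
    move=> y [ay by_]; rewrite /bivector_in_chart (atlas_fwdK aM by_) /U /N.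
    by rewrite !mulmxA.
  apply: smooth_at_mulmx; first exact: smooth_at_cst.
  by apply: smooth_at_mulmx; [exact: sQ|exact: sP].
pose V := A `&` [set x | row_free (U x *m dfwd b (i x))].
have oV : open V by exact: open_row_free.
have fU x : A x -> row_free (U x *m dfwd b (i x)) = row_free (U x).
  move=> [_ bx]; rewrite /row_free mxrankMfree//.
  by apply/row_freeP; exists (dbwd b (fwd b (i x))); exact: dfwd_dbwd.
exists V, (fun x => mx_rows (U x)); split=> //.
  by split; [exact: conj ax0 bx0|rewrite /= fU//; exact: conj ax0 bx0].
split=> [x [Ax fx]|d].
  have [ax bx] := Ax.
  have [_ mem] := perp_chart_rows ax bx.
  rewrite basisEfree free_frame mx_rowsK -fU// fx /=.
  rewrite perp_dim (size_tuple (mx_rows (U x))) leqnn andbT; apply/subvP => v vs.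
  have [c ->] := (mem_span_frame (mx_rows (U x)) v).1 vs.
  by rewrite mx_rowsK; apply/mem; exists (c *m C); rewrite /U /N !mulmxA.
apply: (smooth_section_chart aX aM si (b := b) oV) => x [Ax fx]; split; first by case: Ax.
have E : (fun z => tnth (mx_rows (U (bwd (pref x) z))) d *m dfwd b (i (bwd (pref x) z))) =
    (fun z => row d (U (bwd (pref x) z) *m dfwd b (i (bwd (pref x) z)))).
  by apply/funext => z; rewrite tnth_mktuple row_mul.
rewrite /mx_smooth E; apply/smooth_at_mxP => l j.
under eq_fun do rewrite mxE.
by apply: smooth_at_entry; exact: sU.
Qed.

End PerpBundle.

(** * The dual of a subbundle *)

Section DualBundleAtlas.
Variables (R : realType) (k n r : nat) (X : premanifold R k) (M : premanifold R n).
Variables (i : X -> M) (S : X -> {vspace 'rV[R]_n}).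
Hypotheses (aX : atlas X) (aM : atlas M) (si : forall x, smooth_pt i x).
Hypothesis hS : subbundle r i S.

Lemma hom_frame (x : X) (s : r.-tuple 'rV[R]_n) (xi : 'Hom(subvs_of (S x), R^o))
    (c : 'rV[R]_r) :
  xi (vsproj (S x) (c *m frame_mx s)) = \sum_d c 0 d * xi (vsproj (S x) (tnth s d)).
Proof.
rewrite frame_mx_sum !linear_sum; apply: eq_bigr => d _.
by rewrite !linearZ /= (tnth_nth 0).
Qed.

Lemma hom_frame_eq (x : X) (s : r.-tuple 'rV[R]_n) (xi xi' : 'Hom(subvs_of (S x), R^o)) :
  basis_of (S x) s ->
  (forall d, xi (vsproj (S x) (tnth s d)) = xi' (vsproj (S x) (tnth s d))) -> xi = xi'.
Proof.
move=> /andP[/eqP bs _] H; apply/lfunP => v.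
have [c vE] : exists c, vsval v = c *m frame_mx s.
  by apply/mem_span_frame; rewrite bs; exact: subvsP.
rewrite -[v]vsvalK vE !hom_frame; apply: eq_bigr => d _.
by rewrite H.
Qed.

Lemma frame_functionalE (x : X) (s : X -> r.-tuple 'rV[R]_n) (y c : 'rV[R]_r) :
  basis_of (S x) (s x) ->
  frame_functional S s y x (vsproj (S x) (c *m frame_mx (s x))) = (y *m c^T) 0 0.
Proof.
move=> /andP[/eqP bs fs].
have flin : linear (fun v : subvs_of (S x) =>
    (\sum_(d < r) y 0 d * coord (s x) d (vsval v)) : R^o).
  move=> t u v; rewrite /GRing.scale /= mulr_sumr -big_split; apply: eq_bigr => d _ /=.
  by rewrite !linearP /= mulrDr mulrCA.
pose FM := GRing.isLinear.Build _ _ _ _ _ flin.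
pose F : {linear subvs_of (S x) -> R^o} := HB.pack (fun v : subvs_of (S x) =>
    (\sum_(d < r) y 0 d * coord (s x) d (vsval v)) : R^o) FM.
rewrite -[frame_functional _ _ _ _]/(linfun F) lfunE /= vsprojK; last first.
  by rewrite -bs; apply/mem_span_frame; exists c.
rewrite mxE; apply: eq_bigr => d _; rewrite [RHS]mulrC trmxE [RHS]mulrC; congr (_ * _).
by rewrite frame_mx_sum coord_sum_free.
Qed.

Lemma frame_functional_tnth (x : X) (s : X -> r.-tuple 'rV[R]_n) (y : 'rV[R]_r) d :
  basis_of (S x) (s x) ->
  frame_functional S s y x (vsproj (S x) (tnth (s x) d)) = y 0 d.
Proof.
move=> bs; have <- : delta_mx 0 d *m frame_mx (s x) = tnth (s x) d by rewrite -rowE rowK.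
by rewrite frame_functionalE// trmx_delta -colE mxE.
Qed.

Lemma dual_dom_ex (e : dual_bundle r i S) : exists c, dom (p := dual_bundle r i S) c e.
Proof.
have [V [s [oV Vx [bs ss]]]] := hS (projT1 e).
exists (pref (projT1 e), V `&` dom (pref (projT1 e)), s); split => //=.
- by apply: openI => //; exact: dom_open.
- split=> [y [Vy _]|d a b]; first exact: bs.
  move=> l; apply: Ck_subset (ss d a b l) => _ [y [[[Vy _] ay] by_] <-].
  by exists y.
- by split=> //; exact: atlas_pref.
Qed.

Definition dual_frame_pt (s : X -> r.-tuple 'rV[R]_n) (y : 'rV[R]_r) (x : X)
    : dual_bundle r i S :=
  dual_pt r i (frame_functional S s y x).

Lemma dual_frame_ptE (c : dual_index n r X) (y : 'rV[R]_r) (x : X) :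
  open c.1.2 -> c.1.2 `<=` dom c.1.1 -> smooth_frame i S c.1.2 c.2 -> c.1.2 x ->
  dom (p := dual_bundle r i S) c (dual_frame_pt c.2 y x) /\
  fwd (p := dual_bundle r i S) c (dual_frame_pt c.2 y x) = row_mx (fwd c.1.1 x) y.
Proof.
move=> oV Va sf Vx; split; first by split.
rewrite /= /dual_fwd /=; congr row_mx; apply/rowP => d; rewrite mxE.
by rewrite frame_functional_tnth//; have [bs _] := sf; exact: bs.
Qed.

Lemma dual_bwdE (c : dual_index n r X) (x : X) (y : 'rV[R]_r) : dom c.1.1 x ->
  bwd (p := dual_bundle r i S) c (row_mx (fwd c.1.1 x) y) = dual_frame_pt c.2 y x.
Proof.
move=> cx; rewrite /= /dual_bwd row_mxKl row_mxKr.
exact: (congr1 (dual_frame_pt c.2 y) (atlas_fwdK aX cx)).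
Qed.

Lemma dual_fwdK (c : dual_index n r X) (e : dual_bundle r i S) :
  dom (p := dual_bundle r i S) c e ->
  bwd (p := dual_bundle r i S) c (fwd (p := dual_bundle r i S) c e) = e.
Proof.
case: e => x xi [/= oV Va sf Vx].
apply: etrans (dual_bwdE (c := c) _ (Va x Vx)) _.
congr (existT _ x _); have bs := sf.1 _ Vx.
apply: (hom_frame_eq bs) => d.
by rewrite frame_functional_tnth// mxE.
Qed.

Lemma dual_image (c c' : dual_index n r X) :
  open c.1.2 -> c.1.2 `<=` dom c.1.1 -> smooth_frame i S c.1.2 c.2 ->
  open c'.1.2 -> c'.1.2 `<=` dom c'.1.1 -> smooth_frame i S c'.1.2 c'.2 ->
  fwd (p := dual_bundle r i S) c @`
    (dom (p := dual_bundle r i S) c `&` dom (p := dual_bundle r i S) c') =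
  lsubmx @^-1` (fwd c.1.1 @` (c.1.2 `&` c'.1.2)).
Proof.
move=> oV Va sf oV' Va' sf'; apply/seteqP; split=> [_ [e [ce ce'] <-]|z [x [Vx V'x] xE]].
  exists (projT1 e); last by rewrite /= /dual_fwd row_mxKl.
  by move: ce ce' => [_ _ _ ?] [_ _ _ ?].
have [d1 d2] := dual_frame_ptE (rsubmx z) oV Va sf Vx.
exists (dual_frame_pt c.2 (rsubmx z) x); last by rewrite d2 xE hsubmxK.
by split.
Qed.

(** The transition matrix between two frames is unique but has to be exhibited as a smooth
    expression; [B^T *m invmx (B *m B^T)] is a right inverse of [B], the matrix of the frame [s] in
    the chart [b]. *)
Lemma frame_change (V V' : set X) (s s' : X -> r.-tuple 'rV[R]_n) (x : X)
    (b : Defs.index M) :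
  smooth_frame i S V s -> smooth_frame i S V' s' -> V x -> V' x -> dom b (i x) ->
  let B := frame_mx (s x) *m dfwd b (i x) in
  row_free B /\
  frame_mx (s' x) =
    frame_mx (s' x) *m dfwd b (i x) *m B^T *m invmx (B *m B^T) *m frame_mx (s x).
Proof.
move=> [bs _] [bs' _] Vx V'x bx B.
have /andP[/eqP sp fs] := bs x Vx; have fr : row_free (frame_mx (s x)) by rewrite -free_frame.
have fF : row_free (dfwd b (i x)).
  by apply/row_freeP; exists (dbwd b (fwd b (i x))); exact: dfwd_dbwd.
have fB : row_free B by rewrite /B /row_free (mxrankMfree _ fF).
split=> //.
have /submxP[C CE] : (frame_mx (s' x) <= frame_mx (s x))%MS.
  apply/row_subP => d; apply/submxP; apply/mem_span_frame; rewrite rowK sp.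
  by apply: (basis_mem (bs' x V'x)); exact: mem_tnth.
rewrite {1 2}CE -!mulmxA; congr (_ *m _).
rewrite !mulmxA -[X in _ = X *m _ *m _ *m _]/B.
by rewrite mulmxV ?mul1mx//; exact: gram_unitmx.
Qed.

Lemma dual_transition (c c' : dual_index n r X) (x : X) (y : 'rV[R]_r) (b : Defs.index M) :
  c.1.2 `<=` dom c.1.1 -> smooth_frame i S c.1.2 c.2 -> smooth_frame i S c'.1.2 c'.2 ->
  c.1.2 x -> c'.1.2 x -> dom b (i x) ->
  let B := frame_mx (c.2 x) *m dfwd b (i x) in
  fwd (p := dual_bundle r i S) c' (bwd (p := dual_bundle r i S) c (row_mx (fwd c.1.1 x) y)) =
  row_mx (fwd c'.1.1 x)
    (y *m (frame_mx (c'.2 x) *m dfwd b (i x) *m B^T *m invmx (B *m B^T))^T).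
Proof.
move=> Va sf sf' Vx V'x bx B.
have [fB E] := frame_change sf sf' Vx V'x bx.
rewrite dual_bwdE; last exact: Va.
rewrite /= /dual_fwd /=; congr row_mx; apply/rowP => d; rewrite mxE.
have -> : tnth (c'.2 x) d = row d (frame_mx (c'.2 x)) by rewrite rowK.
set K := _ *m invmx _; have -> : frame_mx (c'.2 x) = K *m frame_mx (c.2 x) by exact: E.
rewrite row_mul frame_functionalE; last by have [bs _] := sf; exact: bs.
by clearbody K; rewrite !mxE; apply: eq_bigr => l _; rewrite !mxE.
Qed.

Lemma dual_smooth (c c' : dual_index n r X) :
  Cinfty (fwd (p := dual_bundle r i S) c @`
      (dom (p := dual_bundle r i S) c `&` dom (p := dual_bundle r i S) c'))
    (fun z => fwd (p := dual_bundle r i S) c' (bwd (p := dual_bundle r i S) c z)).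
Proof.
apply: smooth_at_Cinfty => _ [e [ce ce'] <-].
have [oV Va sf Vx] := ce; have [oV' Va' sf' V'x] := ce'.
set x := projT1 e in Vx V'x; set z := fwd _ e.
pose a := c.1.1; pose a' := c'.1.1; pose b := pref (i x).
have bx : dom b (i x) := atlas_pref aM (i x).
pose B y := frame_mx (c.2 y) *m dfwd b (i y).
pose B' y := frame_mx (c'.2 y) *m dfwd b (i y).
pose K y := B' y *m (B y)^T *m invmx (B y *m (B y)^T).
have zE : lsubmx z = fwd a x by rewrite /z /= /dual_fwd row_mxKl.
have ax : dom a x by exact: Va.
have a'x : dom a' x by exact: Va'.
pose A := c.1.2 `&` c'.1.2 `&` i @^-1` dom b.
have oA : open A by apply: openI; [exact: openI|exact: open_preimage_dom].
have NA := chart_set_nbhs aX oA (conj (conj Vx V'x) bx) ax; rewrite -zE in NA.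
have sl : smooth_at (lsubmx : 'rV[R]_(k + r) -> 'rV[R]_k) z.
  by apply: smooth_at_lsubmx; exact: smooth_at_id.
apply: (@smooth_at_eq _ _ _ (fun z : 'rV[R]_(k + r) => row_mx
    (local_rep (M := X) (N := X) a a' (fun y => y) (lsubmx z))
    (rsubmx z *m (K (bwd a (lsubmx z)))^T))).
  apply: (@filterS _ (nbhs z)) (lsubmx_continuous NA) => z' [y [[[Vy V'y] by_] ay] yE].
  have -> : z' = row_mx (fwd a y) (rsubmx z') by rewrite yE hsubmxK.
  rewrite (dual_transition (rsubmx z') Va sf sf' Vy V'y by_) row_mxKl row_mxKr.
  by rewrite /local_rep (atlas_fwdK aX ay).
have sB : smooth_at (fun q => B (bwd a q)) (fwd a x).
  by apply/(mx_smoothP aX _ ax); exact: (frame_mx_smooth aX aM si oV sf Vx bx).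
have sB' : smooth_at (fun q => B' (bwd a q)) (fwd a x).
  by apply/(mx_smoothP aX _ ax); exact: (frame_mx_smooth aX aM si oV' sf' V'x bx).
have [_ s1] := chart_smooth_id aX ax a'x.
apply: smooth_at_row_mx; first by apply: smooth_at_comp => //; rewrite zE.
apply: smooth_at_mulmx; first by apply: smooth_at_rsubmx; exact: smooth_at_id.
apply: smooth_at_trmx.
apply: (@smooth_at_comp _ _ _ _ _ lsubmx (fun q => K (bwd a q))) => //; rewrite zE.
apply: smooth_at_mulmx; first by apply: smooth_at_mulmx => //; exact: smooth_at_trmx.
apply: smooth_at_invmx; last by apply: smooth_at_mulmx => //; exact: smooth_at_trmx.
rewrite (atlas_fwdK aX ax); apply: gram_unitmx.
by have [] := frame_change sf sf' Vx V'x bx.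
Qed.

Lemma dual_atlas : atlas (dual_bundle r i S).
Proof.
split=> [e|c e|c c'|]; last exact: dual_smooth.
- have [c ce] := dual_dom_ex e.
  exact: (@xgetPex {classic dual_index n r X} _ [set c | dom (p := dual_bundle r i S) c e]
    (ex_intro _ c ce)).
- exact: dual_fwdK.
(* Indices that are not genuine frames have empty domain, so every overlap with them is empty. *)
have [[oV Va sf]|nc] := pselect [/\ open c.1.2, c.1.2 `<=` dom c.1.1 & smooth_frame i S c.1.2 c.2];
    last first.
  rewrite (_ : _ @` _ = set0); first exact: open0.
  by apply/seteqP; split=> // z [e [[oV Va sf Vx] _] _]; apply: nc.
have [[oV' Va' sf']|nc] := pselect [/\ open c'.1.2, c'.1.2 `<=` dom c'.1.1 & smooth_frame i S c'.1.2 c'.2];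
    last first.
  rewrite (_ : _ @` _ = set0); first exact: open0.
  by apply/seteqP; split=> // z [e [_ [oV' Va' sf' Vx]] _]; apply: nc.
rewrite dual_image//; apply: open_comp => [z _|]; first exact: lsubmx_continuous.
rewrite openE => _ [x [Vx V'x] <-].
have ax := Va x Vx.
apply: (@filterS _ (nbhs (fwd c.1.1 x))) (chart_set_nbhs aX (openI oV oV') (conj Vx V'x) ax).
by move=> _ [y [Vy _] <-]; exists y.
Qed.

End DualBundleAtlas.

(** * The inclusion of the dual of the perp bundle *)

Section ConormalInclusion.
Variables (R : realType) (k n r : nat) (X : premanifold R k) (M : premanifold R n).
Variables (p : M -> 'M[R]_n) (i : X -> M).
Hypotheses (aX : atlas X) (aM : atlas M) (si : forall x, smooth_pt i x).
Hypotheses (fi : forall x, row_free (dmap i x)) (hp : poisson setT p).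
Hypothesis hr : coregular r p i.
Variable W : X -> {vspace 'rV[R]_n}.
Hypothesis hW : complement r p i W.

Let aE := dual_atlas aX aM si (perp_subbundle aX aM si fi hp hr).
Let aT := cotangent_atlas aM.

Lemma jcov_pairing (x : X) (xi : 'Hom(subvs_of (perp p i x), R^o)) (v : 'rV[R]_n) :
  (jcov W xi *m v^T) 0 0 = xi (vsproj (perp p i x) (daddv_pi (perp p i x) (W x) v)).
Proof.
rewrite [v in RHS]row_sum_delta !linear_sum mxE; apply: eq_bigr => d _.
by rewrite !linearZ /= !mxE mulrC.
Qed.

Lemma jcov_scale (x : X) (xi : 'Hom(subvs_of (perp p i x), R^o)) (t : R) :
  jcov W (t *: xi) = t *: jcov W xi.
Proof. by apply/rowP => d; rewrite !mxE scale_lfunE. Qed.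

Lemma jcov0 (x : X) : jcov W (0 : 'Hom(subvs_of (perp p i x), R^o)) = 0.
Proof. by apply/rowP => d; rewrite !mxE zero_lfunE. Qed.

Lemma jmap_zero_section (x : X) : jmap W (zero_section r i (perp p i) x) = (i x, 0).
Proof. by rewrite /jmap /= jcov0. Qed.

Section Frames.
Variables (x : X) (s : r.-tuple 'rV[R]_n) (w : (n - r).-tuple 'rV[R]_n).
Hypotheses (bs : basis_of (perp p i x) s) (bw : basis_of (W x) w).

Let B0 := col_mx (frame_mx s) (frame_mx w).

Lemma complement_frame_free : row_free B0.
Proof.
have [_ /(_ x)[_ cap]] := hW.
have /andP[/eqP sp fs] := bs; have /andP[/eqP sw fw] := bw.
rewrite -kermx_eq0; apply/eqP/row_matrixP => l; rewrite row0.
set u := row l _; have : u *m B0 = 0 by rewrite -row_mul mulmx_ker row0.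
rewrite -(hsubmxK u) mul_row_col => /eqP; rewrite addr_eq0 => /eqP E.
have Us : lsubmx u *m frame_mx s \in perp p i x.
  by rewrite -sp; apply/mem_span_frame; exists (lsubmx u).
have Uw : lsubmx u *m frame_mx s \in W x.
  by rewrite -sw E; apply/mem_span_frame; exists (- rsubmx u); rewrite mulNmx.
have zero : lsubmx u *m frame_mx s = 0.
  by apply/eqP; rewrite -memv0 -cap memv_cap Us Uw.
have l0 : lsubmx u = 0.
  by apply: (row_free_inj (A := frame_mx s)); rewrite -?free_frame//= zero mul0mx.
have r0 : rsubmx u = 0.
  apply: (row_free_inj (A := frame_mx w)); rewrite -?free_frame//= mul0mx.
  by apply/eqP; rewrite -oppr_eq0 -E zero.
by rewrite l0 r0 row_mx0.
Qed.

Lemma complement_frame_full : row_full B0.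
Proof.
(* Subtraction is truncated, so [r + (n - r)] is [n] only under this bound, which holds as [r] is
   the dimension of a subspace. *)
have rn : (r <= n)%N.
  rewrite -(perp_dim fi hp hr x).
  by apply: leq_trans (dimvS (subvf _)) _; rewrite dimvf /dim /= mul1n.
by rewrite /row_full (eqP complement_frame_free) subnKC.
Qed.

(** The projection along [W] fixes the vectors of [s] and kills those of [w]. *)
Lemma jcov_frame (xi : 'Hom(subvs_of (perp p i x), R^o)) :
  jcov W xi *m B0^T = row_mx (\row_d xi (vsproj (perp p i x) (tnth s d))) 0.
Proof.
have [_ /(_ x)[sumPW cap]] := hW.
have /andP[/eqP sp fs] := bs; have /andP[/eqP sw fw] := bw.
have entry (u : 'rV[R]_n) a (A : 'M[R]_(a, n)) d : (u *m A^T) 0 d = (u *m (row d A)^T) 0 0.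
  by rewrite !mxE; apply: eq_bigr => l _; rewrite !mxE.
rewrite tr_col_mx mul_mx_row; congr row_mx; apply/rowP => d; rewrite entry rowK jcov_pairing.
  rewrite mxE daddv_pi_id//.
  by apply: (basis_mem bs); exact: mem_tnth.
rewrite [RHS]mxE; set v := tnth w d.
have vW : v \in W x by apply: (basis_mem bw); exact: mem_tnth.
have := daddv_pi_add cap (_ : v \in (perp p i x + W x)%VS).
rewrite sumPW memvf => /(_ isT); rewrite (@daddv_pi_id _ _ (W x))//; last by rewrite capvC.
by move/eqP; rewrite -subr_eq0 addrK => /eqP ->; rewrite !linear0.
Qed.

(** [B] is in effect an invertible matrix, but with [r + (n - r)] rows and [n] columns, two types
    that do not match; [invmx (B *m B^T) *m B] expresses the inverse of its transpose. *)
Lemma jcov_chart (b : Defs.index M) (xi : 'Hom(subvs_of (perp p i x), R^o)) :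
  dom b (i x) ->
  let B := B0 *m dfwd b (i x) in
  jcov W xi *m (dbwd b (fwd b (i x)))^T =
  row_mx (\row_d xi (vsproj (perp p i x) (tnth s d))) 0 *m invmx (B *m B^T) *m B /\
  row_free B.
Proof.
move=> bx B.
have fF : row_free (dfwd b (i x)).
  by apply/row_freeP; exists (dbwd b (fwd b (i x))); exact: dfwd_dbwd.
have fB : row_free B by rewrite /B /row_free (mxrankMfree _ fF); exact: complement_frame_free.
split=> //.
have fBT : row_free B^T.
  rewrite /row_free mxrank_tr /B (mxrankMfree _ fF).
  exact: complement_frame_full.
apply: (row_free_inj fBT) => /=.
rewrite -(mulmxA _ B B^T) mulmxKV; last exact: gram_unitmx.
rewrite -jcov_frame /B trmx_mul mulmxA -(mulmxA (jcov W xi)) -trmx_mul.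
by rewrite (dfwd_dbwd aM bx) trmx1 mulmx1.
Qed.

End Frames.

Lemma jmap_chart_smooth (c : dual_index n r X) (e : perp_dual r p i) (b : Defs.index M) :
  dom (p := perp_dual r p i) c e -> dom b (i (projT1 e)) ->
  chart_smooth (M := perp_dual r p i) (N := cotangent M) c b (jmap W) e.
Proof.
move=> ce bx; have [oV Va sf Vx] := ce; set x := projT1 e in bx Vx.
have [/(_ x)[V' [w [oV' V'x sw]]] _] := hW.
pose a := c.1.1; pose z := fwd (p := perp_dual r p i) c e.
have zE : lsubmx z = fwd a x by rewrite /z /= /dual_fwd row_mxKl.
have ax : dom a x by exact: Va.
pose A := c.1.2 `&` V' `&` i @^-1` dom b.
have oA : open A by apply: openI; [exact: openI|exact: open_preimage_dom].
pose B y := col_mx (frame_mx (c.2 y)) (frame_mx (w y)) *m dfwd b (i y).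
(* Coordinates of j in smooth form: the fiber coordinates are values on the frame, which
   [jcov_chart] converts to a covector in the chart [b]. *)
pose H (z : 'rV[R]_(k + r)) : 'rV[R]_(n + n) := row_mx (local_rep a b i (lsubmx z))
  ((row_mx (rsubmx z) 0 : 'rV[R]_(r + (n - r))) *m
   invmx (B (bwd a (lsubmx z)) *m (B (bwd a (lsubmx z)))^T) *m B (bwd a (lsubmx z))).
have NA := chart_set_nbhs aX oA (conj (conj Vx V'x) bx) ax; rewrite -zE in NA.
have N2 : \forall z' \near z, dom b (i (projT1 (bwd (p := perp_dual r p i) c z'))) /\
    local_rep (M := perp_dual r p i) (N := cotangent M) c b (jmap W) z' = H z'.
  apply: (@filterS _ (nbhs z)) (lsubmx_continuous NA) => z' [y [[[Vy V'y] by_] ay] yE].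
  have z'E : z' = row_mx (fwd a y) (rsubmx z') by rewrite yE hsubmxK.
  have bE : bwd (p := perp_dual r p i) c z' = dual_frame_pt i (perp p i) c.2 (rsubmx z') y.
    by rewrite z'E [in RHS]row_mxKr; apply: (dual_bwdE i (perp p i) aX); exact: Va.
  split; first by rewrite bE; exact: by_.
  rewrite /local_rep bE /H -yE /local_rep (atlas_fwdK aX ay).
  apply: (congr1 (row_mx (fwd b (i y)))).
  have [E _] := jcov_chart (sf.1 y Vy) (sw.1 y V'y)
    (frame_functional (perp p i) c.2 (rsubmx z') y) by_.
  apply: etrans E _; congr (row_mx _ _ *m _ *m _); apply/rowP => d.
  rewrite [LHS]mxE; apply: frame_functional_tnth; exact: (sf.1 y Vy).
split.
  by apply: (@filterS _ (nbhs z)) N2 => z' [].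
apply: (@smooth_at_eq _ _ _ H).
  by apply: (@filterS _ (nbhs z)) N2 => z' [].
have sl : smooth_at (lsubmx : 'rV[R]_(k + r) -> 'rV[R]_k) z.
  by apply: smooth_at_lsubmx; exact: smooth_at_id.
have [_ s1] := smooth_pt_charts aX aM (si x) ax bx.
have sB : smooth_at (fun q => B (bwd a q)) (fwd a x).
  refine (proj1 (mx_smoothP aX B ax) _).
  apply: (@mx_smooth_eq _ _ _ aX _ _ A
    (fun y => col_mx (frame_mx (c.2 y) *m dfwd b (i y)) (frame_mx (w y) *m dfwd b (i y))) _ _ oA).
  - by [].
  - by move=> y _; rewrite /B mul_col_mx.
  - apply: smooth_at_col_mx; first exact: (frame_mx_smooth aX aM si oV sf Vx bx).
    exact: (frame_mx_smooth aX aM si oV' sw V'x bx).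
have sBl : smooth_at (fun z : 'rV[R]_(k + r) => B (bwd a (lsubmx z))) z.
  by apply: (@smooth_at_comp _ _ _ _ _ lsubmx (fun q => B (bwd a q))) => //; rewrite zE.
apply: smooth_at_row_mx; first by apply: smooth_at_comp => //; rewrite zE.
apply: smooth_at_mulmx => //; apply: smooth_at_mulmx.
  apply: smooth_at_row_mx; last exact: smooth_at_cst.
  by apply: smooth_at_rsubmx; exact: smooth_at_id.
apply: smooth_at_invmx; last by apply: smooth_at_mulmx => //; exact: smooth_at_trmx.
rewrite zE (atlas_fwdK aX ax); apply: gram_unitmx.
by have [_ fB] := jcov_chart (sf.1 x Vx) (sw.1 x V'x) (projT2 e) bx.
Qed.

Lemma jmap_smooth_pt (e : perp_dual r p i) : smooth_pt (jmap W) e.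
Proof.
have px := atlas_pref aE e; have py := atlas_pref aM (i (projT1 e)).
exists (pref e), (pref (i (projT1 e))); split=> //.
exact: jmap_chart_smooth.
Qed.

End ConormalInclusion.

(** * The zero section and the differential of j along it *)

Section ZeroSection.
Variables (R : realType) (k n r : nat) (X : premanifold R k) (M : premanifold R n).
Variables (i : X -> M) (S : X -> {vspace 'rV[R]_n}).
Hypotheses (aX : atlas X) (aM : atlas M) (si : forall x, smooth_pt i x).
Hypothesis hS : subbundle r i S.

Let aE := dual_atlas aX aM si hS.

Lemma dual_pr_smooth_pt (e : dual_bundle r i S) :
  smooth_pt (M := dual_bundle r i S) (@dual_pr R k n r X M i S) e.
Proof.
pose c : dual_index n r X := pref e; have ce : dom (p := dual_bundle r i S) c e := atlas_pref aE e.
have [oV Va sf Vx] := ce; have ax : dom c.1.1 (projT1 e) := Va _ Vx.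
exists c, c.1.1; split=> //.
pose z := fwd (p := dual_bundle r i S) c e.
have zE : lsubmx z = fwd c.1.1 (projT1 e) by rewrite /z /= /dual_fwd row_mxKl.
have N := chart_image_nbhs aX ax ax; rewrite -zE in N.
split.
  apply: (@filterS _ (nbhs z)) (lsubmx_continuous N) => z' [y [ay _] yE].
  by rewrite /= /dual_pr /= -yE (atlas_fwdK aX ay).
apply: (@smooth_at_eq _ _ _ lsubmx); last by apply: smooth_at_lsubmx; exact: smooth_at_id.
apply: (@filterS _ (nbhs z)) (lsubmx_continuous N) => z' [y [ay _] yE].
by rewrite /local_rep /= /dual_pr /= -yE (atlas_fwdK aX ay).
Qed.

Lemma zero_section_smooth_pt (x : X) :
  smooth_pt (N := dual_bundle r i S) (zero_section r i S) x.
Proof.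
pose e := zero_section r i S x; pose c : dual_index n r X := pref e.
have ce : dom (p := dual_bundle r i S) c e := atlas_pref aE e.
have [oV Va sf Vx] := ce; have ax : dom c.1.1 x := Va _ Vx.
exists c.1.1, c; split=> //.
have N := chart_set_nbhs aX oV Vx ax.
split.
  apply: (@filterS _ (nbhs (fwd c.1.1 x))) N => _ [y [Vy ay] <-].
  by rewrite (atlas_fwdK aX ay); split.
apply: (@smooth_at_eq _ _ _ (fun z => row_mx z 0)); last first.
  by apply: smooth_at_row_mx; [exact: smooth_at_id|exact: smooth_at_cst].
apply: (@filterS _ (nbhs (fwd c.1.1 x))) N => _ [y [Vy ay] <-].
rewrite /local_rep (atlas_fwdK aX ay) /= /dual_fwd /=; congr row_mx.
by apply/rowP => d; rewrite !mxE zero_lfunE.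
Qed.

Lemma derive_affine (V : normedModType R) (z u : V) : 'D_1 (fun s : R => z + s *: u) 0 = u.
Proof. by rewrite (derive_line id) derive_id. Qed.

Lemma dual_fwd_scale (x : X) (xi : 'Hom(subvs_of (S x), R^o)) (c : dual_index n r X) (s : R) :
  fwd (p := dual_bundle r i S) c (dual_pt r i (s *: xi)) =
  fwd (p := dual_bundle r i S) c (zero_section r i S x) +
  s *: row_mx 0 (\row_d xi (vsproj (S x) (tnth (c.2 x) d))).
Proof.
rewrite /= /dual_fwd /= scale_row_mx add_row_mx scaler0 addr0; congr row_mx.
by apply/rowP => d; rewrite !mxE scale_lfunE zero_lfunE add0r.
Qed.

Lemma verticalE (x : X) (xi : 'Hom(subvs_of (S x), R^o)) :
  vertical r i xi = row_mx 0 (\row_d xi (vsproj (S x)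
    (tnth ((pref (zero_section r i S x) : dual_index n r X).2 x) d))).
Proof.
rewrite /vertical /velocity scale0r derive1E -[RHS](derive_affine
  (fwd (p := dual_bundle r i S) (pref (zero_section r i S x)) (zero_section r i S x))).
by congr ('D_(1 : R) _ (0 : R)); apply/funext => s; exact: dual_fwd_scale.
Qed.

End ZeroSection.

Section ConormalInclusionDifferential.
Variables (R : realType) (k n r : nat) (X : premanifold R k) (M : premanifold R n).
Variables (p : M -> 'M[R]_n) (i : X -> M).
Hypotheses (aX : atlas X) (aM : atlas M) (si : forall x, smooth_pt i x).
Hypotheses (fi : forall x, row_free (dmap i x)) (hp : poisson setT p).
Hypothesis hr : coregular r p i.
Variable W : X -> {vspace 'rV[R]_n}.
Hypothesis hW : complement r p i W.

Let hS := perp_subbundle aX aM si fi hp hr.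
Let aE := dual_atlas aX aM si hS.
Let aT := cotangent_atlas aM.
Let zero := zero_section r i (perp p i).

Lemma dmap_zero_covector (x : X) :
  dmap (N := cotangent M) (fun y => (i y, 0 : 'rV[R]_n)) x = row_mx (dmap i x) 0.
Proof.
have px := atlas_pref aX x; have py := atlas_pref aM (i x).
have [_ s] := smooth_pt_charts aX aM (si x) px py.
pose C : 'M[R]_(n, n + n) := row_mx 1%:M 0.
pose L : {linear 'rV[R]_n -> 'rV[R]_(n + n)} := mulmxr C.
have sL z : smooth_at L z.
  by apply: smooth_at_mulmx; [exact: smooth_at_id|exact: smooth_at_cst].
transitivity (jacobian (fun z => L (local_rep (pref x) (pref (i x)) i z)) (fwd (pref x) x)).
  congr jacobian; apply/funext => z.
  by rewrite /= mul0mx mul_mx_row mulmx1 mulmx0.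
rewrite (jacobian_comp (g := L)); [|exact: smooth_at_differentiable..].
rewrite jacobian_linear; last by move=> z; exact/smooth_at_continuous/sL.
have -> : lin1_mx L = C by apply/row_matrixP => d; rewrite !rowE mul_rV_lin1.
by rewrite mul_mx_row mulmx1 mulmx0.
Qed.

(** Chain rule: j carries the zero section to the zero covectors over the image of i. *)
Lemma horizontal_dmap_jmap (x : X) (v : 'rV[R]_k) :
  horizontal r i (perp p i) x v *m dmap (jmap W) (zero x) = row_mx (v *m dmap i x) 0.
Proof.
have [_ E] := dmap_comp aX aE aT (zero_section_smooth_pt aX aM si hS x)
  (jmap_smooth_pt aX aM si fi hp hr hW (zero x)).
have EF : (fun y => jmap W (zero y)) = (fun y => (i y, 0 : 'rV[R]_n) : cotangent M).
  by apply/funext => y; exact: jmap_zero_section.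
have {}E := etrans (esym E) (congr1 (fun F => dmap (N := cotangent M) F x) EF).
apply: etrans (esym (mulmxA _ _ _)) _; rewrite E dmap_zero_covector.
by rewrite mul_mx_row mulmx0.
Qed.

Lemma dbwd_pref (y : M) : dbwd (pref y) (fwd (pref y) y) = 1%:M.
Proof. by rewrite (dbwdE aM) ?(chart_jacobian_id aM)//; exact: atlas_pref. Qed.

(** [jcov] is linear on fibers, so the line [t *: xi] goes to an affine curve in the chart of the
    cotangent bundle. *)
Lemma vertical_dmap_jmap (x : X) (xi : 'Hom(subvs_of (perp p i x), R^o)) :
  vertical r i xi *m dmap (jmap W) (zero x) = row_mx 0 (jcov W xi).
Proof.
pose c : dual_index n r X := pref (zero x).
have cz : dom (p := perp_dual r p i) c (zero x) := atlas_pref aE (zero x).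
have sj := jmap_smooth_pt aX aM si fi hp hr hW (zero x).
have [_ s] := smooth_pt_charts aE aT sj cz (atlas_pref aT (jmap W (zero x))).
rewrite verticalE dmapE /chart_jacobian -deriveEjacobian; last exact: smooth_at_differentiable.
set u := row_mx 0 _; set F := local_rep _ _ _; set z := fwd _ _.
rewrite -[X in 'D_u F X]addr0 -[X in z + X](scale0r u) -derive_line.
rewrite -[RHS](derive_affine (row_mx (fwd (pref (i x)) (i x)) 0)).
congr ('D_(1 : R) _ (0 : R)); apply/funext => t.
rewrite /F /z -/c -dual_fwd_scale /local_rep dual_fwdK//.
rewrite [in LHS]/= jcov_scale dbwd_pref trmx1 mulmx1.
by rewrite scale_row_mx add_row_mx scaler0 addr0 add0r.
Qed.

End ConormalInclusionDifferential.

(** * Transport to the local model *)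

Section TensorLemmas.
Variable R : realType.

Lemma dmap_id (n : nat) (M : premanifold R n) (x : M) :
  atlas M -> dmap (fun y => y) x = 1%:M.
Proof. by move=> aM; rewrite dmapE (chart_jacobian_id aM)//; exact: atlas_pref. Qed.

Lemma dmap_inverse (m n : nat) (M : premanifold R m) (N : premanifold R n) (A : set M)
    (f : M -> N) (g : N -> M) (x : M) :
  atlas M -> atlas N -> open A -> A x -> (forall y, A y -> g (f y) = y) ->
  smooth_pt f x -> smooth_pt g (f x) -> dmap f x *m dmap g (f x) = 1%:M.
Proof.
move=> aM aN oA Ax gf sf sg; have [s <-] := dmap_comp aM aN aM sf sg.
have [_ <-] := near_eq_dmap aM aM oA Ax gf s.
exact: dmap_id.
Qed.

Lemma closed_two_form_opp (n : nat) (M : premanifold R n) (A : set M) (w : M -> 'M[R]_n) :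
  atlas M -> open A -> closed_two_form A w -> closed_two_form A (fun x => - w x).
Proof.
move=> aM oA [[skew sw] cw].
have E (a : Defs.index M) : form_in_chart a (fun x => - w x) = (fun z => - form_in_chart a w z).
  by apply/funext => z; rewrite /form_in_chart mulmxN mulNmx.
have s (a : Defs.index M) (z : 'rV[R]_n) : (fwd a @` (A `&` dom a)) z ->
    smooth_at (form_in_chart a w) z.
  move=> [x [Ax ax] <-]; apply: Cinfty_smooth_at (sw a).
  exact: chart_set_nbhs.
split; first split=> [x Ax|a].
- by rewrite linearN /= skew.
- by rewrite E; apply: smooth_at_Cinfty => z /s; exact: smooth_atN.
move=> a z az k l h.
have pdN c i j : pd c (fun y => form_in_chart a (fun x => - w x) y i j) z =
    - pd c (fun y => form_in_chart a w y i j) z.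
  transitivity (pd c (fun y => - (form_in_chart a w y i j)) z).
    by congr (pd c _ z); apply/funext => y; rewrite E oppmxE.
  apply: deriveN; apply: diff_derivable.
  exact: smooth_at_differentiable (smooth_at_entry i j (s a z az)).
by rewrite !pdN -!opprD (cw a z az) oppr0.
Qed.

Lemma bil_opp_congruence (m n : nat) (J : 'M[R]_(m, n)) (w : 'M[R]_n) (u v : 'rV[R]_m) :
  bil (- (J *m w *m J^T)) u v = - bil w (u *m J) (v *m J).
Proof. by rewrite /bil mulmxN mulNmx oppmxE trmx_mul !mulmxA. Qed.

(** The block matrix is the value of Omega at a zero covector; the two summands on the right become
    [sigma] and [tau] along the zero section. *)
Lemma bil_zero_section (n : nat) (p : 'M[R]_n) (a1 b1 a2 b2 : 'rV[R]_n) :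
  bil (block_mx 0 1%:M (- 1%:M) p) (row_mx a1 b1) (row_mx a2 b2) =
  bil p b1 b2 + (pairing b2 a1 - pairing b1 a2).
Proof.
have pairingC (a b : 'rV[R]_n) : pairing a b = (b *m a^T) 0 0.
  by rewrite /pairing -[in RHS](trmxK b) -trmx_mul [RHS]mxE.
rewrite (pairingC b2) /bil /pairing mul_row_block tr_row_mx mul_row_col.
rewrite mulmx0 add0r mulmx1 mulmxN mulmx1 mulNmx mulmxDl !addmxE oppmxE.
by rewrite addrC -addrA addrCA.
Qed.

End TensorLemmas.

Unset Implicit Arguments.
Set Strict Implicit.
Set Printing Implicit Defensive.

Theorem theorem3p2 (R : realType) (n k r q : nat)
  (M : premanifold R n) (hM : is_manifold M)
  (p : M -> 'M[R]_n) (hp : poisson setT p)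
  (X : premanifold R k) (hX : is_manifold X) (i : X -> M) (hi : embedding i)
  (hcoreg : coregular r p i)
  (W : X -> {vspace 'rV[R]_n}) (hW : complement r p i W)
  (chi : cotangent M -> 'rV[R]_(n + n)) (hchi : poisson_spray p chi)
  (Sg : set (cotangent M)) (hSg : zero_nbhd Sg)
  (phi : R -> cotangent M -> cotangent M) (hphi : is_flow chi Sg phi)
  (hsymp : symplectic Sg (Omega phi))
  (hdual : full_dual_pair Sg (Omega phi) (@cpr R n M) (spray_exp phi)
             p (fun x => - p x))
  (P : premanifold R q) (iP : P -> M) (pP : P -> 'M[R]_q)
  (f : perp_dual r p i -> P)
  (hP : local_saturation W Sg (spray_exp phi) iP pP f) :
  let j : perp_dual r p i -> cotangent M := @jmap R k n r X M p i W in
  let eta := fun e : perp_dual r p i => - pullback_form j (Omega phi) e in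
  extension W (j @^-1` Sg) eta /\
  exists (U : set (perp_dual r p i))
         (pU : perp_dual r p i -> 'M[R]_(k + r)) (B : set P),
    [/\ U `<=` j @^-1` Sg,
        open U /\ (forall x, U (zero_section r i (perp p i) x)),
        local_model U eta pU,
        open B /\ range i `<=` iP @` B &
        diffeo U B f /\ poisson_map U f pU pP].
Proof.
move=> j eta.
have aM := manifold_atlas hM; have aX := manifold_atlas hX.
have [smi fi _ _] := hi.
have si x : smooth_pt i x := smooth_map_pt aX aM openT smi I.
have hS := perp_subbundle aX aM si fi hp hcoreg.
have aE : atlas (perp_dual r p i) := dual_atlas aX aM si hS.
have aT := cotangent_atlas aM.
have [oSg Sg0] := hSg; have [cO uO] := hsymp.
have skewp x : (p x)^T = - p x by have [H _ _] := hp; exact: H.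
have sj e : smooth_pt j e := jmap_smooth_pt aX aM si fi hp hcoreg hW e.
have [[mP eP] _ subP [_ [poisP mapP]] [fE df]] := hP.
have aP := manifold_atlas mP; have [smP fP _ _] := eP.
have [oU _ [_ injf surf] smf [g [smg gf]]] := df.
set U : set (perp_dual r p i) := jmap W @^-1` Sg in oU injf surf smf gf.
have zU x : U (zero_section r i (perp p i) x) by rewrite /U /= jmap_zero_section.
have gU y : U (g y) /\ f (g y) = y.
  by have [e Ue <-] := surf y I; rewrite gf.
have sf e : U e -> smooth_pt f e := smooth_map_pt aE aP oU smf.
have sg y : smooth_pt g y := smooth_map_pt aP aE openT smg I.
split.
  split=> //.
    apply: (closed_two_form_opp aE oU).
    exact: (closed_two_form_pullback aE aT oU oSg (fun e _ => sj e) (fun e Ue => Ue) cO).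
  move=> x v1 v2 xi1 xi2.
  have hJ v (xi : 'Hom(subvs_of (perp p i x), R^o)) :
      (horizontal r i (perp p i) x v + vertical r i xi) *m
        dmap j (zero_section r i (perp p i) x) = row_mx (v *m dmap i x) (jcov W xi).
    rewrite mulmxDl (horizontal_dmap_jmap aX aM si fi hp hcoreg hW).
    by rewrite (vertical_dmap_jmap aX aM si fi hp hcoreg hW) add_row_mx addr0 add0r.
  set zx := zero_section r i (perp p i) x in hJ *.
  have O0 : Omega phi (j zx) = block_mx 0 1%:M (- 1%:M) (p (i x)).
    rewrite (_ : j zx = (i x, 0)); last exact: jmap_zero_section.
    exact: (Omega_zero aM hchi hSg hphi skewp).
  apply: etrans (bil_opp_congruence (dmap j zx) (Omega phi (j zx)) _ _) _.
  rewrite O0; apply: etrans (congr1 -%R (congr2 (bil _) (hJ v1 xi1) (hJ v2 xi2))) _.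
  by rewrite bil_zero_section opprD.
have FG e : U e -> dmap f e *m dmap g (f e) = 1%:M.
  by move=> Ue; exact: (dmap_inverse aE aP oU Ue gf (sf e Ue) (sg _)).
have GF e : U e -> dmap g (f e) *m dmap f e = 1%:M.
  move=> Ue; rewrite -[X in dmap f X](gf e Ue).
  apply: (dmap_inverse aP aE openT I (fun y _ => (gU y).2) (sg _)).
  by rewrite gf//; exact: sf.
(* [G e] inverts the differential of f, so [pU] is the pushforward of [pP] along [g]. *)
pose G e := dmap g (f e).
pose pU e := (G e)^T *m pP (f e) *m G e.
(* The saturation is by hypothesis the diffeomorphic image of all of the preimage of [Sg], so no
   shrinking takes place and the neighborhood of X is P itself. *)
exists U, pU, setT; split=> //.
- split.
    apply: (poisson_pushforward aE aP oU openT sf _ (fun y _ => sg y) _ gf _ _ poisP) => //.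
      by move=> y _; have [] := gU y.
    by move=> y _; have [] := gU y.
  move=> e Ue; apply/predeqP => -[v a].
  have [[[scpr _ _] mcpr] [[sex _ _] mex] orth] := hdual.
  have cpr_pt : smooth_pt (@cpr R n M) (j e) := smooth_map_pt aT aM oSg scpr Ue.
  have ex_pt : smooth_pt (spray_exp phi) (j e) := smooth_map_pt aT aM oSg sex Ue.
  have iP_pt : smooth_pt iP (f e) := smooth_map_pt aP aM openT smP I.
  have [_ AD] := dmap_comp aE aX aM (dual_pr_smooth_pt aX aM si hS e) (si (dual_pr e)).
  have [_ JS] := dmap_comp aE aT aM (sj e) cpr_pt.
  have [sFI FI] := dmap_comp aE aP aM (sf e Ue) iP_pt.
  have [_ JT] := dmap_comp aE aT aM (sj e) ex_pt.
  (* The composites of f with the inclusion of P and of j with exp agree only on [U]; openness of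
     [U] gives equality of their differentials. *)
  have [_ FJ] := near_eq_dmap aE aM oU Ue fE sFI.
  have hI : (dmap iP (f e))^T *m pP (f e) *m dmap iP (f e) = p (spray_exp phi (j e)).
    by rewrite -(fE _ Ue); exact: mapP.
  have skO : (Omega phi (j e))^T = - Omega phi (j e) by have [[H _] _] := cO; exact: H.
  (* Passes from the scalar [bil] to the 1 by 1 matrix equation in [local_model_graph]. *)
  have orth' (u : 'rV[R]_(n + n)) :
      (forall v : 'rV[R]_(n + n), v *m dmap (@cpr R n M) (j e) = 0 ->
        u *m Omega phi (j e) *m v^T = 0) <-> u *m dmap (spray_exp phi) (j e) = 0.
    apply: iff_trans (orth _ Ue u); split=> H v' /H E; last first.
      by apply/matrixP => l l'; rewrite !ord1 [RHS]mxE; exact: E.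
    exact: (etrans (congr1 (fun A : 'M[R]_1 => A 0 0) E) (mxE _ _ _ _)).
  exact: (local_model_graph (uO _ Ue) skO (mcpr _ Ue) (mex _ Ue) orth'
    (etrans (esym AD) JS) (etrans (etrans (esym FI) (esym FJ)) JT) (FG e Ue) (GF e Ue) (fP _) hI).
- by split; [exact: openT|move=> _ [x _ <-]; have [y _ <-] := subP _ (imageT i x); exists y].
- split=> // e Ue; rewrite /pU /G.
  by rewrite !mulmxA -trmx_mul (GF e Ue) trmx1 mul1mx -mulmxA (GF e Ue) mulmx1.
Qed.
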